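(* Let $G$ be a compact Lie group and let $A$ be a finite maximal abelian subgroup of $G$. Let $G'=\langle A,G_{(p_1)}^0,\dots,G_{(p_s)}^0\rangle$, where $p_1,\dots,p_s$ are the distinct primes dividing the order of the image of $A$ under the adjoint homomorphism. Then $$W_{small}(G',A)=W_{small}(G,A).$$
   Context: $G$ is a compact Lie group, $\mathfrak{g}_0$ its real Lie algebra, $\mathfrak{g}=\mathfrak g_0\otimes_{\mathbb R}\mathbb C$, $\pi:G\to\mathrm{Aut}(\mathfrak{g}_0)$ the adjoint homomorphism, $n=|\pi(A)|$. For a prime $p\mid n$ let $k\ge1$ be the largest integer with $p^k\mid n$, $A_{(p)}=\{g\in A:\pi(g)^{n/p^k}=1\}$, and $G_{(p)}=Z_G(A_{(p)})$, with identity component $G_{(p)}^0$. The identity components for distinct primes commute, and $G'$ is a compact subgroup of $G$ containing $A$. Small Weyl group for a finite abelian subgroup $A$ of a compact Lie group $H$ with $Z_{\mathfrak{h}}(A)=0$ (apply with $H=G$ and $H=G'$), where $\mathfrak{h}_0$ is the real Lie algebra of $H$ and $\mathfrak{h}=\mathfrak{h}_0\otimes\mathbb{C}$: $X^*(A)=\mathrm{Hom}(A,\mathrm{U}(1))$, written additively; $\mathfrak{h}_\lambda=\{Y\in\mathfrak{h}:\mathrm{Ad}(a)Y=\lambda(a)Y\ \forall a\in A\}$; roots are the $\alpha\in X^*(A)-\{0\}$ with $\mathfrak{h}_\alpha\neq0$. For a root $\alpha$, $\mathfrak{h}_{[\alpha]}=\bigoplus_{\mu\in\mathbb{Z}\alpha,\,\mu\ne0}\mathfrak{h}_\mu$,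 $H_{[\alpha]}$ is the connected Lie subgroup with Lie algebra $\mathfrak{h}_0\cap\mathfrak{h}_{[\alpha]}$ (a torus, with $A\cap H_{[\alpha]}\subset\ker\alpha$), $R^\vee(\alpha)=\mathrm{Hom}(A/\ker\alpha,\,A\cap H_{[\alpha]})$, and for $\xi\in R^\vee(\alpha)$, $s_{\alpha,\xi}:A\to A$ is the automorphism $s_{\alpha,\xi}(a)=a\,\xi(a)$. $W_{small}(H,A)$ is the group of automorphisms of $A$ generated by all $s_{\alpha,\xi}$ ($\alpha$ a root, $\xi\in R^\vee(\alpha)$). *)

(* Defs.v *)
From HB Require Import structures.
From mathcomp Require Import all_boot all_order all_algebra.
From mathcomp Require Import finmap.
From mathcomp Require Import complex.
From mathcomp Require Import all_classical all_reals all_analysis.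

Set Implicit Arguments.
Unset Strict Implicit.
Unset Printing Implicit Defensive.

Import Order.TTheory GRing.Theory Num.Theory.
Import numFieldNormedType.Exports.

Local Open Scope classical_set_scope.
Local Open Scope ring_scope.

(* Compatibility of the group law with the topology is part of
   [lie_structure] below. *)
HB.structure Definition TopologyGroup := {T of Topological T & Group T}.

(* [Ck_on k U f], for [U] open: the partial derivatives of [f] of order at
   most [k] exist and are continuous on [U]. *)
Fixpoint Ck_on (R : realType) (d e k : nat) (U : set 'rV[R]_d)
    (f : 'rV[R]_d -> 'rV[R]_e) : Prop :=
  (forall x, U x -> {for x, continuous f}) /\
  (if k is k'.+1 then
     forall i : 'I_d,
       (forall x, U x -> derivable f x (delta_mx 0 i)) /\
       Ck_on k' U (fun x => 'D_(delta_mx 0 i) f x)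
   else True).

Definition smooth_on (R : realType) (d e : nat) (U : set 'rV[R]_d)
    (f : 'rV[R]_d -> 'rV[R]_e) : Prop :=
  forall k, Ck_on k U f.

(* [chart_map] and [chart_inv] are total functions, of which only the
   restrictions to [chart_dom] and to [chart_map @` chart_dom] are
   meaningful. *)
Record chart (R : realType) (d : nat) (T : topologicalType) := Chart {
  chart_dom : set T;
  chart_map : T -> 'rV[R]_d;
  chart_inv : 'rV[R]_d -> T;
  chart_dom_open : open chart_dom;
  chart_cod_open : open (chart_map @` chart_dom);
  chart_mapK : forall x, chart_dom x -> chart_inv (chart_map x) = x;
  chart_map_continuous : forall x, chart_dom x ->
    {for x, continuous chart_map};
  chart_inv_continuous : forall v, (chart_map @` chart_dom) v ->
    {for v, continuous chart_inv}
}.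

Definition chart_cod (R : realType) (d : nat) (T : topologicalType)
  (c : chart R d T) : set 'rV[R]_d := chart_map c @` chart_dom c.

Record lie_structure (R : realType) (d : nat) (G : TopologyGroup.type) :=
    LieStructure {
  atlas : set (chart R d G);
  chart_at : G -> chart R d G;
  chart_at_atlas : forall x, atlas (chart_at x);
  mem_chart_at : forall x, chart_dom (chart_at x) x;
  transition_smooth : forall c c', atlas c -> atlas c' ->
    smooth_on (chart_map c @` (chart_dom c `&` chart_dom c'))
      (chart_map c' \o chart_inv c);
  lie_hausdorff : hausdorff_space G;
  lie_second_countable : @second_countable G;
  mulg_continuous : continuous (fun xy : G * G => (xy.1 * xy.2)%g);
  mulg_smooth : forall c1 c2 c3, atlas c1 -> atlas c2 -> atlas c3 ->
    smooth_on
      [set v : 'rV[R]_(d + d) | [/\ chart_cod c1 (lsubmx v),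
         chart_cod c2 (rsubmx v) &
         chart_dom c3 (chart_inv c1 (lsubmx v) * chart_inv c2 (rsubmx v))%g]]
      (fun v =>
         chart_map c3 (chart_inv c1 (lsubmx v) * chart_inv c2 (rsubmx v))%g);
  invg_continuous : continuous (fun x : G => (x^-1)%g);
  invg_smooth : forall c c', atlas c -> atlas c' ->
    smooth_on [set v | chart_cod c v /\ chart_dom c' ((chart_inv c v)^-1)%g]
      (fun v => chart_map c' ((chart_inv c v)^-1)%g)
}.

Definition subgroup (G : groupType) (H : set G) : Prop :=
  [/\ H 1%g, (forall x y, H x -> H y -> H (x * y)%g)
    & (forall x, H x -> H (x^-1)%g)].

Definition generated (G : groupType) (S : set G) : set G :=
  \bigcap_(H in [set H : set G | subgroup H /\ S `<=` H]) H.

Definition centralizer (G : groupType) (S : set G) : set G :=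
  [set x | forall y, S y -> (x * y)%g = (y * x)%g].

Definition abelian_subgroup (G : groupType) (A : set G) : Prop :=
  subgroup A /\ (forall x y, A x -> A y -> (x * y)%g = (y * x)%g).

Definition maximal_abelian (G : groupType) (A : set G) : Prop :=
  abelian_subgroup A /\
  (forall B, abelian_subgroup B -> A `<=` B -> B = A).

(* Homomorphisms out of [A] are functions on the type of elements of [A].
   As [A] is only a set, its product is expressed in [G]. *)
Definition character (R : realType) (G : groupType) (A : set G)
    (chi : A -> R[i]) : Prop :=
  (forall a, `|chi a| = 1) /\
  (forall a b c : A, val c = (val a * val b)%g -> chi c = chi a * chi b).

Definition endomorphism (G : groupType) (A : set G) (f : A -> A) : Prop :=
  forall a b c : A,
    val c = (val a * val b)%g -> val (f c) = (val (f a) * val (f b))%g.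

Section LieGroupTheory.
Variables (R : realType) (d : nat) (G : TopologyGroup.type).
Variable L : lie_structure R d G.

(* The tangent space at [1] is identified with [R^d] by the chart at [1]. *)
Definition chart1 : chart R d G := chart_at L 1%g.

(* The matrix of the differential at [1] of conjugation by [g], acting on row
   vectors from the right. *)
Definition Ad (g : G) : 'M[R]_d :=
  jacobian (fun v => chart_map chart1 (g * chart_inv chart1 v * g^-1)%g)
    (chart_map chart1 1%g).

Definition AdC (g : G) : 'M[R[i]]_d := map_mx (real_complex R) (Ad g).

(* [gamma] is the one-parameter subgroup t |-> exp (t X). *)
Definition one_parameter (gamma : R -> G) (X : 'rV[R]_d) : Prop :=
  [/\ continuous gamma,
      (forall s t, gamma (s + t) = (gamma s * gamma t)%g)
    & is_derive (0 : R) (1 : R) (chart_map chart1 \o gamma) X].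

(* The real Lie algebra of a closed subgroup [H] of [G]: the tangent vectors
   [X] such that exp (t X) lies in [H] for all [t]. *)
Definition lie_algebra (H : set G) : set 'rV[R]_d :=
  [set X | exists2 gamma, one_parameter gamma X & forall t, H (gamma t)].

Definition lie_algebraC (H : set G) : set 'rV[R[i]]_d :=
  [set Z | lie_algebra H (map_mx (@complex.Re R) Z) /\
           lie_algebra H (map_mx (@complex.Im R) Z)].

(* The connected Lie subgroup with Lie algebra [V]; it is generated by the
   exponentials of the elements of [V]. *)
Definition connected_lie_subgroup (V : set 'rV[R]_d) : set G :=
  generated [set g | exists X gamma, [/\ V X, one_parameter gamma X &
                                         exists t, g = gamma t]].

Section SmallWeylGroup.
Variables (H A : set G).

Definition weight_space (lambda : A -> R[i]) : set 'rV[R[i]]_d :=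
  [set Z | lie_algebraC H Z /\
           forall a : A, Z *m AdC (val a) = lambda a *: Z].

Definition nontrivial (chi : A -> R[i]) : Prop := exists a, chi a != 1.

Definition weight_root (alpha : A -> R[i]) : Prop :=
  [/\ character alpha, nontrivial alpha &
      exists2 Z, weight_space alpha Z & Z != 0].

(* The additive multiple [k alpha] in the character group. *)
Definition multiple (alpha : A -> R[i]) (k : int) : A -> R[i] :=
  fun a => alpha a ^ k.

(* The sum of the spaces [h_mu] over the nonzero multiples [mu] of [alpha]. *)
Definition multiple_weight_space (alpha : A -> R[i]) : set 'rV[R[i]]_d :=
  [set Z | exists n (k : 'I_n -> int) (Y : 'I_n -> 'rV[R[i]]_d),
     [/\ (forall i, nontrivial (multiple alpha (k i))),
         (forall i, weight_space (multiple alpha (k i)) (Y i))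
       & Z = \sum_(i < n) Y i]].

Definition root_torus (alpha : A -> R[i]) : set G :=
  connected_lie_subgroup
    [set X | lie_algebra H X /\
             multiple_weight_space alpha (map_mx (real_complex R) X)].

(* [xi] is in R^vee(alpha) = Hom(A / ker alpha, A :&: root_torus alpha): a
   homomorphism from [A / ker alpha] is one from [A] trivial on [ker alpha]. *)
Definition coroot (alpha : A -> R[i]) (xi : A -> A) : Prop :=
  [/\ endomorphism xi,
      (forall a, alpha a = 1 -> val (xi a) = 1%g)
    & (forall a, root_torus alpha (val (xi a)))].

(* [s] is s_(alpha, xi). *)
Definition transvection (xi s : A -> A) : Prop :=
  forall a, val (s a) = (val a * val (xi a))%g.

Inductive W_small : set (A -> A) :=
| W_small_gen alpha xi s :
    weight_root alpha -> coroot alpha xi -> transvection xi s -> W_small s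
| W_small_id : W_small idfun
| W_small_comp f g : W_small f -> W_small g -> W_small (f \o g)
| W_small_inv f g : W_small f -> cancel f g -> cancel g f -> W_small g.

End SmallWeylGroup.

Section GPrime.
Variable A : set G.

Definition Ad_order : nat := #|` fset_set (Ad @` A)|%fset.

(* A_(p), G_(p) and its identity component. *)
Definition p_kernel (p : nat) : set G :=
  [set g | A g /\ Ad g ^+ (Ad_order %/ p ^ logn p Ad_order)%N = 1].

Definition G_p (p : nat) : set G := centralizer (p_kernel p).

Definition G_p0 (p : nat) : set G := connected_component (G_p p) 1%g.

Definition G_prime : set G :=
  generated (A `|` \bigcup_(p in [set p | prime p /\ (p %| Ad_order)%N]) G_p0 p).

End GPrime.

End LieGroupTheory.

(* Main.v *)
(** The small Weyl group is monotone in the ambient group, so it is enough to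
    write each generator s_(alpha, xi) for G in terms of generators for G'.

    As A is finite and equal to its own centralizer, it fixes no nonzero vector
    of the Lie algebra: the chart at 1, averaged over A, is equivariant, so a
    fixed vector would give points near 1 that commute with A. Let X and Y have
    weights in Z alpha. Since [X, conj X] has weight 0, it vanishes, so ad X is
    normal for a form invariant under the adjoint representation; hence
    Y (ad X)^r = 0 implies Y (ad X) = 0. A suitable iterated bracket of X and Y
    has weight 0, which forces [X, Y] = 0. So G_[alpha] is the group of the
    exponentials of its Lie algebra, it centralizes that Lie algebra, and alpha
    is trivial on A :&: G_[alpha]. It follows that s_(alpha, xi) is
    multiplicative in xi, and one may take the values of xi to be of p-power
    order for a prime p.

    The norm of an exponential along the action of an element of A projects its
    exponent onto the fixed weights. Norms along the cyclic group A / ker alpha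
    show that xi takes its values in the exponentials of the weights of p-power
    order, and then that, if q is the largest order of such a weight beta, xi is
    killed by q, so that it is a coroot of beta. Since A_(p) acts trivially
    on the weight spaces of the multiples of beta, their real exponentials lie
    in the identity component of G_(p), hence in G'. *)

Require Import Defs.
From HB Require Import structures.
From mathcomp Require Import all_boot all_order all_algebra.
From mathcomp Require Import finmap.
From mathcomp Require Import complex ring lra zify cyclic.
From mathcomp Require Import all_classical all_reals all_analysis.

Set Implicit Arguments.
Unset Strict Implicit.
Unset Printing Implicit Defensive.

Import Order.TTheory GRing.Theory Num.Theory.
Import numFieldNormedType.Exports.

Local Open Scope classical_set_scope.
Local Open Scope ring_scope.

(** * Derivatives of curves and strict differentials *)

Section CurveDerivative.
Variable R : realType.

(** No exponential map is constructed: membership in [lie_algebra] carries a one-parameter subgroup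
    by definition, and closure of [lie_algebra] under sums is not at hand. Vectors are added only
    once their one-parameter subgroups are known to commute, so the vanishing of brackets has to
    precede everything about root tori. The bracket itself is extracted from the group law in a
    chart: [ad] is the derivative of [Ad] at 1, its antisymmetry is the equality of the mixed second
    partials of the product, and the Jacobi identity is a derivative of equivariance. The passage to
    primes is imposed by G', whose generating pieces each see one prime, while alpha may have mixed
    order. A root of G' must have a nonzero weight space, so beta is selected among the weights that
    actually occur; if no multiple of alpha of p-power order occurs, the part of xi belonging to p
    is trivial. The parts are recombined by a Bezout relation between exponents of xi. *)

Definition has_deriv (V : normedModType R) (c : R -> V) (t : R) (w : V) : Prop :=
  forall e, 0 < e -> exists2 r, 0 < r &
    forall h, `|h| < r -> `|c (t + h) - c t - h *: w| <= e * `|h|.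

(** Clearing the denominator in the limit of difference quotients lets later estimates be chained
    without dividing by [h] and without excluding [h = 0]. *)
Lemma has_derivP (V : normedModType R) (c : R -> V) t w :
  has_deriv c t w <-> is_derive t 1 c w.
Proof.
split=> [cw|[dc <-]].
- have lim : h^-1 *: ((c \o shift t) (h *: (1 : R)) - c t) @[h --> 0^'] --> w.
    apply/cvgrPdist_le => e e0; have [r r0 H] := cw _ e0.
    rewrite /dnbhs/= near_withinE; near=> h => h0.
    have hr : `|h| < r.
      by near: h; apply/nbhs_ballP; exists r => //= y; rewrite /ball/= sub0r normrN.
    have -> : w - h^-1 *: ((c \o shift t) (h *: (1 : R)) - c t) =
        - (h^-1 *: (c (t + h) - c t - h *: w)).
      have h1 : h *: (1 : R) = h by exact: mulr1.
      by rewrite /= h1 [h + t]addrC [in RHS]scalerBr scalerA mulVf// scale1r opprB.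
    rewrite normrN normrZ normfV ler_pdivrMl ?normr_gt0// mulrC.
    exact: H.
  split; first by apply/cvg_ex; exists w.
  exact: cvg_lim lim.
- move=> e e0; move/cvgrPdist_le: (dc) => /(_ e e0).
  rewrite /dnbhs/= near_withinE => /nbhs_ballP[r /= r0 H].
  exists r => // h hr; have [->|h0] := eqVneq h 0.
    by rewrite addr0 subrr scale0r subrr !normr0 mulr0.
  have := H h; rewrite /ball/= sub0r normrN => /(_ hr h0).
  rewrite -/('D_1 c t) => le1.
  have -> : c (t + h) - c t - h *: 'D_1 c t =
      - (h *: ('D_1 c t - h^-1 *: ((c \o shift t) (h *: (1 : R)) - c t))).
    have h1 : h *: (1 : R) = h by exact: mulr1.
    by rewrite /= h1 [h + t]addrC scalerBr scalerA mulfV// scale1r opprB.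
  by rewrite normrN normrZ mulrC ler_wpM2r.
Unshelve. all: by end_near. Qed.

Lemma derivable_has_deriv (V W : normedModType R) (f : V -> W) (x v : V) :
  derivable f x v -> has_deriv (fun s => f (x + s *: v)) 0 ('D_v f x).
Proof.
move=> df e e0; move/cvgrPdist_le: (df) => /(_ e e0).
rewrite /dnbhs/= near_withinE => /nbhs_ballP[r /= r0 H].
exists r => // h hr; have [->|h0] := eqVneq h 0.
  by rewrite addr0 subrr scale0r subrr !normr0 mulr0.
have := H h; rewrite /ball/= sub0r normrN => /(_ hr h0).
rewrite -/('D_v f x) => le1; rewrite add0r scale0r addr0.
have -> : f (x + h *: v) - f x - h *: 'D_v f x =
    - (h *: ('D_v f x - h^-1 *: ((f \o shift x) (h *: v) - f x))).
  rewrite /= [h *: v + x]addrC scalerBr.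
  by rewrite scalerA mulfV// scale1r opprB.
by rewrite normrN normrZ mulrC ler_wpM2r.
Qed.

Lemma has_deriv_uniq (V : normedModType R) (c : R -> V) t w w' :
  has_deriv c t w -> has_deriv c t w' -> w = w'.
Proof. by move=> /has_derivP[_ <-] /has_derivP[_ <-]. Qed.

Lemma has_deriv_near (V : normedModType R) (c c' : R -> V) t w :
  (exists2 r, 0 < r & forall h, `|h| < r -> c (t + h) = c' (t + h)) ->
  has_deriv c t w -> has_deriv c' t w.
Proof.
move=> [r r0 cc'] cw e e0; have [r' r'0 H] := cw _ e0.
exists (Num.min r r'); first by rewrite lt_min r0.
move=> h; rewrite lt_min => /andP[hr hr'].
by rewrite -cc'// -[c' t](_ : c t = _) ?H// -[t]addr0 cc'// normr0.
Qed.

Lemma has_deriv_cst (V : normedModType R) (w : V) t : has_deriv (fun=> w) t 0.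
Proof.
move=> e e0; exists 1 => // h _; rewrite scaler0 subrr subr0 normr0.
by rewrite mulr_ge0// ltW.
Qed.

Lemma has_derivD (V : normedModType R) (c c' : R -> V) t w w' :
  has_deriv c t w -> has_deriv c' t w' -> has_deriv (fun s => c s + c' s) t (w + w').
Proof.
move=> /has_derivP cw /has_derivP cw'; apply/has_derivP.
Qed.

Lemma has_derivN (V : normedModType R) (c : R -> V) t w :
  has_deriv c t w -> has_deriv (fun s => - c s) t (- w).
Proof.
move=> cw e e0; have [r r0 H] := cw _ e0; exists r => // h hr.
by rewrite scalerN -!opprD normrN H.
Qed.

Lemma has_deriv_line (V : normedModType R) (x w : V) t :
  has_deriv (fun s => x + s *: w) t w.
Proof.
move=> e e0; exists 1 => // h _.
rewrite scalerDl [_ + (t *: w + _)]addrA [_ + _ - (x + _)]addrC addrA addNr add0r subrr normr0.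
by rewrite mulr_ge0// ltW.
Qed.

Lemma has_deriv_scale (V : normedModType R) (c : R -> V) t a w :
  has_deriv c (a * t) w -> has_deriv (fun s => c (a * s)) t (a *: w).
Proof.
move=> cw e e0; have a0 : 0 < `|a| + 1 by rewrite ltr_wpDl.
have [r r0 H] := cw _ (divr_gt0 e0 a0).
exists (r / (`|a| + 1)); first exact: divr_gt0.
move=> h; rewrite ltr_pdivlMr// => hr.
have har : `|a * h| <= `|h| * (`|a| + 1).
  by rewrite normrM mulrC ler_wpM2l// lerDl.
have := H _ (le_lt_trans har hr).
rewrite mulrDr [h *: _]scalerA [h * a]mulrC => /le_trans; apply.
apply: (le_trans (ler_wpM2l _ har)); first by rewrite ltW ?divr_gt0.
by rewrite mulrA mulrAC divfK ?gt_eqF.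
Qed.

Lemma has_deriv_shift (V : normedModType R) (c : R -> V) t w :
  has_deriv (fun s => c (t + s)) 0 w <-> has_deriv c t w.
Proof.
by split=> cw e e0; have [r r0 H] := cw _ e0; exists r => // h hr;
  have := H h hr; rewrite add0r addr0.
Qed.

Lemma has_deriv_continuous (V : normedModType R) (c : R -> V) t w :
  has_deriv c t w -> {for t, continuous c}.
Proof.
move=> cw; apply/cvgrPdist_lt => e e0.
have [r r0 H] := cw 1 ltr01; have w0 : 0 < `|w| + 1 by rewrite ltr_wpDl.
apply/nbhs_ballP; exists (Num.min r (e / (`|w| + 1))); first by rewrite /= lt_min r0 divr_gt0.
move=> s; rewrite /ball/= distrC lt_min => /andP[sr se].
have := H _ sr; rewrite [t + _]addrC subrK mul1r => le1.
rewrite distrC -[c s - c t](subrK ((s - t) *: w)).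
apply: (le_lt_trans (ler_normD _ _)); rewrite normrZ.
apply: (@le_lt_trans _ _ (`|s - t| + `|s - t| * `|w|)); first by rewrite lerD2r.
have -> : forall a b : R, a + a * b = a * (b + 1) by move=> a b; ring.
by rewrite -ltr_pdivlMr.
Qed.

Lemma mvt_unit (c w : R -> R) :
  (forall t, 0 <= t <= 1 -> has_deriv c t (w t)) ->
  exists2 t, 0 <= t <= 1 & c 1 - c 0 = w t.
Proof.
move=> cw; have [|t|t tI cE] := @MVT_segment R c w 0 1 ler01.
- move=> t; rewrite in_itv/= => /andP[t0 t1]; apply/has_derivP/cw.
  by rewrite !ltW.
- apply: continuous_in_subspaceT => s; rewrite inE/= in_itv/= => sI.
  exact: has_deriv_continuous (cw _ sI).
- exists t; last by rewrite cE subr0 mulr1.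
  by move: tI; rewrite in_itv.
Qed.

Lemma mx_norm_entry m n (M : 'M[R]_(m, n)) i j : `|M i j| <= `|M|.
Proof.
by rewrite [leRHS]/Num.Def.normr/= mx_normrE; apply/bigmax_geP; right => /=; exists (i, j).
Qed.

Lemma mx_norm_le m n (M : 'M[R]_(m, n)) e :
  0 <= e -> (forall i j, `|M i j| <= e) -> `|M| <= e.
Proof.
move=> e0 H; rewrite [leLHS]/Num.Def.normr/= mx_normrE.
by apply/bigmax_leP; split => // -[i j] _ /=.
Qed.

(** The norm is the largest entry, hence submultiplicative only up to the inner dimension. This is
    the origin of the factors [n%:R] and [d%:R + 1] in all later constants. *)
Lemma mx_norm_mulmx m n p (A : 'M[R]_(m, n)) (B : 'M[R]_(n, p)) :
  `|A *m B| <= n%:R * (`|A| * `|B|).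
Proof.
apply: mx_norm_le => [|i j]; first by rewrite !mulr_ge0.
rewrite mxE; apply: (le_trans (ler_norm_sum _ _ _)).
apply: (@le_trans _ _ (\sum_(k < n) `|A| * `|B|)).
  by apply: ler_sum => k _; rewrite normrM ler_pM// mx_norm_entry.
by rewrite sumr_const card_ord mulr_natl.
Qed.

Lemma has_deriv_entry m n (c : R -> 'M[R]_(m, n)) t w i j :
  has_deriv c t w -> has_deriv (fun s => c s i j) t (w i j).
Proof.
move=> cw e e0; have [r r0 H] := cw _ e0; exists r => // h hr.
apply: le_trans (H _ hr); have := mx_norm_entry (c (t + h) - c t - h *: w) i j.
by rewrite !mxE.
Qed.

Lemma has_deriv_entryP m n (c : R -> 'M[R]_(m, n)) t (w : 'M[R]_(m, n)) :
  (forall i j, has_deriv (fun s => c s i j) t (w i j)) -> has_deriv c t w.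
Proof.
move=> H; have dc : derivable c t 1.
  by apply/derivable_mxP => i j; have /has_derivP[] := H i j.
apply/has_derivP; split => //; apply/matrixP => i j.
by rewrite derive_mx// mxE; have /has_derivP[_ ->] := H i j.
Qed.

Lemma has_deriv0_eq m n (c : R -> 'M[R]_(m, n)) t :
  (forall s, `|s| <= `|t| -> has_deriv c s 0) -> c t = c 0.
Proof.
move=> cw; apply/matrixP => i j.
pose f s := c (t * s) i j.
have [|s _] := @mvt_unit f (fun s => 0 * s).
  move=> s /andP[s0 s1]; rewrite mul0r.
  have /cw/has_deriv_scale : `|t * s| <= `|t| by rewrite normrM (ger0_norm s0) ler_piMr.
  by rewrite scaler0 => /(has_deriv_entry i j); rewrite mxE.
by rewrite mul0r /f mulr1 mulr0 => /eqP; rewrite subr_eq0 => /eqP.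
Qed.

Lemma has_deriv_mulmx m n p (A : R -> 'M[R]_(m, n)) (B : R -> 'M[R]_(n, p)) t A' B' :
  has_deriv A t A' -> has_deriv B t B' ->
  has_deriv (fun s => A s *m B s) t (A' *m B t + A t *m B').
Proof.
move=> dA dB; apply: has_deriv_entryP => i j; rewrite !mxE -big_split/=.
apply/has_derivP.
have -> : (fun s => (A s *m B s) i j) = \sum_k (fun s => A s i k * B s k j).
  by apply/funext => s; rewrite mxE fct_sumE.
apply: is_derive_sum => k; rewrite addrC.
have /has_derivP dAk := has_deriv_entry i k dA.
have /has_derivP dBk := has_deriv_entry k j dB.
have := is_deriveM dAk dBk.
by rewrite /GRing.scale/= [B t k j * _]mulrC.
Qed.

Lemma has_deriv_mull m n p (A : 'M[R]_(m, n)) (B : R -> 'M[R]_(n, p)) t B' :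
  has_deriv B t B' -> has_deriv (fun s => A *m B s) t (A *m B').
Proof.
by move=> dB; have := has_deriv_mulmx (has_deriv_cst A t) dB; rewrite mul0mx add0r.
Qed.

Lemma has_deriv_mulr m n p (A : R -> 'M[R]_(m, n)) (B : 'M[R]_(n, p)) t A' :
  has_deriv A t A' -> has_deriv (fun s => A s *m B) t (A' *m B).
Proof.
by move=> dA; have := has_deriv_mulmx dA (has_deriv_cst B t); rewrite mulmx0 addr0.
Qed.

End CurveDerivative.

(** * Strict differentiability at a point *)

Section StrictDifferential.
Variable R : realType.

(** Comparing two moving points, rather than one with [x], makes the condition at the single point
    [x] strong enough for local Lipschitz bounds, injectivity and local inversion; C^1 maps satisfy
    it. *)
Definition strict_diff n e (f : 'rV[R]_n -> 'rV[R]_e) (x : 'rV[R]_n)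
    (D : 'M[R]_(n, e)) : Prop :=
  forall eps, 0 < eps -> exists2 r, 0 < r &
    forall y z, `|y - x| < r -> `|z - x| < r ->
      `|f y - f z - (y - z) *m D| <= eps * `|y - z|.

Lemma strict_diff_lip n e (f : 'rV[R]_n -> 'rV[R]_e) x D :
  strict_diff f x D -> exists2 r, 0 < r &
    forall y z, `|y - x| < r -> `|z - x| < r ->
      `|f y - f z| <= (n%:R * `|D| + 1) * `|y - z|.
Proof.
move=> fD; have [r r0 H] := fD 1 ltr01; exists r => // y z yr zr.
rewrite -[f y - f z](subrK ((y - z) *m D)).
apply: (le_trans (ler_normD _ _)).
have := mx_norm_mulmx (y - z) D; have := H y z yr zr.
rewrite mul1r => h1 h2; apply: (le_trans (lerD h1 h2)).
by rewrite mulrDl mul1r addrC lerD2r -mulrA [ `|D| * _]mulrC.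
Qed.

Lemma strict_diff_near n e (f g : 'rV[R]_n -> 'rV[R]_e) x D :
  (exists2 r, 0 < r & forall y, `|y - x| < r -> f y = g y) ->
  strict_diff f x D -> strict_diff g x D.
Proof.
move=> [r r0 fg] fD eps eps0; have [r' r'0 H] := fD _ eps0.
exists (Num.min r r'); first by rewrite lt_min r0.
move=> y z; rewrite !lt_min => /andP[yr yr'] /andP[zr zr'].
by rewrite -!fg// H.
Qed.

Lemma strict_diff_comp n e k (f : 'rV[R]_n -> 'rV[R]_e) (g : 'rV[R]_e -> 'rV[R]_k)
    x D E :
  strict_diff f x D -> strict_diff g (f x) E ->
  strict_diff (g \o f) x (D *m E).
Proof.
move=> fD gE eps eps0.
have [r1 r10 lipf] := strict_diff_lip fD.
pose K := n%:R * `|D| + 1; have K0 : 0 < K by rewrite ltr_wpDl// mulr_ge0.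
pose K' := e%:R * `|E| + 1; have K'0 : 0 < K' by rewrite ltr_wpDl// mulr_ge0.
have e2 : 0 < eps / 2 by rewrite divr_gt0.
have [r2 r20 H2] := gE _ (divr_gt0 e2 K0).
have [r3 r30 H3] := fD _ (divr_gt0 e2 K'0).
exists (Num.min r1 (Num.min r3 (r2 / K))).
  by rewrite !lt_min r10 r30 divr_gt0.
have near_fx y : `|y - x| < r1 -> `|y - x| < r2 / K -> `|f y - f x| < r2.
  move=> yr1 yr2; apply: (le_lt_trans (lipf y x yr1 _)).
    by rewrite subrr normr0.
  by rewrite mulrC -ltr_pdivlMr.
move=> y z; rewrite !lt_min => /and3P[y1 y3 y2] /and3P[z1 z3 z2] /=.
have := H2 _ _ (near_fx y y1 y2) (near_fx z z1 z2).
have := H3 _ _ y3 z3; have := lipf _ _ y1 z1; rewrite -/K.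
set fyz := f y - f z => hl h3 h2.
have -> : g (f y) - g (f z) - (y - z) *m (D *m E) =
   (g (f y) - g (f z) - fyz *m E) + (fyz - (y - z) *m D) *m E.
  by rewrite mulmxA [X in _ = _ + X]mulmxBl addrA subrK.
apply: (le_trans (ler_normD _ _)); rewrite [eps]splitr mulrDl lerD//.
  apply: (le_trans h2); apply: (@le_trans _ _ (eps / 2 / K * (K * `|y - z|))).
    by rewrite ler_wpM2l// !divr_ge0// ltW.
  by rewrite mulrA divfK// gt_eqF.
apply: (le_trans (mx_norm_mulmx _ _)).
apply: (@le_trans _ _ (K' * `|fyz - (y - z) *m D|)).
  by rewrite mulrDl mul1r -mulrA [ `|E| * _]mulrC lerDl.
apply: (le_trans (ler_wpM2l (ltW K'0) h3)).
by rewrite mulrA [K' * _]mulrC divfK// gt_eqF.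
Qed.

Lemma strict_diff_affine n e (D : 'M[R]_(n, e)) (c : 'rV[R]_e) x :
  strict_diff (fun y => y *m D + c) x D.
Proof.
move=> eps eps0; exists 1 => // y z _ _.
rewrite mulmxBl opprD addrACA subrr addr0 subrr normr0.
by rewrite mulr_ge0// ltW.
Qed.

Lemma strict_diff_id n (x : 'rV[R]_n) : strict_diff id x 1%:M.
Proof.
move=> eps eps0; exists 1 => // y z _ _.
by rewrite mulmx1 subrr normr0 mulr_ge0// ltW.
Qed.

Lemma strict_diff_cst n e (c : 'rV[R]_e) (x : 'rV[R]_n) : strict_diff (fun=> c) x 0.
Proof.
move=> eps eps0; exists 1 => // y z _ _.
by rewrite mulmx0 subrr subr0 normr0 mulr_ge0// ltW.
Qed.

Lemma strict_diffD n e (f g : 'rV[R]_n -> 'rV[R]_e) x D E :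
  strict_diff f x D -> strict_diff g x E ->
  strict_diff (fun y => f y + g y) x (D + E).
Proof.
move=> fD gE eps eps0.
have e2 : 0 < eps / 2 by rewrite divr_gt0.
have [r1 r10 H1] := fD _ e2; have [r2 r20 H2] := gE _ e2.
exists (Num.min r1 r2); first by rewrite lt_min r10.
move=> y z; rewrite !lt_min => /andP[y1 y2] /andP[z1 z2].
have E3 (a b c d p q : 'rV[R]_e) :
    a + b - (c + d) - (p + q) = (a - c - p) + (b - d - q).
  by rewrite !opprD (addrACA a b) [LHS]addrACA.
rewrite mulmxDr E3.
apply: (le_trans (ler_normD _ _)); rewrite [eps]splitr mulrDl lerD//.
  exact: H1.
exact: H2.
Qed.

Lemma strict_diff_sum n e (I : Type) (s : seq I) (f : I -> 'rV[R]_n -> 'rV[R]_e) x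
    (D : I -> 'M[R]_(n, e)) :
  (forall i, strict_diff (f i) x (D i)) ->
  strict_diff (fun y => \sum_(i <- s) f i y) x (\sum_(i <- s) D i).
Proof.
move=> H; elim: s => [|i s IH].
  rewrite big_nil; apply: strict_diff_near (strict_diff_cst 0 x).
  by exists 1 => // y _; rewrite big_nil.
rewrite big_cons; apply: strict_diff_near (strict_diffD (H i) IH).
by exists 1 => // y _; rewrite big_cons.
Qed.

Lemma strict_diff_curve n e (f : 'rV[R]_n -> 'rV[R]_e) (c : R -> 'rV[R]_n) t D w :
  strict_diff f (c t) D -> has_deriv c t w ->
  has_deriv (fun s => f (c s)) t (w *m D).
Proof.
move=> fD cw eps eps0.
pose K := `|w| + 1; have K0 : 0 < K by rewrite ltr_wpDl.
pose K' := n%:R * `|D| + 1; have K'0 : 0 < K' by rewrite ltr_wpDl// mulr_ge0.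
have e2 : 0 < eps / 2 by rewrite divr_gt0.
have [r1 r10 H1] := fD _ (divr_gt0 e2 K0).
have [r2 r20 H2] := cw _ (divr_gt0 e2 K'0).
have [r3 r30 H3] := cw _ ltr01.
exists (Num.min r2 (Num.min r3 (r1 / K))); first by rewrite !lt_min r20 r30 divr_gt0.
move=> h; rewrite !lt_min => /and3P[h2 h3 h1].
have lipc : `|c (t + h) - c t| <= K * `|h|.
  rewrite -[_ - _](subrK (h *: w)); apply: (le_trans (ler_normD _ _)).
  by rewrite normrZ mulrDl addrC [ `|w| * _]mulrC lerD2l; exact: H3.
have cr : `|c (t + h) - c t| < r1.
  by apply: (le_lt_trans lipc); rewrite mulrC -ltr_pdivlMr.
have fle := H1 _ _ cr (_ : `|c t - c t| < r1).
have {fle}fle := fle ltac:(by rewrite subrr normr0).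
have -> : f (c (t + h)) - f (c t) - h *: (w *m D) =
   (f (c (t + h)) - f (c t) - (c (t + h) - c t) *m D) +
   (c (t + h) - c t - h *: w) *m D.
  by rewrite scalemxAl [X in _ = _ + X]mulmxBl addrA subrK.
apply: (le_trans (ler_normD _ _)); rewrite [eps]splitr mulrDl lerD//.
  apply: (le_trans fle).
  apply: (@le_trans _ _ (eps / 2 / K * (K * `|h|))).
    by rewrite ler_wpM2l// !divr_ge0// ltW.
  by rewrite mulrA divfK// gt_eqF.
apply: (le_trans (mx_norm_mulmx _ _)).
apply: (@le_trans _ _ (K' * `|c (t + h) - c t - h *: w|)).
  by rewrite mulrDl mul1r -mulrA [ `|D| * _]mulrC lerDl.
apply: (le_trans (ler_wpM2l (ltW K'0) (H2 _ h2))).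
by rewrite mulrA [K' * _]mulrC divfK// gt_eqF.
Qed.

Lemma strict_diff_uniq n e (f : 'rV[R]_n -> 'rV[R]_e) x D E :
  strict_diff f x D -> strict_diff f x E -> D = E.
Proof.
move=> fD fE; apply/row_matrixP => i; rewrite !rowE.
have l0 : has_deriv (fun s => x + s *: delta_mx 0 i) 0 (delta_mx 0 i : 'rV[R]_n).
  exact: has_deriv_line.
have x0 : x + 0 *: delta_mx 0 i = x by rewrite scale0r addr0.
apply: (has_deriv_uniq (V := 'rV[R]_e) (c := fun s => f (x + s *: delta_mx 0 i)) (t := 0)).
  by apply: strict_diff_curve l0; rewrite x0.
by apply: strict_diff_curve l0; rewrite x0.
Qed.

Lemma continuous_at_eps (V W : normedModType R) (g : V -> W) a :
  (forall eps, 0 < eps -> exists2 r, 0 < r &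
     forall y, `|y - a| < r -> `|g y - g a| < eps) -> {for a, continuous g}.
Proof.
move=> H; apply/cvgrPdist_lt => eps eps0; apply/nbhs_ballP.
have [r r0 H'] := H _ eps0; exists r => // y; rewrite -ball_normE/= distrC => /H'.
by rewrite distrC.
Qed.

Lemma continuous_at_epsE (V W : normedModType R) (g : V -> W) a :
  {for a, continuous g} -> forall eps, 0 < eps -> exists2 r, 0 < r &
     forall y, `|y - a| < r -> `|g y - g a| < eps.
Proof.
move=> /cvgrPdist_lt H eps eps0; have /nbhs_ballP[r /= r0 H'] := H _ eps0.
exists r => // y yr; rewrite distrC; apply: H'.
by rewrite -ball_normE/= distrC.
Qed.

Lemma nbhs_norm_ball (V : normedModType R) (U : set V) x :
  nbhs x U -> exists2 r, 0 < r & forall y, `|y - x| < r -> U y.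
Proof.
move=> /nbhs_ballP[r /= r0 H].
by exists r => // y yr; apply: H; rewrite -ball_normE/= distrC.
Qed.

Lemma norm_ball_nbhs (V : normedModType R) (x : V) r : 0 < r ->
  nbhs x [set y | `|y - x| < r].
Proof.
move=> r0; apply/nbhs_ballP; exists r => // y.
by rewrite -ball_normE/= distrC.
Qed.

Lemma open_norm_ball (V : normedModType R) (U : set V) x :
  open U -> U x -> exists2 r, 0 < r & forall y, `|y - x| < r -> U y.
Proof.
move=> oU Ux; have /nbhs_ballP[r /= r0 H] := open_nbhs_nbhs (conj oU Ux).
by exists r => // y yr; apply: H; rewrite -ball_normE/= distrC.
Qed.

Lemma strict_diff_continuous n e (f : 'rV[R]_n -> 'rV[R]_e) x D :
  strict_diff f x D -> {for x, continuous f}.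
Proof.
move=> fD; have [r r0 H] := strict_diff_lip fD.
pose K := n%:R * `|D| + 1; have K0 : 0 < K by rewrite ltr_wpDl// mulr_ge0.

apply: (@continuous_at_eps 'rV[R]_n 'rV[R]_e f x) => eps eps0.
exists (Num.min r (eps / K)); first by rewrite /= lt_min r0 divr_gt0.
move=> y; rewrite lt_min => /andP[yr ye].
apply: (le_lt_trans (H y x yr _)); first by rewrite subrr normr0.
by rewrite mulrC -ltr_pdivlMr.
Qed.

(** [Ad] is defined by a [jacobian]; this identifies it with a strict differential. *)
Lemma strict_diff_jacobian n e (f : 'rV[R]_n -> 'rV[R]_e) x D :
  strict_diff f x D -> jacobian f x = D.
Proof.
move=> fD.
have : 'd f x = mulmxr D :> ('rV[R]_n -> 'rV[R]_e).
  apply: diff_unique.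
    move=> y; apply: (@strict_diff_continuous _ _ (mulmxr D) y D).
    apply: strict_diff_near (strict_diff_affine D 0 y).
    by exists 1 => // z _; rewrite addr0.
  apply/eqaddoP => eps eps0; have [r r0 H] := fD _ eps0.
  apply/nbhs_ballP; exists r => // y; rewrite -ball_normE/= sub0r normrN => yr.
  have := H (y + x) x; rewrite addrK subrr normr0 => /(_ yr r0).
  rewrite -addrA -opprD; exact.
move=> dE; apply/row_matrixP => i.
by rewrite !rowE /jacobian mul_rV_lin1 dE.
Qed.
End StrictDifferential.

(** * C^1 maps are strictly differentiable; symmetry of second partials *)

Section ContinuouslyDifferentiable.
Variable R : realType.

(** The intermediate point depends on the coordinate, so the mean value theorem is stated for one
    coordinate [k] at a time. *)
Lemma mvt_line n e (f : 'rV[R]_n -> 'rV[R]_e) p v (D : R -> 'rV[R]_e) k :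
  (forall s, 0 <= s <= 1 -> has_deriv (fun h => f (p + s *: v + h *: v)) 0 (D s)) ->
  exists2 s, 0 <= s <= 1 & (f (p + v) - f p) 0 k = D s 0 k.
Proof.
move=> H; have [|s sI E] := @mvt_unit R (fun s => f (p + s *: v) 0 k) (fun s => D s 0 k);
  last first.
  by exists s => //; rewrite -E scale1r scale0r addr0 !mxE.
move=> s sI; apply/has_deriv_shift.
have := has_deriv_entry 0 k (H s sI).
apply: has_deriv_near; exists 1 => // h _ /=.
by rewrite add0r scalerDl addrA.
Qed.

Definition partials n e (f : 'rV[R]_n -> 'rV[R]_e) (x : 'rV[R]_n) : 'M[R]_(n, e) :=
  \matrix_(i, j) ('D_(delta_mx 0 i) f x) 0 j.

Lemma derivable_line n e (f : 'rV[R]_n -> 'rV[R]_e) q v a :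
  derivable f q v -> has_deriv (fun h => f (q + h *: (a *: v))) 0 (a *: 'D_v f q).
Proof.
move=> /derivable_has_deriv df.
have : has_deriv (fun h => f (q + h *: v)) (a * 0) ('D_v f q) by rewrite mulr0.
move=> /has_deriv_scale; apply: has_deriv_near; exists 1 => // h _.
by rewrite scalerA [a * _]mulrC.
Qed.

(** Pass from [z] to [y] by replacing one coordinate at a time and apply the mean value theorem to
    each step. In the maximum norm the path stays as near to [x] as its ends. The error is shared
    among [n] steps; the denominator [n + 1] also covers [n = 0]. *)
Lemma C1_strict_diff n e (U : set 'rV[R]_n) (f : 'rV[R]_n -> 'rV[R]_e) x :
  open U -> U x -> Ck_on 1 U f -> strict_diff f x (partials f x).
Proof.
move=> oU Ux [_ /= Hf] eps eps0.
have [r0 r00 HU] := open_norm_ball oU Ux.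
have n0 : 0 < n%:R + 1 :> R by rewrite ltr_wpDl.
have en : 0 < eps / (n%:R + 1) by rewrite divr_gt0.
have Hr i : exists2 r, 0 < r & forall y, `|y - x| < r ->
    `|'D_(delta_mx 0 i) f y - 'D_(delta_mx 0 i) f x| < eps / (n%:R + 1).
  have [_ [Hc _]] := Hf i.
  exact: (continuous_at_epsE (Hc x Ux) en).
pose r i := sval (cid2 (Hr i)).
have r_gt0 i : 0 < r i by rewrite /r; case: cid2.
have rP i y : `|y - x| < r i ->
    `|'D_(delta_mx 0 i) f y - 'D_(delta_mx 0 i) f x| < eps / (n%:R + 1).
  by rewrite /r; case: (cid2 (Hr i)) => /= ? _; apply.
exists (\big[Num.min/r0]_i r i).
  by apply: lt_bigmin.
move=> y z yr zr; apply: mx_norm_le => [|k j]; first by rewrite mulr_ge0// ltW.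
rewrite {k}[k]ord1.
pose w (k : nat) : 'rV[R]_n := \row_i (if (i < k)%N then y 0 i else z 0 i).
have wS (k : 'I_n) : w k.+1 = w k + (y 0 k - z 0 k) *: delta_mx 0 k.
  apply/rowP => i; rewrite !mxE eqxx/=; have [ik|ki|/val_inj ->] := ltngtP i k.
  - rewrite ltnS (ltnW ik) (_ : i == k = false) ?mulr0 ?addr0//.
    by apply/eqP => ikE; rewrite ikE ltnn in ik.
  - rewrite ltnS leqNgt ki/= (_ : i == k = false) ?mulr0 ?addr0//.
    by apply/eqP => ikE; rewrite ikE ltnn in ki.
  - by rewrite ltnS leqnn eqxx mulr1 addrC subrK.
have w0 : w 0%N = z by apply/rowP => i; rewrite mxE.
have wn : w n = y by apply/rowP => i; rewrite mxE ltn_ord.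
pose rho := Num.max `|y - x| `|z - x|.
have wball (k : 'I_n) s : 0 <= s <= 1 ->
    `|w k + s *: ((y 0 k - z 0 k) *: delta_mx 0 k) - x| <= rho.
  move=> /andP[s0 s1]; apply: mx_norm_le; first by rewrite le_max normr_ge0.
  move=> i' i; rewrite {i'}[i']ord1 !mxE eqxx/=.
  have yi : `|y 0 i - x 0 i| <= rho.
    rewrite le_max (le_trans _ (mx_norm_entry (y - x) 0 i))//.
    by rewrite !mxE.
  have zi : `|z 0 i - x 0 i| <= rho.
    rewrite le_max [X in _ || X](le_trans _ (mx_norm_entry (z - x) 0 i)) ?orbT//.
    by rewrite !mxE.
  have [ik|ik] := eqVneq i k; last by rewrite mulr0 mulr0 addr0; case: ifP.
  rewrite -ik ltnn mulr1.
  have -> : z 0 i + s * (y 0 i - z 0 i) - x 0 i =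
     (1 - s) * (z 0 i - x 0 i) + s * (y 0 i - x 0 i) by ring.
  apply: (le_trans (ler_normD _ _)); rewrite !normrM (ger0_norm s0).
  rewrite (ger0_norm (_ : 0 <= 1 - s)) ?subr_ge0//.
  have -> : rho = (1 - s) * rho + s * rho by ring.
  by apply: lerD; apply: ler_wpM2l; rewrite ?subr_ge0.
have rho_lt a : (\big[Num.min/r0]_i r i) <= a -> rho < a.
  by move=> h; rewrite gt_max !(lt_le_trans _ h).
have step (k : 'I_n) : `|(f (w k.+1) - f (w k)) 0 j -
    (y 0 k - z 0 k) * ('D_(delta_mx 0 k) f x) 0 j| <= eps / (n%:R + 1) * `|y - z|.
  pose D s := (y 0 k - z 0 k) *: 'D_(delta_mx 0 k) f
    (w k + s *: ((y 0 k - z 0 k) *: delta_mx 0 k)).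
  have [|s sI Es] := @mvt_line _ _ f (w k) ((y 0 k - z 0 k) *: delta_mx 0 k) D j; last first.
    have ws := wball k s sI.
    have E1 (a : R) (u v : 'rV[R]_e) : (a *: u) 0 j - a * v 0 j = a * (u - v) 0 j.
      by rewrite !mxE mulrBr.
    rewrite wS Es /D E1 normrM mulrC ler_pM//.
      have /rP : `|w k + s *: ((y 0 k - z 0 k) *: delta_mx 0 k) - x| < r k.
        by apply: (le_lt_trans ws); apply: rho_lt; exact: bigmin_le.
      by move=> /ltW; apply: le_trans; exact: mx_norm_entry.
    by have := mx_norm_entry (y - z) 0 k; rewrite !mxE.
  move=> s sI; apply: derivable_line.
  have [+ _] := Hf k; apply; apply: HU.
  by apply: (le_lt_trans (wball k s sI)); apply: rho_lt; exact: bigmin_le_id.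
have tel : \sum_(k < n) (f (w k.+1) - f (w k)) = f y - f z.
  by rewrite -(big_mkord xpredT (fun k => f (w k.+1) - f (w k))) telescope_sumr// wn w0.
have -> : (f y - f z - (y - z) *m partials f x) 0 j =
   \sum_(k < n) ((f (w k.+1) - f (w k)) 0 j - (y 0 k - z 0 k) * ('D_(delta_mx 0 k) f x) 0 j).
  rewrite [RHS]big_split/= sumrN [in LHS]mxE [X in _ + X = _]mxE; congr (_ - _).
    by rewrite -tel summxE.
  by rewrite mxE; apply: eq_bigr => k _; rewrite !mxE.
apply: (le_trans (ler_norm_sum _ _ _)).
apply: (@le_trans _ _ (\sum_(k < n) eps / (n%:R + 1) * `|y - z|)).
  by apply: ler_sum => k _; exact: step.
rewrite sumr_const card_ord -(mulr_natl (eps / _ * _)) mulrA ler_wpM2r//.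
by rewrite mulrCA ler_piMr ?(ltW eps0)// ler_pdivrMr// mul1r lerDl.
Qed.


(** The second difference [Delta s] is symmetric in [i] and [j], and divided by [s * s] it
    approximates either mixed derivative: the mean value theorem in one direction, then strict
    differentiability of that partial derivative in the other. *)
Lemma Schwarz n e (U : set 'rV[R]_n) (f : 'rV[R]_n -> 'rV[R]_e) x i j :
  open U -> U x -> Ck_on 2 U f ->
  'D_(delta_mx 0 j) ('D_(delta_mx 0 i) f) x = 'D_(delta_mx 0 i) ('D_(delta_mx 0 j) f) x.
Proof.
move=> oU Ux Hf; apply/rowP => k; apply/eqP; rewrite -subr_eq0 -normr_eq0.
pose e_ a : 'rV[R]_n := delta_mx 0 a.
have norm_e (a : 'I_n) : `|e_ a| <= 1.
  apply: mx_norm_le => // b c; rewrite !mxE.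
  by case: (_ && _); rewrite ?normr1 ?normr0.
pose Delta s := (f (x + s *: e_ i + s *: e_ j) - f (x + s *: e_ i)
  - f (x + s *: e_ j) + f x) 0 k.
have key (a b : 'I_n) : ((a, b) = (i, j) \/ (a, b) = (j, i)) ->
  forall eps, 0 < eps -> exists2 r, 0 < r & forall s, 0 < s < r ->
   `|Delta s - s * s * ('D_(e_ b) ('D_(e_ a) f) x) 0 k| <= eps * (s * s).
  move=> ab eps eps0.
  have [_ /= HD] := Hf; have [da Ca] := HD a.
  have [r r0 Hr] := C1_strict_diff oU Ux (Ca : Ck_on 1 U _) eps0.
  have [r' r'0 HU] := open_norm_ball oU Ux.
  exists (Num.min r r' / 2); first by rewrite divr_gt0// lt_min r0.
  move=> s /andP[s0]; rewrite ltr_pdivlMr// => sr.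
  have inball t u : 0 <= t <= 1 -> (u = s \/ u = 0) ->
      `|x + u *: e_ b + t *: (s *: e_ a) - x| < Num.min r r'.
    move=> /andP[t0 t1] us; rewrite addrAC [x + _]addrC addrK.
    apply: (le_lt_trans (ler_normD _ _)); apply: le_lt_trans sr.
    rewrite mulr_natr mulr2n lerD//.
      case: us => ->; last by rewrite scale0r normr0 ltW.
      by rewrite normrZ (gtr0_norm s0) ler_piMr// ltW.
    rewrite scalerA normrZ normrM (ger0_norm t0) (gtr0_norm s0) -mulrA.
    rewrite -[leRHS]mul1r -[s in leRHS]mulr1.
    by rewrite ler_pM ?mulr_ge0 ?(ltW s0)// ler_wpM2l// ltW.
  pose g p := f (p + s *: e_ b) - f p.
  have [t tI Et] : exists2 t, 0 <= t <= 1 & (g (x + s *: e_ a) - g x) 0 k =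
      (s *: ('D_(e_ a) f (x + s *: e_ b + t *: (s *: e_ a))
             - 'D_(e_ a) f (x + 0 *: e_ b + t *: (s *: e_ a)))) 0 k.
    apply: (@mvt_line _ _ g x (s *: e_ a)
      (fun t => s *: ('D_(e_ a) f (x + s *: e_ b + t *: (s *: e_ a))
             - 'D_(e_ a) f (x + 0 *: e_ b + t *: (s *: e_ a))))) => t tI.
    have d u : (u = s \/ u = 0) -> derivable f (x + u *: e_ b + t *: (s *: e_ a)) (e_ a).
      move=> us; apply: da; apply: HU; apply: (lt_le_trans (inball t u tI us)).
      by rewrite ge_min lexx orbT.
    have d1 := derivable_line s (d s (or_introl erefl)).
    have := has_deriv_scale (a := -1) (t := 0).
    have d2 := derivable_line s (d 0 (or_intror erefl)).
    move=> _; rewrite scalerBr; move: (has_derivD d1 (has_derivN d2)).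
    apply: has_deriv_near; exists 1 => // h _; rewrite add0r /g scale0r addr0.
    by rewrite -!addrA [s *: e_ b + _]addrC !addrA.
  have DE : Delta s = (g (x + s *: e_ a) - g x) 0 k.
    rewrite /Delta /g; case: ab => -[-> ->]; congr (fun_of_matrix _ _ _).
      by rewrite opprB addrA addrAC.
    rewrite [x + _ + _]addrAC opprB [RHS]addrA [RHS]addrAC; congr (_ + _).
    by rewrite [LHS]addrAC.
  have /= := Hr _ _ (lt_le_trans (inball t s tI (or_introl erefl)) _)
                (lt_le_trans (inball t 0 tI (or_intror erefl)) _).
  rewrite !ge_min !lexx => /(_ isT isT).
  have E1 (u v w : 'rV[R]_n) : x + u + w - (x + v + w) = u - v.
    by rewrite opprD addrACA subrr addr0 opprD addrACA subrr add0r.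
  rewrite DE Et E1 scale0r subr0 -scalemxAl -rowE.
  have -> : row b (partials ('D_(e_ a) f) x) = 'D_(e_ b) ('D_(e_ a) f) x.
    by apply/rowP => c; rewrite !mxE.
  have E6 (u v : 'rV[R]_e) : (s *: u) 0 k - s * s * v 0 k = s * (u - s *: v) 0 k.
    by rewrite !mxE; ring.
  set u := ('D_(e_ a) f _ - 'D_(e_ a) f _); set v := 'D_(e_ b) _ _ => Huv.
  rewrite E6.
  rewrite normrM (gtr0_norm s0) mulrCA ler_pM2l//.
  apply: (le_trans (mx_norm_entry _ 0 k)); apply: (le_trans Huv).
  by rewrite ler_wpM2l ?(ltW eps0)// normrZ (gtr0_norm s0) ler_piMr ?(ltW s0).
have [//|c0] := eqVneq (`|_ - _|) 0.
set c := `|_ - _| in c0 *; have {}c0 : 0 < c by rewrite lt_def c0 normr_ge0.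
(* With a quarter of the gap [c] allowed to each approximation, the two together give
   [c <= c / 2]. *)
have c4 : 0 < c / 4%:R by rewrite divr_gt0.
have [r1 r10 H1] := key _ _ (or_introl erefl) _ c4.
have [r2 r20 H2] := key _ _ (or_intror erefl) _ c4.
pose s := Num.min r1 r2 / 2.
have s0 : 0 < s by rewrite divr_gt0// lt_min r10.
have slt : s < Num.min r1 r2 by rewrite ltr_pdivrMr// ltr_pMr ?ltr1n// lt_min r10.
move: (slt); rewrite lt_min => /andP[s1 s2].
have := H1 s; rewrite s0 s1 => /(_ isT) h1.
have := H2 s; rewrite s0 s2 => /(_ isT) h2.
have ss : 0 < s * s by rewrite mulr_gt0.
have : s * s * c <= s * s * (c / 2).
  rewrite -{1}(gtr0_norm ss) /c -normrM.
  pose p := ('D_(e_ j) ('D_(e_ i) f) x : 'rV[R]_e) 0 k.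
  pose q := ('D_(e_ i) ('D_(e_ j) f) x : 'rV[R]_e) 0 k.
  rewrite -/p in h1; rewrite -/q in h2.
  have E4 (D a b : R) : s * s * (a - b) = (D - s * s * b) - (D - s * s * a) by ring.
  rewrite (E4 (Delta s)).
  apply: (le_trans (ler_normB _ _)); apply: (le_trans (lerD h2 h1)).
  have E5 (a b : R) : a / 4%:R * b + a / 4%:R * b = b * (a / 2) by field.
  by rewrite E5.
by rewrite ler_pM2l// leNgt ltr_pdivrMr// ltr_pMr// ltr1n.
Qed.



End ContinuouslyDifferentiable.

(** * The adjoint representation and its differential *)

Section Charts.
Variables (R : realType) (d : nat) (G : TopologyGroup.type).
Variable L : lie_structure R d G.

Lemma chart_invP (c : chart R d G) v : chart_cod c v ->
  chart_dom c (chart_inv c v) /\ chart_map c (chart_inv c v) = v.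
Proof. by move=> [x cx <-]; rewrite chart_mapK. Qed.

Definition chart_mul (c1 c2 c3 : chart R d G) (v : 'rV[R]_(d + d)) : 'rV[R]_d :=
  chart_map c3 (chart_inv c1 (lsubmx v) * chart_inv c2 (rsubmx v))%g.

Definition chart_mul_dom (c1 c2 c3 : chart R d G) : set 'rV[R]_(d + d) :=
  [set v | [/\ chart_cod c1 (lsubmx v), chart_cod c2 (rsubmx v) &
     chart_dom c3 (chart_inv c1 (lsubmx v) * chart_inv c2 (rsubmx v))%g]].

Lemma chart_mul_dom_open c1 c2 c3 : open (chart_mul_dom c1 c2 c3).
Proof.
rewrite openE => v [v1 v2 v3].
have cl : {for v, continuous (@lsubmx R 1 d d)}.
  exact/differentiable_continuous/differentiable_lsubmx.
have cr : {for v, continuous (@rsubmx R 1 d d)}.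
  exact/differentiable_continuous/differentiable_rsubmx.
have n1 : nbhs v [set w | chart_cod c1 (lsubmx w)].
  by apply: cl; apply: open_nbhs_nbhs; split => //; exact: chart_cod_open.
have n2 : nbhs v [set w | chart_cod c2 (rsubmx w)].
  by apply: cr; apply: open_nbhs_nbhs; split => //; exact: chart_cod_open.
have n3 : nbhs v [set w | chart_dom c3 (chart_inv c1 (lsubmx w) * chart_inv c2 (rsubmx w))%g].
  have h1 : chart_inv c1 (lsubmx w) @[w --> v] --> chart_inv c1 (lsubmx v).
    by apply: (cvg_comp _ _ cl); exact: chart_inv_continuous.
  have h2 : chart_inv c2 (rsubmx w) @[w --> v] --> chart_inv c2 (rsubmx v).
    by apply: (cvg_comp _ _ cr); exact: chart_inv_continuous.
  have h3 := cvg_comp _ _ (cvg_pair h1 h2) (@mulg_continuous _ _ _ L (_, _)).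
  by apply: h3; apply: open_nbhs_nbhs; split => //; exact: chart_dom_open.
by near=> w; split; near: w.
Unshelve. all: by end_near. Qed.

Lemma chart_mul_strict_diff c1 c2 c3 v : atlas L c1 -> atlas L c2 -> atlas L c3 ->
  chart_mul_dom c1 c2 c3 v ->
  strict_diff (chart_mul c1 c2 c3) v (partials (chart_mul c1 c2 c3) v).
Proof.
move=> a1 a2 a3 vD; apply: C1_strict_diff vD _; first exact: chart_mul_dom_open.
exact: (mulg_smooth a1 a2 a3 1).
Qed.

Lemma strict_diff_row_mxr (u w : 'rV[R]_d) :
  strict_diff (fun w => row_mx u w) w (row_mx 0 1%:M).
Proof.
apply: strict_diff_near (strict_diff_affine (row_mx 0 1%:M) (row_mx u 0) w).
by exists 1 => // y _; rewrite mul_mx_row mulmx0 mulmx1 add_row_mx add0r addr0.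
Qed.

Lemma strict_diff_row_mxl (u w : 'rV[R]_d) :
  strict_diff (fun w => row_mx w u) w (row_mx 1%:M 0).
Proof.
apply: strict_diff_near (strict_diff_affine (row_mx 1%:M 0) (row_mx 0 u) w).
by exists 1 => // y _; rewrite mul_mx_row mulmx0 mulmx1 add_row_mx add0r addr0.
Qed.

Lemma near_chart (c : chart R d G) x (P : set G) : chart_dom c x -> nbhs x P ->
  exists2 r, 0 < r & forall w, `|w - chart_map c x| < r ->
    [/\ P (chart_inv c w), chart_cod c w & chart_dom c (chart_inv c w)].
Proof.
move=> cx Px.
have cv : chart_cod c (chart_map c x) by exists x.
have n1 : nbhs (chart_map c x) [set w | P (chart_inv c w)].
  by apply: (chart_inv_continuous cv); rewrite chart_mapK.
have n2 : nbhs (chart_map c x) (chart_cod c).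
  by apply: open_nbhs_nbhs; split => //; exact: chart_cod_open.
have [r r0 H] := @nbhs_norm_ball R 'rV[R]_d _ _ (filterI n1 n2).
exists r => // w wr; have [Pw cw] := H w wr.
by split => //; have [] := chart_invP cw.
Qed.

Lemma continuous_mulg2 (g h x : G) : {for x, continuous (fun y => g * y * h)%g}.
Proof.
have h1 : (g * y)%g @[y --> x] --> (g * x)%g.
  exact: (cvg_comp _ _ (cvg_pair (cvg_cst g) cvg_id) (@mulg_continuous _ _ _ L (g, x))).
exact: (cvg_comp _ _ (cvg_pair h1 (cvg_cst h)) (@mulg_continuous _ _ _ L (g * x, h)%g)).
Qed.

(** Smoothness is given for products of two factors, so the map is factored through an intermediate
    chart at [g * x]. *)
Lemma strict_diff_mul2 (g h x : G) c c3 : atlas L c -> atlas L c3 ->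
  chart_dom c x -> chart_dom c3 (g * x * h)%g ->
  exists D, strict_diff (fun w => chart_map c3 (g * chart_inv c w * h)%g)
    (chart_map c x) D.
Proof.
move=> ac ac3 cx c3x.
pose c' := chart_at L (g * x)%g; pose cg := chart_at L g; pose ch := chart_at L h.
have m1 : chart_mul_dom cg c c' (row_mx (chart_map cg g) (chart_map c x)).
  split; rewrite ?row_mxKl ?row_mxKr.
  - by exists g => //; exact: mem_chart_at.
  - by exists x.
  - by rewrite !chart_mapK//; exact: mem_chart_at.
have m2 : chart_mul_dom c' ch c3 (row_mx (chart_map c' (g * x)%g) (chart_map ch h)).
  split; rewrite ?row_mxKl ?row_mxKr.
  - by exists (g * x)%g => //; exact: mem_chart_at.
  - by exists h => //; exact: mem_chart_at.
  - by rewrite !chart_mapK//; exact: mem_chart_at.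
have d1 := strict_diff_comp (strict_diff_row_mxr (chart_map cg g) (chart_map c x))
  (chart_mul_strict_diff (chart_at_atlas L g) ac (chart_at_atlas L _) m1).
have d2 := strict_diff_comp (strict_diff_row_mxl (chart_map ch h) _)
  (chart_mul_strict_diff (chart_at_atlas L _) (chart_at_atlas L h) ac3 m2).
have E : (chart_mul cg c c' \o [eta row_mx (chart_map cg g)]) (chart_map c x) =
   chart_map c' (g * x)%g.
  by rewrite /chart_mul/= row_mxKl row_mxKr !chart_mapK//; exact: mem_chart_at.
rewrite -E in d2.
eexists; apply: strict_diff_near (strict_diff_comp d1 d2).
have nx : nbhs x [set y | chart_dom c' (g * y)%g].
  have cx1 : (g * y)%g @[y --> x] --> (g * x)%g.
    exact: (cvg_comp _ _ (cvg_pair (cvg_cst g) cvg_id) (@mulg_continuous _ _ _ L (g, x))).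
  apply: cx1; apply: open_nbhs_nbhs; split; first exact: chart_dom_open.
  exact: mem_chart_at.
have [r r0 H] := near_chart cx nx; exists r => // w wr; have [/= H1 _ _] := H w wr.
rewrite /chart_mul/= !row_mxKl !row_mxKr !chart_mapK//; exact: mem_chart_at.
Qed.

End Charts.

(** * The adjoint representation in the chart at 1 *)

Section Adjoint.
Variables (R : realType) (d : nat) (G : TopologyGroup.type).
Variable L : lie_structure R d G.

Let phi := chart_inv (chart1 L).
Let kap := chart_map (chart1 L).
Let v0 := kap 1%g.

Lemma chart1_atlas : atlas L (chart1 L).
Proof. exact: chart_at_atlas. Qed.

Lemma chart1_dom1 : chart_dom (chart1 L) 1%g.
Proof. exact: mem_chart_at. Qed.

Lemma chart1_inv0 : phi v0 = 1%g.
Proof. by rewrite /phi /v0 /kap chart_mapK//; exact: chart1_dom1. Qed.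

Lemma Ad_strict_diff g :
  strict_diff (fun v => kap (g * phi v * g^-1)%g) v0 (Ad L g).
Proof.
have [|D fD] := strict_diff_mul2 (g := g) (h := g^-1%g) (chart1_atlas) (chart1_atlas) chart1_dom1.
  by rewrite mulg1 mulgV; exact: chart1_dom1.
by rewrite /Ad (strict_diff_jacobian fD).
Qed.

(* The curve [c] is only required to be differentiable at [0]. *)
Definition tangent_curve (c : R -> G) (X : 'rV[R]_d) : Prop :=
  [/\ c 0 = 1%g, {for 0, continuous c} & has_deriv (kap \o c) 0 X].

Lemma tangent_curve_uniq c X Y : tangent_curve c X -> tangent_curve c Y -> X = Y.
Proof. by move=> [_ _ h1] [_ _ h2]; exact: has_deriv_uniq h1 h2. Qed.

Lemma near_curve (c : R -> G) (P : set G) t : {for t, continuous c} -> nbhs (c t) P ->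
  exists2 r, 0 < r & forall s, `|s| < r -> P (c (t + s)).
Proof.
move=> cc n; have [r r0 H] := @nbhs_norm_ball R R^o [set s | P (c s)] t (cc _ n).
exists r => // s sr; apply: H.
by rewrite [t + s]addrC addrK.
Qed.

Lemma tangent_curve_near c X : tangent_curve c X ->
  exists2 r, 0 < r & forall s, `|s| < r -> chart_dom (chart1 L) (c s).
Proof.
move=> [c0 cc _]; have [|r r0 H] := @near_curve c (chart_dom (chart1 L)) 0 cc.
  by rewrite c0; apply: open_nbhs_nbhs; split; [exact: chart_dom_open|exact: chart1_dom1].
by exists r => // s /H; rewrite add0r.
Qed.

Lemma tangent_curve_conj c X g : tangent_curve c X ->
  tangent_curve (fun s => g * c s * g^-1)%g (X *m Ad L g).
Proof.
move=> cX; have [r r0 cd] := tangent_curve_near cX; have [c0 cc dc] := cX; split.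
- by rewrite c0 mulg1 mulgV.
- exact: (cvg_comp _ _ cc (@continuous_mulg2 _ _ _ L g g^-1%g (c 0))).
- have dc' : has_deriv (fun s => kap (g * phi (kap (c s)) * g^-1)%g) 0 (X *m Ad L g).
    have sd := Ad_strict_diff g; rewrite /v0 -c0 in sd.
    exact: strict_diff_curve sd dc.
  apply: has_deriv_near dc'; exists r => // h hr; rewrite add0r /=.
  by rewrite /phi /kap chart_mapK//; exact: cd.
Qed.

Definition mul1 := chart_mul (chart1 L) (chart1 L) (chart1 L).
Definition dom1 := chart_mul_dom (chart1 L) (chart1 L) (chart1 L).

Lemma mul1E v w : mul1 (row_mx v w) = kap (phi v * phi w)%g.
Proof. by rewrite /mul1 /chart_mul row_mxKl row_mxKr. Qed.

Lemma chart_cod0 : chart_cod (chart1 L) v0.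
Proof. by exists 1%g => //; exact: chart1_dom1. Qed.

Lemma dom1_l v : chart_cod (chart1 L) v -> dom1 (row_mx v v0).
Proof.
move=> vc; have [h1 h2] := chart_invP vc; split; rewrite ?row_mxKl ?row_mxKr//.
  exact: chart_cod0.
by rewrite -/phi chart1_inv0 mulg1.
Qed.

Lemma dom1_r v : chart_cod (chart1 L) v -> dom1 (row_mx v0 v).
Proof.
move=> vc; have [h1 h2] := chart_invP vc; split; rewrite ?row_mxKl ?row_mxKr//.
  exact: chart_cod0.
by rewrite -/phi chart1_inv0 mul1g.
Qed.

Lemma mul1_strict_diff v : dom1 v -> strict_diff mul1 v (partials mul1 v).
Proof. by apply: chart_mul_strict_diff; exact: chart1_atlas. Qed.

(* The differentials at [1] of the left and right translations by [phi v]. As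
   [Ad (phi v)] is a quotient of the two, the derivatives of [dleft] and
   [dright] at [v0] yield that of [Ad]. *)
Definition dleft v := dsubmx (partials mul1 (row_mx v v0)).
Definition dright v := usubmx (partials mul1 (row_mx v0 v)).

Lemma dleft_strict_diff v : chart_cod (chart1 L) v ->
  strict_diff (fun w => kap (phi v * phi w)%g) v0 (dleft v).
Proof.
move=> vc; have := strict_diff_comp (strict_diff_row_mxr v v0) (mul1_strict_diff (dom1_l vc)).
rewrite -[partials _ _]vsubmxK mul_row_col mul0mx mul1mx add0r.
apply: strict_diff_near; exists 1 => // y _; exact: mul1E.
Qed.

Lemma dright_strict_diff v : chart_cod (chart1 L) v ->
  strict_diff (fun w => kap (phi w * phi v)%g) v0 (dright v).
Proof.
move=> vc; have := strict_diff_comp (strict_diff_row_mxl v v0) (mul1_strict_diff (dom1_r vc)).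
rewrite -[partials _ _]vsubmxK mul_row_col mul0mx mul1mx addr0.
apply: strict_diff_near; exists 1 => // y _; exact: mul1E.
Qed.

Lemma near_v0 : exists2 r, 0 < r & forall w, `|w - v0| < r ->
  chart_cod (chart1 L) w /\ kap (phi w) = w.
Proof.
have [r r0 H] := near_chart chart1_dom1 (filterT : nbhs (1%g : G) setT).
by exists r => // w /H[_ cw _]; have [] := chart_invP cw.
Qed.

Lemma dleft0 : dleft v0 = 1%:M.
Proof.
apply: strict_diff_uniq (dleft_strict_diff chart_cod0) _.
apply: strict_diff_near (strict_diff_id v0).
have [r r0 H] := near_v0; exists r => // w /H[cw kw].
by rewrite chart1_inv0 mul1g.
Qed.

Lemma dright0 : dright v0 = 1%:M.
Proof.
apply: strict_diff_uniq (dright_strict_diff chart_cod0) _.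
apply: strict_diff_near (strict_diff_id v0).
have [r r0 H] := near_v0; exists r => // w /H[cw kw].
by rewrite chart1_inv0 mulg1.
Qed.

Lemma tangent_curve_mul c c' X X' : tangent_curve c X -> tangent_curve c' X' ->
  tangent_curve (fun s => c s * c' s)%g (X + X').
Proof.
move=> cX cX'; have [r r0 cd] := tangent_curve_near cX.
have [r' r'0 cd'] := tangent_curve_near cX'.
have [c0 cc dc] := cX; have [c'0 cc' dc'] := cX'; split.
- by rewrite c0 c'0 mulg1.
- exact: (cvg_comp _ _ (cvg_pair cc cc') (@mulg_continuous _ _ _ L (_, _))).
have dcc : has_deriv (fun s => row_mx (kap (c s)) (kap (c' s))) 0 (row_mx X X').
  move=> e e0; have [r1 r10 H1] := dc _ e0; have [r2 r20 H2] := dc' _ e0.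
  exists (Num.min r1 r2); first by rewrite lt_min r10.
  move=> h; rewrite lt_min => /andP[h1 h2].
  rewrite scale_row_mx opp_row_mx add_row_mx opp_row_mx add_row_mx.
  apply: mx_norm_le => [|i j]; first by rewrite mulr_ge0// ltW.
  rewrite mxE; case: (fintype.split j) => k.
    exact: le_trans (mx_norm_entry _ _ _) (H1 _ h1).
  exact: le_trans (mx_norm_entry _ _ _) (H2 _ h2).
have sd : strict_diff mul1 (row_mx (kap (c 0)) (kap (c' 0))) (partials mul1 (row_mx v0 v0)).
  by rewrite c0 c'0; apply: mul1_strict_diff; exact: (dom1_l chart_cod0).
have := strict_diff_curve sd dcc.
rewrite -[partials _ _]vsubmxK mul_row_col -/(dright v0) -/(dleft v0) dleft0 dright0 !mulmx1.
apply: has_deriv_near; exists (Num.min r r'); first by rewrite lt_min r0.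
move=> h; rewrite lt_min add0r => /andP[h1 h2].
by rewrite mul1E /phi /kap !chart_mapK//; [exact: cd'|exact: cd].
Qed.

Definition line_curve (w : 'rV[R]_d) (s : R) : G := phi (v0 + s *: w).

Lemma line_curve_tangent w : tangent_curve (line_curve w) w.
Proof.
have l0 : has_deriv (fun s => v0 + s *: w) 0 w by exact: has_deriv_line.
split.
- by rewrite /line_curve scale0r addr0 chart1_inv0.
- have cl := has_deriv_continuous l0.
  have ci : {for v0 + 0 *: w, continuous phi}.
    by rewrite scale0r addr0; exact: chart_inv_continuous chart_cod0.
  exact: (cvg_comp _ _ cl ci).
have [r r0 H] := near_v0.
apply: has_deriv_near l0; exists (r / (`|w| + 1)); first by rewrite divr_gt0// ltr_wpDl.
move=> h; rewrite ltr_pdivlMr ?ltr_wpDl// => hr; rewrite add0r /line_curve /=.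
have [|//] := H (v0 + h *: w); rewrite addrAC subrr add0r normrZ.
by apply: le_lt_trans hr; rewrite ler_wpM2l// lerDl.
Qed.

(** Both sides send the tangent vector of a line curve to that of the same conjugated curve. The
    order is reversed because matrices act on row vectors from the right. *)
Lemma Ad_mul g h : Ad L (g * h)%g = Ad L h *m Ad L g.
Proof.
apply/row_matrixP => i; rewrite !rowE mulmxA.
have t := line_curve_tangent (delta_mx 0 i).
apply: tangent_curve_uniq (tangent_curve_conj (g * h)%g t) _.
have := tangent_curve_conj g (tangent_curve_conj h t).
congr (tangent_curve _ _); apply/funext => s.
by rewrite invgM !mulgA.
Qed.

Lemma Ad1 : Ad L 1%g = 1%:M.
Proof.
apply/row_matrixP => i; rewrite !rowE mulmx1.
have t := line_curve_tangent (delta_mx 0 i).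
apply: tangent_curve_uniq (tangent_curve_conj 1%g t) _.
move: t; congr (tangent_curve _ _); apply/funext => s.
by rewrite mul1g invg1 mulg1.
Qed.

Lemma AdV g : Ad L g *m Ad L g^-1%g = 1%:M.
Proof. by rewrite -Ad_mul mulVg Ad1. Qed.

(** Left translation by [g] is conjugation by [g] followed by right translation by [g]; this is the
    chain rule at 1. *)
Lemma Ad_dright : exists2 r, 0 < r & forall v, `|v - v0| < r ->
  Ad L (phi v) *m dright v = dleft v.
Proof.
have [r r0 H] := near_v0; exists r => // v /H[vc kv].
set g := phi v.
apply: strict_diff_uniq (dleft_strict_diff vc).
have fD := Ad_strict_diff g.
have E : kap (g * phi v0 * g^-1)%g = v0 by rewrite chart1_inv0 mulg1 mulgV.
have gE := dright_strict_diff vc; rewrite -[X in strict_diff _ X]E in gE.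
apply: strict_diff_near (strict_diff_comp fD gE).
have n1 : nbhs (1%g : G) [set y | chart_dom (chart1 L) (g * y * g^-1)%g].
  apply: (continuous_mulg2 L); rewrite mulg1 mulgV.
  by apply: open_nbhs_nbhs; split; [exact: chart_dom_open|exact: chart1_dom1].
have [r' r'0 H'] := near_chart chart1_dom1 n1.
exists r' => // w /H'[/= w1 _ _].
by rewrite /phi /kap chart_mapK// -!/phi mulgVK.
Qed.

(** The derivatives of [dleft] and [dright] at [v0] in the direction [w]: mixed second partials of
    the product at (1, 1). Their difference [ad] is the Lie bracket, with [Y *m ad X] in the role of
    [X, Y]. *)
Definition dleft' (w : 'rV[R]_d) : 'M[R]_d := \matrix_(i, j)
  (row_mx w 0 *m partials ('D_(delta_mx 0 (rshift d i)) mul1) (row_mx v0 v0)) 0 j.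
Definition dright' (w : 'rV[R]_d) : 'M[R]_d := \matrix_(i, j)
  (row_mx 0 w *m partials ('D_(delta_mx 0 (lshift d i)) mul1) (row_mx v0 v0)) 0 j.
Definition ad w := dleft' w - dright' w.

Lemma partial_mul1_strict_diff i : strict_diff ('D_(delta_mx 0 i) mul1) (row_mx v0 v0)
  (partials ('D_(delta_mx 0 i) mul1) (row_mx v0 v0)).
Proof.
apply: C1_strict_diff (dom1_l chart_cod0) _; first exact: chart_mul_dom_open.
have [_ /= H] := mulg_smooth chart1_atlas chart1_atlas chart1_atlas 2.
by have [_] := H i.
Qed.

Lemma dleft_deriv (c : R -> 'rV[R]_d) w : c 0 = v0 -> has_deriv c 0 w ->
  has_deriv (dleft \o c) 0 (dleft' w).
Proof.
move=> c0 cw; apply: has_deriv_entryP => i j; rewrite mxE.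
have cw' : has_deriv (fun s => row_mx (c s) v0) 0 (row_mx w 0).
  have := strict_diff_curve (strict_diff_row_mxl v0 (c 0)) cw.
  by rewrite mul_mx_row mulmx1 mulmx0.
have sd := partial_mul1_strict_diff (rshift d i); rewrite -{1}c0 in sd.
have := has_deriv_entry 0 j (strict_diff_curve sd cw').
by apply: has_deriv_near; exists 1 => // h _; rewrite !mxE.
Qed.

Lemma dright_deriv (c : R -> 'rV[R]_d) w : c 0 = v0 -> has_deriv c 0 w ->
  has_deriv (dright \o c) 0 (dright' w).
Proof.
move=> c0 cw; apply: has_deriv_entryP => i j; rewrite mxE.
have cw' : has_deriv (fun s => row_mx v0 (c s)) 0 (row_mx 0 w).
  have := strict_diff_curve (strict_diff_row_mxr v0 (c 0)) cw.
  by rewrite mul_mx_row mulmx1 mulmx0.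
have sd := partial_mul1_strict_diff (lshift d i).
rewrite -[X in strict_diff _ (row_mx _ X)]c0 in sd.
have := has_deriv_entry 0 j (strict_diff_curve sd cw').
by apply: has_deriv_near; exists 1 => // h _; rewrite !mxE.
Qed.

End Adjoint.

(** The differentiability of [X] is part of the conclusion. With [E = X - 1] and [N = A - B] one has
    [E = N - E (B - 1)]. As [B - 1] tends to 0, this first bounds [E] by [2 N], which is O(s), and
    then shows that [E (B - 1)] is o(s). *)
Lemma has_deriv_quotient (R : realType) d (X A B : R -> 'M[R]_d) A' B' :
  (exists2 r, 0 < r & forall s, `|s| < r -> X s *m B s = A s) ->
  X 0 = 1%:M -> A 0 = 1%:M -> B 0 = 1%:M ->
  has_deriv A 0 A' -> has_deriv B 0 B' -> has_deriv X 0 (A' - B').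
Proof.
move=> [r r0 XB] X0 A0 B0 dA dB.
have dN : has_deriv (fun s => A s - B s) 0 (A' - B').
  exact: has_derivD dA (has_derivN dB).
pose N s := A s - B s; pose E s := X s - 1%:M.
have EE s : `|s| < r -> E s = N s - E s *m (B s - 1%:M).
  move=> sr; rewrite /E /N mulmxBr mulmx1 mulmxBl XB// mul1mx.
  by rewrite [in RHS]opprB [RHS]addrC subrK.
have N0 : N 0 = 0 by rewrite /N A0 B0 subrr.
pose dR : R := d%:R + 1; have dR0 : 0 < dR by rewrite ltr_wpDl.
have cB := has_deriv_continuous dB.
have smallB del : 0 < del -> exists2 r, 0 < r & forall s, `|s| < r ->
    dR * `|B s - 1%:M| <= del.
  move=> del0; have [r1 r10 H1] := continuous_at_epsE cB (divr_gt0 del0 dR0).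
  exists r1 => // s sr; rewrite mulrC -ler_pdivlMr//.
  by have := H1 s; rewrite subr0 B0 => /(_ sr) /ltW.
have prodle s : `|E s *m (B s - 1%:M)| <= `|E s| * (dR * `|B s - 1%:M|).
  apply: (le_trans (mx_norm_mulmx _ _)); rewrite mulrCA ler_wpM2l//.
  by rewrite ler_wpM2r// lerDl.
have half0 : 0 < 2^-1 :> R by rewrite invr_gt0.
have [r1 r10 HB] := smallB _ half0.
have E2 s : `|s| < r -> `|s| < r1 -> `|E s| <= 2 * `|N s|.
  move=> sr sr1; have h1 : `|E s| <= `|N s| + `|E s| * (dR * `|B s - 1%:M|).
    rewrite {1}EE//; apply: (le_trans (ler_normB _ _)).
    by rewrite lerD2l.
  have h2 : `|E s| * (dR * `|B s - 1%:M|) <= `|E s| * 2^-1.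
    by rewrite ler_wpM2l// HB.
  lra.
pose K := `|A' - B'| + 1; have K0 : 0 < K by rewrite ltr_wpDl.
have [r2 r20 H2] := dN _ ltr01.
have NK s : `|s| < r2 -> `|N s| <= K * `|s|.
  move=> sr; have := H2 s sr; rewrite add0r -/(N s) -/(N 0) N0 subr0 mul1r => h.
  rewrite -[N s](subrK (s *: (A' - B'))); apply: (le_trans (ler_normD _ _)).
  by rewrite normrZ /K mulrDl mul1r addrC [ `|s| * _]mulrC lerD2l.
move=> e e0; have e2 : 0 < e / 2 by rewrite divr_gt0.
have [r3 r30 H3] := dN _ e2.
have [r4 r40 H4] := smallB _ (divr_gt0 e2 (mulr_gt0 (ltr0Sn R 1) K0)).
exists (Num.min r (Num.min r1 (Num.min r2 (Num.min r3 r4)))).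
  by rewrite !lt_min r0 r10 r20 r30.
move=> h; rewrite !lt_min => /and5P[hr h1 h2 h3 h4].
have := H3 h h3; rewrite add0r -/(N h) -/(N 0) N0 subr0 => le3.
rewrite X0 -/(E h) {1}EE// addrAC; apply: (le_trans (ler_normB _ _)).
rewrite [e]splitr mulrDl lerD//; apply: (le_trans (prodle h)).
apply: (@le_trans _ _ ((2 * K * `|h|) * (e / 2 / (2 * K)))).
  apply: ler_pM; rewrite ?mulr_ge0 ?(ltW dR0)//; last exact: H4.
  by apply: (le_trans (E2 h hr h1)); rewrite -mulrA ler_wpM2l// NK.
rewrite mulrC mulrA divfK// gt_eqF// mulr_gt0//.
Qed.

(** * The Lie bracket: bilinearity, antisymmetry, equivariance, Jacobi identity *)

Section AdjointAlgebra.
Variables (R : realType) (d : nat) (G : TopologyGroup.type).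
Variable L : lie_structure R d G.

Notation phi := (chart_inv (chart1 L)).
Notation kap := (chart_map (chart1 L)).
Notation v0 := (kap 1%g).

Lemma tangent_curve_Ad c X : tangent_curve L c X ->
  has_deriv (fun s => Ad L (c s)) 0 (ad L X).
Proof.
move=> cX; have [c0 cc dc] := cX; have [r r0 cd] := tangent_curve_near cX.
have k0 : (kap \o c) 0 = v0 by rewrite /= c0.
apply: (has_deriv_quotient (A := dleft L \o (kap \o c)) (B := dright L \o (kap \o c))).
- have [r1 r10 H1] := Ad_dright L.
  have [r2 r20 H2] := continuous_at_epsE (has_deriv_continuous dc) r10.
  exists (Num.min r r2); first by rewrite lt_min r0.
  move=> s; rewrite lt_min => /andP[sr s2] /=.
  rewrite -{1}(chart_mapK (cd s sr)); apply: H1.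
  by have := H2 s; rewrite subr0 k0; apply.
- by rewrite c0 Ad1.
- by rewrite /= c0 dleft0.
- by rewrite /= c0 dright0.
- exact: dleft_deriv.
- exact: dright_deriv.
Qed.

Lemma adD X Y : ad L (X + Y) = ad L X + ad L Y.
Proof.
have E1 : row_mx (X + Y) 0 = row_mx X 0 + row_mx Y 0 :> 'rV[R]_(d + d).
  by rewrite add_row_mx addr0.
have E2 : row_mx 0 (X + Y) = row_mx 0 X + row_mx 0 Y :> 'rV[R]_(d + d).
  by rewrite add_row_mx addr0.
rewrite /ad addrACA -opprD; congr (_ - _); apply/matrixP => i j.
  by rewrite [LHS]mxE E1 mulmxDl [LHS]mxE [RHS]mxE; congr (_ + _); rewrite [RHS]mxE.
by rewrite [LHS]mxE E2 mulmxDl [LHS]mxE [RHS]mxE; congr (_ + _); rewrite [RHS]mxE.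
Qed.

Lemma adZ a X : ad L (a *: X) = a *: ad L X.
Proof.
have E1 : row_mx (a *: X) 0 = a *: row_mx X 0 :> 'rV[R]_(d + d).
  by rewrite scale_row_mx scaler0.
have E2 : row_mx 0 (a *: X) = a *: row_mx 0 X :> 'rV[R]_(d + d).
  by rewrite scale_row_mx scaler0.
rewrite /ad scalerBr; congr (_ - _); apply/matrixP => i j.
  by rewrite [LHS]mxE E1 -scalemxAl [LHS]mxE [RHS]mxE; congr (_ * _); rewrite [RHS]mxE.
by rewrite [LHS]mxE E2 -scalemxAl [LHS]mxE [RHS]mxE; congr (_ * _); rewrite [RHS]mxE.
Qed.

Lemma ad_row_lin (f : 'rV[R]_d -> 'M[R]_d) X :
  (forall X Y, f (X + Y) = f X + f Y) -> (forall a X, f (a *: X) = a *: f X) ->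
  f X = \sum_k X 0 k *: f (delta_mx 0 k).
Proof.
move=> fD fZ; have f0 : f 0 = 0 by rewrite -[0](scale0r 0) fZ scale0r.
rewrite {1}[X]row_sum_delta; elim/big_ind2 : _ => //.
  by move=> x y z w <- <-; rewrite fD.
Qed.

(** On basis vectors the bracket is a difference of two mixed second partials of the product; the
    symmetry of second partials lets [i] and [k] be exchanged up to sign. *)
Lemma ad_delta i k : (delta_mx 0 i : 'rV[R]_d) *m ad L (delta_mx 0 k) =
  - ((delta_mx 0 k : 'rV[R]_d) *m ad L (delta_mx 0 i)).
Proof.
apply/rowP => j.
have oD : open (dom1 L) by exact: (@chart_mul_dom_open R d G L).
have [D DC DE] : exists2 D : 'I_(d + d) -> 'I_(d + d) -> R,
    (forall x y, D x y = D y x) &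
    forall x y, partials ('D_(delta_mx 0 x) (mul1 L)) (row_mx v0 v0) y j = D x y.
  exists (fun x y => partials ('D_(delta_mx 0 x) (mul1 L)) (row_mx v0 v0) y j) => // x y.
  rewrite [LHS]mxE [RHS]mxE.
  apply: (congr1 (fun M : 'rV[R]_d => M 0 j)).
  exact: (@Schwarz R _ _ (dom1 L) (mul1 L) (row_mx v0 v0) x y oD (dom1_l (chart_cod0 L))
    (mulg_smooth (chart1_atlas L) (chart1_atlas L) (chart1_atlas L) 2)).
have H a b : ((delta_mx 0 a : 'rV[R]_d) *m ad L (delta_mx 0 b)) 0 j =
   D (rshift d a) (lshift d b) - D (lshift d a) (rshift d b).
  have E1 : row_mx (delta_mx 0 b) 0 = delta_mx 0 (lshift d b) :> 'rV[R]_(d + d).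
    by rewrite -delta_mx_lshift.
  have E2 : row_mx 0 (delta_mx 0 b) = delta_mx 0 (rshift d b) :> 'rV[R]_(d + d).
    by rewrite -delta_mx_rshift.
  rewrite -rowE [LHS]mxE [LHS]mxE [X in _ + X]mxE -!DE; congr (_ - _).
    by rewrite [LHS]mxE E1 -rowE [LHS]mxE.
  by rewrite [LHS]mxE E2 -rowE [LHS]mxE.
rewrite [RHS]mxE !H opprB (DC (rshift d i)) (DC (lshift d i)).
by [].
Qed.

Lemma ad_anti X Y : X *m ad L Y = - (Y *m ad L X).
Proof.
have adE := ad_row_lin _ adD adZ.
rewrite (adE X) (adE Y) mulmx_sumr mulmx_sumr -sumrN.
under eq_bigr do rewrite -scalemxAr {1}[X]row_sum_delta mulmx_suml scaler_sumr.
under [RHS]eq_bigr do rewrite -scalemxAr {1}[Y]row_sum_delta mulmx_suml scaler_sumr -sumrN.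
rewrite exchange_big/=; apply: eq_bigr => i _; apply: eq_bigr => k _.
by rewrite -!scalemxAl !scalerA ad_delta mulrC scalerN.
Qed.

Lemma ad_equivariant g X : ad L (X *m Ad L g) = Ad L g^-1%g *m ad L X *m Ad L g.
Proof.
have t := line_curve_tangent L X.
have d1 := tangent_curve_Ad (tangent_curve_conj g t).
have d2 := has_deriv_mulr (Ad L g) (has_deriv_mull (Ad L g^-1%g) (tangent_curve_Ad t)).
apply: has_deriv_uniq d1 (has_deriv_near _ d2).
by exists 1 => // h _; rewrite !Ad_mul mulmxA.
Qed.

(** Differentiate the equivariance [Ad (c s) *m ad (X *m Ad (c s)) = ad X *m Ad (c s)] at 0 along a
    curve [c] with tangent [Y]. In this form no inverse has to be differentiated. *)
Lemma ad_jacobi X Y : ad L (X *m ad L Y) = ad L X *m ad L Y - ad L Y *m ad L X.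
Proof.
have t := line_curve_tangent L Y; set c := line_curve L Y in t.
have tA := tangent_curve_Ad t; have [c0 _ _] := t.
have adE := ad_row_lin _ adD adZ.
have dX : has_deriv (fun s => X *m Ad L (c s)) 0 (X *m ad L Y).
  exact: has_deriv_mull.
have dadX : has_deriv (fun s => ad L (X *m Ad L (c s))) 0 (ad L (X *m ad L Y)).
  apply: has_deriv_entryP => i j.
  rewrite adE summxE; apply/has_derivP.
  have -> : (fun s => ad L (X *m Ad L (c s)) i j) =
     \sum_k (fun s => (X *m Ad L (c s)) 0 k * ad L (delta_mx 0 k) i j).
    apply/funext => s; rewrite adE summxE fct_sumE; apply: eq_bigr => k _.
    by rewrite mxE.
  apply: is_derive_sum => k.
  have /has_derivP dk := has_deriv_entry 0 k dX.
  have dc := is_derive_cst (ad L (delta_mx 0 k) i j) (0 : R) (1 : R).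
  apply: (is_derive_eq (is_deriveM dk dc)).
  by rewrite scaler0 add0r [RHS]mxE [RHS]mulrC.
have d1 := has_deriv_mulmx tA dadX.
have d2 : has_deriv (fun s => ad L X *m Ad L (c s)) 0 (ad L X *m ad L Y).
  exact: has_deriv_mull.
have := has_deriv_uniq (has_deriv_near _ d1) d2.
rewrite c0 Ad1 mulmx1 mul1mx => <-; first by rewrite addrAC subrr add0r.
exists 1 => // h _; rewrite add0r ad_equivariant !mulmxA.
by rewrite AdV mul1mx.
Qed.

End AdjointAlgebra.

(** * One-parameter subgroups *)

(* Unification must not unfold the jacobians. *)
Local Opaque Ad ad.

Section OneParameter.
Variables (R : realType) (d : nat) (G : TopologyGroup.type).
Variable L : lie_structure R d G.

Notation phi := (chart_inv (chart1 L)).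
Notation kap := (chart_map (chart1 L)).
Notation v0 := (kap 1%g).

Lemma one_parameter0 gam X : one_parameter L gam X -> gam 0 = 1%g.
Proof.
by move=> [_ gD _]; apply: (mulgI (gam 0)); rewrite -gD addr0 mulg1.
Qed.

Lemma one_parameterP gam X : one_parameter L gam X <->
  [/\ continuous gam, (forall s t, gam (s + t) = (gam s * gam t)%g)
    & tangent_curve L gam X].
Proof.
split=> [gX|[gc gD [_ _ /has_derivP gX]]]; last by split.
have g0 := one_parameter0 gX; have [gc gD /has_derivP gd] := gX.
by split => //; split => //; exact: gc.
Qed.

Lemma one_parameterN gam X t : one_parameter L gam X -> gam (- t) = (gam t)^-1%g.
Proof.
move=> gX; have [_ gD _] := gX; apply: (mulgI (gam t)).
by rewrite -gD subrr mulgV (one_parameter0 gX).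
Qed.

Lemma one_parameterX gam X t n : one_parameter L gam X ->
  gam (n%:R * t) = (gam t ^+ n)%g.
Proof.
move=> gX; have [_ gD _] := gX; elim: n => [|n IH].
  by rewrite mul0r expg0 (one_parameter0 gX).
by rewrite expgS -IH -gD -natr1 mulrDl mul1r addrC.
Qed.

Lemma one_parameter_conj gam X g : one_parameter L gam X ->
  one_parameter L (fun t => g * gam t * g^-1)%g (X *m Ad L g).
Proof.
move=> /one_parameterP[gc gD gX]; apply/one_parameterP; split.
- by move=> t; exact: (cvg_comp _ _ (gc t) (@continuous_mulg2 _ _ _ L g g^-1%g (gam t))).
- by move=> s t; rewrite gD -!mulgA mulKg.
- exact: tangent_curve_conj.
Qed.

Lemma one_parameter_scale gam X a : one_parameter L gam X ->
  one_parameter L (fun t => gam (a * t)) (a *: X).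
Proof.
move=> gX; have g0 := one_parameter0 gX.
move: gX => /one_parameterP[gc gD [_ _ gX]].
have gac : continuous (fun t => gam (a * t)).
  by move=> t; apply: continuous_comp; [exact: mulrl_continuous|exact: gc].
apply/one_parameterP; split => //; first by move=> s t; rewrite mulrDr gD.
split; [by rewrite mulr0|exact: gac|].
by apply: (@has_deriv_scale _ _ (kap \o gam)); rewrite mulr0.
Qed.

Lemma one_parameter_mul gam gam' X X' :
  (forall s t, gam s * gam' t = gam' t * gam s)%g ->
  one_parameter L gam X -> one_parameter L gam' X' ->
  one_parameter L (fun t => gam t * gam' t)%g (X + X').
Proof.
move=> cm /one_parameterP[gc gD gX] /one_parameterP[gc' gD' gX'].
apply/one_parameterP; split.
- by move=> t; exact: (cvg_comp _ _ (cvg_pair (gc t) (gc' t)) (@mulg_continuous _ _ _ L (_, _))).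
- by move=> s t; rewrite gD gD' -!mulgA; congr (_ * _)%g; rewrite !mulgA cm.
- exact: tangent_curve_mul.
Qed.

Lemma one_parameter_cst : one_parameter L (fun=> 1%g) 0.
Proof.
split; [exact: cst_continuous|by move=> s t; rewrite mulg1|].
by apply/has_derivP; exact: has_deriv_cst.
Qed.

(** The curve [gam (- s) * gam' s] has derivative 0 at 0. Since its value at [s + h] is its value at
    [h] multiplied by [gam (- s)] on the left and [gam' s] on the right, the derivative vanishes at
    every small [s], so the curve is constant near 0. Division of [t] by a large integer extends the
    equality to all [t]. *)
Lemma one_parameter_uniq gam gam' X :
  one_parameter L gam X -> one_parameter L gam' X -> gam = gam'.
Proof.
move=> gX gX'; have [gc gD tX] := (one_parameterP _ _).1 gX.
have [gc' gD' tX'] := (one_parameterP _ _).1 gX'.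
have tN := (one_parameterP _ _).1 (one_parameter_scale (-1) gX).
have [_ _ {}tN] := tN.
pose del s := (gam (-1 * s)%R * gam' s)%g.
have tdel : tangent_curve L del 0.
  by have := tangent_curve_mul tN tX'; rewrite scaleN1r addNr.
have del0 : del 0 = 1%g by case: tdel.
have [r r0 dd] := tangent_curve_near tdel.
have near_eq t : `|t| < r -> gam t = gam' t.
  move=> tr; suff dt : del t = 1%g.
    apply: (mulgI (gam (-1 * t))); rewrite -gD mulN1r addNr.
    by rewrite -mulN1r -[RHS]/(del t) dt (one_parameter0 gX).
  rewrite -(chart_mapK (dd t tr)) -[RHS](chart_mapK (chart1_dom1 L)); congr (phi _).
  rewrite -del0; apply: (@has_deriv0_eq R 1 d (kap \o del)) => s sle.
  have sr := le_lt_trans sle tr.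
  have [|D sD] := @strict_diff_mul2 _ _ _ L (gam (-1 * s)) (gam' s) 1%g _ _
     (chart1_atlas L) (chart1_atlas L) (chart1_dom1 L).
    by rewrite mulg1; exact: dd.
  have [_ _ dk] := tdel; rewrite -del0 in sD.
  have := strict_diff_curve sD dk; rewrite mul0mx => h0.
  apply/has_deriv_shift; apply: has_deriv_near h0; exists r => // h hr.
  rewrite add0r /= (chart_mapK (dd h hr)); congr (kap _).
  by rewrite /del mulrDr gD [s + h]addrC gD' -!mulgA.
apply/funext => t.
pose n := Num.bound (`|t| / r).
have n0 : 0 < n.+1%:R :> R by rewrite ltr0Sn.
have tn : `|t / n.+1%:R| < r.
  rewrite normrM normfV (gtr0_norm n0) ltr_pdivrMr// mulrC -ltr_pdivrMr//.
  apply: (@lt_trans _ _ n%:R); last by rewrite ltr_nat.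
  by apply: archi_boundP; rewrite divr_ge0// ltW.
have -> : t = n.+1%:R * (t / n.+1%:R) by rewrite mulrC divfK// gt_eqF.
by rewrite (one_parameterX _ _ gX) (one_parameterX _ _ gX') near_eq.
Qed.

Lemma Ad_fix_commute gam X g : one_parameter L gam X -> X *m Ad L g = X ->
  forall t, (g * gam t = gam t * g)%g.
Proof.
move=> gX Xg t; have := one_parameter_conj g gX; rewrite Xg => gX'.
by rewrite {2}(one_parameter_uniq gX gX') mulgVK.
Qed.

Lemma commute_Ad_fix gam X g : one_parameter L gam X ->
  (forall t, g * gam t = gam t * g)%g -> X *m Ad L g = X.
Proof.
move=> gX gc; have := one_parameter_conj g gX.
have -> : (fun t => g * gam t * g^-1)%g = gam by apply/funext => t; rewrite gc mulgK.
move=> /one_parameterP[_ _ t1]; have /one_parameterP[_ _ t2] := gX.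
exact: tangent_curve_uniq t1 t2.
Qed.

(** By the homomorphism property the derivative of [Y *m Ad (gam s)] is
    [Y *m ad X *m Ad (gam s) = 0], so [Y] is fixed by every [Ad (gam s)]; uniqueness of
    one-parameter subgroups turns this into commutation. *)
Lemma ad_commute gam gam' X Y : one_parameter L gam X -> one_parameter L gam' Y ->
  Y *m ad L X = 0 -> forall s t, (gam s * gam' t = gam' t * gam s)%g.
Proof.
move=> gX gY YX s t; apply: (Ad_fix_commute gY).
have [_ gD tX] := (one_parameterP _ _).1 gX.
have -> : Y *m Ad L (gam s) = Y *m Ad L (gam 0).
  apply: (@has_deriv0_eq R 1 d (fun s => Y *m Ad L (gam s))) => u _.
  apply/has_deriv_shift.
  have := has_deriv_mulr (Ad L (gam u)) (has_deriv_mull Y (tangent_curve_Ad tX)).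
  rewrite YX mul0mx => H.
  apply: (@has_deriv_near R 'rV[R]_d (fun s => Y *m Ad L (gam s) *m Ad L (gam u)) _ 0 0 _ H).
  by exists 1; [exact: ltr01|move=> h _; rewrite add0r gD Ad_mul mulmxA].
by rewrite (one_parameter0 gX) Ad1 mulmx1.
Qed.

End OneParameter.

(** * Vectors fixed by a finite maximal abelian subgroup *)

Lemma compact_norm_ball (R : realType) n (x : 'rV[R]_n) r :
  compact [set v : 'rV[R]_n | `|v - x| <= r].
Proof.
have [r0|r0] := ltP r 0.
  rewrite (_ : [set _ | _] = set0); first exact: compact0.
  by apply/seteqP; split => // v /=; rewrite leNgt (lt_le_trans r0).
rewrite (_ : [set _ | _] =
  [set v : 'rV[R]_n | forall i, `[x 0 i - r, x 0 i + r]%classic (v ord0 i)]).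
  by apply: (@rV_compact R n (fun i => `[x 0 i - r, x 0 i + r]%classic)) => i;
    exact: segment_compact.
apply/seteqP; split => v /= H.
  move=> i; rewrite in_itv/= -ler_distl.
  by apply: le_trans H; have := mx_norm_entry (v - x) 0 i; rewrite !mxE.
apply: mx_norm_le => // i j; rewrite (ord1 i) !mxE.
by have := H j; rewrite in_itv/= -ler_distl.
Qed.

(** * Local inversion of a map whose differential is a positive scalar *)

Section LocalInversion.
Variables (R : realType) (n : nat) (f : 'rV[R]_n -> 'rV[R]_n) (x : 'rV[R]_n) (a : R).
Hypotheses (a0 : 0 < a) (fD : strict_diff f x a%:M).

Lemma strict_diff_inj : exists2 r, 0 < r &
  forall y z, `|y - x| < r -> `|z - x| < r -> f y = f z -> y = z.
Proof.
have a2 : 0 < a / 2 by rewrite divr_gt0.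
have [r r0 H] := fD a2; exists r => // y z yr zr fyz.
have := H y z yr zr; rewrite fyz subrr sub0r normrN mul_mx_scalar normrZ (gtr0_norm a0).
move=> h; apply/eqP; rewrite -subr_eq0 -normr_eq0 eq_le normr_ge0 andbT leNgt.
apply/negP => p; have : a <= a / 2 by rewrite -(ler_pM2r p).
by rewrite leNgt ltr_pdivrMr// ltr_pMr// ltr1n.
Qed.

(** Take [z] minimizing the distance from [f z] to [y] on a closed ball. The Newton map [T]
    contracts by 1/2 and preserves the ball, and [a] times its displacement is that distance; so
    [T z] would halve the minimum, which must therefore be 0. *)
Lemma strict_diff_surj r : 0 < r -> exists2 rho, 0 < rho &
  forall y, `|y - f x| < rho -> exists2 z, `|z - x| < r & f z = y.
Proof.
move=> r0; have a2 : 0 < a / 2 by rewrite divr_gt0.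
have [r1 r10 H1] := fD a2; have [r2 r20 H2] := strict_diff_lip fD.
pose K := n%:R * `|a%:M : 'M[R]_n| + 1; have K0 : 0 < K by rewrite ltr_wpDl// mulr_ge0.
pose s := Num.min r (Num.min r1 r2) / 2.
have m0 : 0 < Num.min r (Num.min r1 r2) by rewrite !lt_min r0 r10.
have s0 : 0 < s by rewrite divr_gt0.
have : s < Num.min r (Num.min r1 r2) by rewrite ltr_pdivrMr// ltr_pMr// ltr1n.
rewrite !lt_min => /and3P[sr sr1 sr2]; clearbody s.
(* This radius makes [T] move the centre by less than [s / 2], so that [T] maps the ball of radius
   [s] to itself. *)
exists (a * s / 2); first by rewrite divr_gt0// mulr_gt0.
move=> y ya.
pose B := [set v : 'rV[R]_n | `|v - x| <= s].
have B0 : B !=set0 by exists x; rewrite /B/= subrr normr0 ltW.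
have hc : {within B, continuous (fun z => `|f z - y|)}.
  apply: continuous_in_subspaceT => z; rewrite inE /B/= => zs.
  apply: (@continuous_at_eps R 'rV[R]_n R^o) => eps eps0.
  exists (Num.min (r2 - s) (eps / K)); first by rewrite lt_min subr_gt0 sr2 divr_gt0.
  move=> z'; rewrite lt_min => /andP[z1 z2].
  apply: (le_lt_trans (ler_dist_dist _ _)).
  rewrite opprB addrA subrK.
  apply: (@le_lt_trans _ _ (K * `|z' - z|)); last by rewrite mulrC -ltr_pdivlMr.
  apply: H2; last exact: le_lt_trans sr2.
  have -> : z' - x = (z' - z) + (z - x) by rewrite addrA subrK.
  apply: (le_lt_trans (ler_normD _ _)).
  by rewrite -(subrK s r2) ltr_leD.
have [z zB zmin] := compact_EVT_min B0 (@compact_norm_ball R n x s) hc.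
rewrite inE /B/= in zB.
exists z; first exact: le_lt_trans sr.
pose T v := v - a^-1 *: (f v - y).
have aK u : a *: (a^-1 *: u) = u :> 'rV[R]_n by rewrite scalerA divff ?gt_eqF// scale1r.
have T2 u v : `|u - x| <= s -> `|v - x| <= s -> `|T u - T v| <= `|u - v| / 2.
  move=> us vs; have := H1 u v (le_lt_trans us sr1) (le_lt_trans vs sr1).
  rewrite mul_mx_scalar.
  have -> : f u - f v - a *: (u - v) = - (a *: (T u - T v)).
    have -> : T u - T v = (u - v) - a^-1 *: (f u - f v).
      have E (p q k l : 'rV[R]_n) : p - q - (k - l) = p - k - (q - l).
        by rewrite !opprB [LHS]addrACA [RHS]addrACA [- q - k]addrC.
      by rewrite /T E -scalerBr opprB addrA subrK.
    by rewrite [in RHS]scalerBr aK opprB.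
  by rewrite normrN normrZ (gtr0_norm a0) -mulrA ler_pM2l// mulrC.
have fT v : `|f v - y| = a * `|T v - v|.
  rewrite /T addrAC subrr add0r normrN normrZ ger0_norm ?invr_ge0 ?ltW//.
  by rewrite mulrA divff ?gt_eqF// mul1r.
have Tx : `|T x - x| < s / 2.
  rewrite -(ltr_pM2l a0) -fT distrC; apply: (lt_le_trans ya).
  by rewrite mulrA.
have TB : `|T z - x| <= s.
  rewrite -(subrK (T x) (T z)) -addrA; apply: (le_trans (ler_normD _ _)).
  rewrite [s]splitr lerD// ?(ltW Tx)//.
  apply: (le_trans (T2 z x zB _)); first by rewrite subrr normr0 ltW.
  by rewrite ler_pM2r.
have := zmin (T z); rewrite inE /B/= => /(_ TB).
rewrite !fT ler_pM2l// => h1.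
have h2 := T2 (T z) z TB zB.
have : `|T z - z| <= 0 by have := le_trans h1 h2; lra.
rewrite normr_le0 => /eqP E.
have := fT z; rewrite E normr0 mulr0 => /eqP; rewrite normr_eq0 subr_eq0 => /eqP.
by [].
Qed.

End LocalInversion.

(** The elements of [A] and [x] commute pairwise, so the double centralizer of their union is an
    abelian subgroup containing [A] and [x]; maximality makes it [A]. *)
Lemma maximal_abelian_centralizer (G : groupType) (A : set G) x :
  maximal_abelian A -> (forall a, A a -> (x * a)%g = (a * x)%g) -> A x.
Proof.
move=> [[sA cA] mA] xA; pose S := A `|` [set x].
have cS y z : S y -> S z -> (y * z)%g = (z * y)%g.
  by move=> [Ay|->] [Az|->] //; [exact: cA|rewrite xA|rewrite xA].
pose B := centralizer (centralizer S).
have SB : S `<=` B by move=> y Sy z /(_ y Sy).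
have BS : B `<=` centralizer S by move=> y By z Sz; apply: By => w Sw; exact: cS.
rewrite -(mA B) ?inE//; first by apply: SB; right.
  split; first split.
  - by move=> y _; rewrite mul1g mulg1.
  - by move=> y z By Bz w wS; rewrite -mulgA (Bz _ wS) mulgA (By _ wS) -mulgA.
  - move=> y By w wS.
    by rewrite -[in LHS](mulgK y w) -(By w wS) -!mulgA mulKg.
  - by move=> y z By Bz; apply: By; exact: BS.
by move=> a Aa; apply: SB; left.
Qed.

(** Asking for every [r'] below the radius makes the condition hereditary, so the minimum of the
    radii works although [P] need not be monotone. *)
Lemma seq_radius (R : realType) (T : eqType) (s : seq T) (P : T -> R -> Prop) :
  (forall x, x \in s -> exists2 r, 0 < r & forall r', r' < r -> P x r') ->
  exists2 r, 0 < r & forall r', r' < r -> forall x, x \in s -> P x r'.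
Proof.
elim: s => [|x s IH] H; first by exists 1.
have [|r r0 Hr] := IH; first by move=> y ys; apply: H; rewrite inE ys orbT.
have [|r1 r10 H1] := H x; first by rewrite inE eqxx.
exists (Num.min r r1); first by rewrite lt_min r0.
move=> r'; rewrite lt_min => /andP[h h1] y; rewrite inE => /orP[/eqP ->|ys].
  exact: H1.
exact: Hr.
Qed.

(** * The equivariant averaged chart *)

Section FixedVector.
Variables (R : realType) (d : nat) (G : TopologyGroup.type).
Variable L : lie_structure R d G.
Variable A : set G.
Hypotheses (finA : finite_set A) (maxA : maximal_abelian A).

Notation phi := (chart_inv (chart1 L)).
Notation kap := (chart_map (chart1 L)).
Notation v0 := (kap 1%g).

Let S := enum_fset (fset_set A).

Lemma mem_enumA a : (a \in S) = (a \in A).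
Proof. by rewrite -in_fset_set. Qed.

(* Averaging the chart over [A] makes it equivariant. *)
Definition average_chart (v : 'rV[R]_d) : 'rV[R]_d :=
  \sum_(a <- S) (kap (a * phi v * a^-1)%g - v0) *m Ad L a^-1%g.

Lemma average_chart0 : average_chart v0 = 0.
Proof.
rewrite /average_chart big1_seq// => a _.
by rewrite chart1_inv0 mulg1 mulgV subrr mul0mx.
Qed.

(** Each summand has differential [Ad a *m Ad a^-1 = 1], so the total is a positive scalar, the case
    covered by local inversion. *)
Lemma average_chart_strict_diff : strict_diff average_chart v0 ((size S)%:R%:M).
Proof.
have E : \sum_(a <- S) (1%:M : 'M[R]_d) = ((size S)%:R%:M).
  by rewrite big_const_seq count_predT iter_addr_0 -[RHS]scalemx1 scaler_nat.
rewrite -E; apply: strict_diff_sum => a.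
have := strict_diff_comp (Ad_strict_diff L a)
  (@strict_diff_affine R d d (Ad L a^-1%g) (- (v0 *m Ad L a^-1%g)) _).
rewrite AdV; apply: strict_diff_near; exists 1; first exact: ltr01.
by move=> y _ /=; rewrite mulmxBl.
Qed.

Lemma average_chart_equivariant b v : A b ->
  chart_dom (chart1 L) (b * phi v * b^-1)%g ->
  average_chart (kap (b * phi v * b^-1)%g) = average_chart v *m Ad L b.
Proof.
move=> Ab vb; have [[[A1 AM AV] cA] _] := maxA.
rewrite /average_chart (chart_mapK vb).
have pS : perm_eq [seq (a * b)%g | a <- S] S.
  apply: uniq_perm; rewrite ?fset_uniq ?map_inj_uniq ?fset_uniq//; first exact: mulIg.
  move=> c; apply/mapP/idP => [[a aS ->]|cS].
    by move: aS; rewrite !mem_enumA !inE => Aa; exact: AM.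
  exists (c * b^-1)%g; last by rewrite mulgVK.
  by move: cS; rewrite !mem_enumA !inE => Ac; apply: AM => //; exact: AV.
rewrite -[in RHS](perm_big _ pS)/= big_map mulmx_suml; apply: eq_bigr => a _.
rewrite -mulmxA -Ad_mul; congr (_ *m Ad L _); last by rewrite invgM mulgA mulgV mul1g.
by congr (kap _ - _); rewrite invgM !mulgA.
Qed.

Lemma Ad_fixed0 (w : 'rV[R]_d) : (forall a, A a -> w *m Ad L a = w) -> w = 0.
Proof.
move=> wA; have [[[A1 AM AV] cA] _] := maxA.
have n0 : 0 < (size S)%:R :> R.
  rewrite ltr0n lt0n size_eq0; apply/eqP => S0.
  by have := mem_enumA 1%g; rewrite S0 in_nil => /esym/negP; apply; rewrite inE.
have [rinj rinj0 inj] := strict_diff_inj n0 average_chart_strict_diff.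
have [r1 r10 H1] : exists2 r, 0 < r & forall r', r' < r -> forall b, b \in S ->
    forall v, `|v - v0| <= r' -> `|kap (b * phi v * b^-1)%g - v0| < rinj /\
      chart_dom (chart1 L) (b * phi v * b^-1)%g.
  apply: (@seq_radius R _ S (fun b r' => forall v, `|v - v0| <= r' ->
     `|kap (b * phi v * b^-1)%g - v0| < rinj /\ chart_dom (chart1 L) (b * phi v * b^-1)%g)).
  move=> b _.
  have [r r0 Hr] := continuous_at_epsE (strict_diff_continuous (Ad_strict_diff L b)) rinj0.
  have n1 : nbhs (1%g : G) [set y | chart_dom (chart1 L) (b * y * b^-1)%g].
    apply: (continuous_mulg2 L); rewrite mulg1 mulgV.
    by apply: open_nbhs_nbhs; split; [exact: chart_dom_open|exact: chart1_dom1].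
  have [r2 r20 H2] := near_chart (chart1_dom1 L) n1.
  exists (Num.min r r2); first by rewrite lt_min r0.
  move=> r'; rewrite lt_min => /andP[h h2] v vr; split; last first.
    by have [] := H2 v (le_lt_trans vr h2).
  have := Hr v (le_lt_trans vr h).
  by rewrite chart1_inv0 mulg1 mulgV.
(* A finite set is closed in a Hausdorff space, so 1 is an isolated point of [A]. *)
have nA : nbhs (1%g : G) [set y | A y -> y = 1%g].
  have cl : closed (A `\ (1%g : G)).
    have /accessible_finite_set_closed := hausdorff_accessible (lie_hausdorff L).
    by apply; exact: finite_setD.
  have := open_nbhs_nbhs (conj (closed_openC cl) (_ : (~` (A `\ (1%g : G))) 1%g)).
  move=> /(_ (fun h => h.2 erefl)); apply: filterS => y /= ny Ay.
  by have [//|/eqP yn] := eqVneq y 1%g; case: ny.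
have [r2 r20 H2] := near_chart (chart1_dom1 L) nA.
pose r := Num.min rinj (Num.min r1 r2).
have r_gt0 : 0 < r by rewrite !lt_min rinj0 r10.
have [rho rho0 surj] := strict_diff_surj n0 average_chart_strict_diff r_gt0.
pose s := rho / (`|w| + 1).
have w1 : 0 < `|w| + 1 by rewrite ltr_wpDl.
have s0 : 0 < s by rewrite divr_gt0.
(* Solve for the point with averaged coordinates [s *: w]. Conjugation by [b] in [A] preserves these
   coordinates, so by injectivity it fixes [phi x]; then [phi x] lies in [A] near 1, hence is 1, and
   [s *: w] is 0. *)
have [|x xr xE] := surj (s *: w).
  rewrite average_chart0 subr0 normrZ (gtr0_norm s0) /s mulrAC ltr_pdivrMr//.
  by rewrite ltr_pM2l// ltrDl.
move: xr; rewrite !lt_min => /and3P[xinj x1 x2].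
have [Ax cx dx] := H2 x x2; have [_ kx] := chart_invP cx.
have fixx b : A b -> (b * phi x * b^-1)%g = phi x.
  move=> Ab; have [|kb db] := H1 _ x1 b _ x (lexx _); first by rewrite mem_enumA inE.
  rewrite -(chart_mapK db); congr (phi _); apply: inj => //.
  by rewrite average_chart_equivariant// xE -scalemxAl wA.
have {}Ax : phi x = 1%g.
  apply: Ax; apply: (maximal_abelian_centralizer maxA) => b Ab.
  by rewrite -{1}(fixx b Ab) mulgVK.
have xv0 : x = v0 by rewrite -kx Ax.
move: xE; rewrite xv0 average_chart0 => /esym/eqP.
by rewrite scaler_eq0 gt_eqF//= => /eqP.
Qed.

End FixedVector.

(** * An inner product invariant under the adjoint representation *)

Section InvariantForm.
Variables (R : realType) (d : nat) (gT : groupType) (rho : gT -> 'M[R]_d) (K : R).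
Hypotheses (rho1 : rho 1%g = 1%:M)
  (rhoM : forall g h, rho (g * h)%g = rho h *m rho g)
  (K0 : 0 < K) (rhoK : forall g, `|rho g| <= K).

(** [act] is the action on bilinear forms. [sq] is a squared Euclidean norm: comparable with the
    maximum norm, it also obeys the parallelogram law. [K2] bounds [act g] in norm, [kappa] bounds
    its effect on [sq] from below, and [c] measures how positive every [act g 1] is. *)
Let act g Q := rho g *m Q *m (rho g)^T.
Let sq (Q : 'M[R]_d) := \sum_(ij : 'I_d * 'I_d) Q ij.1 ij.2 ^+ 2.
Let qf (v : 'rV[R]_d) (Q : 'M[R]_d) := (v *m Q *m v^T) 0 0.
Let dR : R := d%:R + 1.
Let K2 := dR * (dR * (K * K)).
Let c := (dR * K) ^- 2.
Let kappa := (dR * dR * K2 ^+ 2)^-1.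

Let dR0 : 0 < dR. Proof. by rewrite ltr_wpDl. Qed.
Let d_dR : d%:R <= dR. Proof. by rewrite lerDl. Qed.
Let K20 : 0 < K2. Proof. by rewrite !mulr_gt0. Qed.
Let c0 : 0 < c. Proof. by rewrite invr_gt0 exprn_gt0// mulr_gt0. Qed.
Let kappa0 : 0 < kappa. Proof. by rewrite invr_gt0 !mulr_gt0// exprn_gt0. Qed.

Let actM g h Q : act h (act g Q) = act (g * h)%g Q.
Proof. by rewrite /act rhoM trmx_mul !mulmxA. Qed.

Let act1 Q : act 1%g Q = Q.
Proof. by rewrite /act rho1 trmx1 mul1mx mulmx1. Qed.

Let actD g Q Q' : act g (Q + Q') = act g Q + act g Q'.
Proof. by rewrite /act mulmxDr mulmxDl. Qed.

Let actZ g a Q : act g (a *: Q) = a *: act g Q.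
Proof. by rewrite /act -scalemxAr -scalemxAl. Qed.

Let actB g Q Q' : act g (Q - Q') = act g Q - act g Q'.
Proof. by rewrite actD -scaleN1r actZ scaleN1r. Qed.

Let mulmx_le m n p (A : 'M[R]_(m, n)) (B : 'M[R]_(n, p)) a b :
  n%:R <= dR -> `|A| <= a -> `|B| <= b -> `|A *m B| <= dR * (a * b).
Proof.
move=> nd Aa Bb; apply: (le_trans (mx_norm_mulmx _ _)).
by rewrite ler_pM ?mulr_ge0// ler_pM.
Qed.

Let norm_tr m n (A : 'M[R]_(m, n)) : `|A^T| <= `|A|.
Proof. by apply: mx_norm_le => // i j; rewrite mxE mx_norm_entry. Qed.

Let act_le g Q : `|act g Q| <= K2 * `|Q|.
Proof.
have -> : K2 * `|Q| = dR * (dR * (K * `|Q|) * K) by rewrite /K2; ring.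
rewrite /act; apply: mulmx_le => //; first exact: mulmx_le.
by apply: le_trans (norm_tr _) _.
Qed.

Let sq_ge0 Q : 0 <= sq Q.
Proof. by apply: sumr_ge0 => ij _; rewrite sqr_ge0. Qed.

Let sq_ge Q : `|Q| ^+ 2 <= sq Q.
Proof.
have H ij : Q ij.1 ij.2 ^+ 2 <= sq Q.
  by rewrite /sq (bigD1 ij)//= lerDl; apply: sumr_ge0 => k _; rewrite sqr_ge0.
have s0 := sq_ge0 Q; rewrite -[leRHS]sqr_sqrtr//.
rewrite ler_pXn2r ?nnegrE ?sqrtr_ge0//; apply: mx_norm_le => [|i j].
  exact: sqrtr_ge0.
by rewrite -sqrtr_sqr ler_sqrt//; exact: (H (i, j)).
Qed.

Let sq_le Q : sq Q <= dR * dR * `|Q| ^+ 2.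
Proof.
apply: (@le_trans _ _ (\sum_(ij : 'I_d * 'I_d) `|Q| ^+ 2)).
  apply: ler_sum => -[i j] _ /=; rewrite -[leLHS]real_normK ?num_real//.
  by rewrite ler_pXn2r ?nnegrE// mx_norm_entry.
rewrite sumr_const card_prod card_ord -(mulr_natl (`|Q| ^+ 2)) natrM ler_wpM2r ?sqr_ge0//.
by rewrite ler_pM.
Qed.

Let act_ge g Q : kappa * sq Q <= sq (act g Q).
Proof.
rewrite /kappa ler_pdivrMl ?mulr_gt0 ?exprn_gt0//.
apply: (le_trans (sq_le Q)).
rewrite -[leRHS]mulrA ler_pM2l ?mulr_gt0//.
apply: (@le_trans _ _ (K2 ^+ 2 * `|act g Q| ^+ 2)); last by rewrite ler_pM2l ?exprn_gt0// sq_ge.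
rewrite -exprMn ler_pXn2r ?nnegrE ?(mulr_ge0 (ltW K20))//.
by have := act_le g^-1%g (act g Q); rewrite actM mulgV act1.
Qed.

(* The invariant form is the one minimizing [spread] on the convex set [C],
   unique by the parallelogram law; this replaces averaging over the group. *)
Let spread Q := sup [set sq (act g Q) | g in [set: gT]].

Let spread_sup Q : has_sup [set sq (act g Q) | g in [set: gT]].
Proof.
split; first by exists (sq (act 1%g Q)), 1%g.
exists (dR * dR * (K2 * `|Q|) ^+ 2) => _ [g _ <-].
apply: (le_trans (sq_le _)); rewrite ler_pM2l ?mulr_gt0//.
by rewrite ler_pXn2r ?nnegrE ?(mulr_ge0 (ltW K20))// act_le.
Qed.

Let spread_ge g Q : sq (act g Q) <= spread Q.
Proof. by apply: sup_upper_bound; [exact: spread_sup|exists g]. Qed.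

Let spread_le Q b : (forall g, sq (act g Q) <= b) -> spread Q <= b.
Proof.
move=> H; apply: ge_sup; first by have [] := spread_sup Q.
by move=> _ [g _ <-].
Qed.

Let spread_act h Q : spread (act h Q) <= spread Q.
Proof. by apply: spread_le => g; rewrite actM; exact: spread_ge. Qed.

(** Positivity is imposed along the whole orbit with the fixed constant [c]: the set is then stable
    under the action and under midpoints, and a limit of its members remains positive definite. *)
Let C := [set Q : 'M[R]_d | Q^T = Q /\
  forall g v, c * `|v| ^+ 2 <= qf v (act g Q)].

Let C_act h Q : C Q -> C (act h Q).
Proof.
move=> [QT QC]; split; first by rewrite /act !trmx_mul trmxK QT mulmxA.
by move=> g v; rewrite actM; exact: QC.
Qed.

Let qfD v Q Q' : qf v (Q + Q') = qf v Q + qf v Q'.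
Proof. by rewrite /qf mulmxDr mulmxDl mxE. Qed.

Let qfZ v a Q : qf v (a *: Q) = a * qf v Q.
Proof. by rewrite /qf -scalemxAr -scalemxAl mxE. Qed.

Let C_mid Q Q' : C Q -> C Q' -> C (2^-1 *: (Q + Q')).
Proof.
move=> [QT QC] [QT' QC']; split; first by rewrite linearZ/= linearD/= QT QT'.
move=> g v; rewrite actZ actD qfZ qfD.
have := QC g v; have := QC' g v; set a := _ * _ ^+ 2; lra.
Qed.

Let C1 : C 1%:M.
Proof.
split; first exact: trmx1.
move=> g v; rewrite /act mulmx1 /qf mulmxA -mulmxA -trmx_mul.
set w := v *m rho g.
have vw : `|v| <= dR * K * `|w|.
  have -> : v = w *m rho g^-1%g by rewrite /w -mulmxA -rhoM mulVg rho1 mulmx1.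
  by rewrite -mulrA [K * _]mulrC; exact: mulmx_le d_dR (lexx _) (rhoK _).
clearbody w.
have w2 : `|w| ^+ 2 <= (w *m w^T) 0 0.
  have -> : (w *m w^T) 0 0 = \sum_j w 0 j ^+ 2.
    by rewrite mxE; apply: eq_bigr => j _; rewrite mxE expr2.
  have s0 : 0 <= \sum_j w 0 j ^+ 2 by apply: sumr_ge0 => j _; rewrite sqr_ge0.
  rewrite -[leRHS]sqr_sqrtr// ler_pXn2r ?nnegrE ?sqrtr_ge0//.
  apply: mx_norm_le => [|i j]; first exact: sqrtr_ge0.
  rewrite (ord1 i) -sqrtr_sqr ler_sqrt// (bigD1 j)//= lerDl.
  by apply: sumr_ge0 => k _; rewrite sqr_ge0.
apply: le_trans w2; rewrite /c mulrC ler_pdivrMr ?exprn_gt0 ?mulr_gt0//.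
by rewrite mulrC -exprMn ler_pXn2r ?nnegrE ?mulr_ge0 ?(ltW dR0) ?(ltW K0).
Qed.

Let m := inf [set spread Q | Q in C].

Let spread_inf : has_inf [set spread Q | Q in C].
Proof.
split; first by exists (spread 1%:M), 1%:M.
by exists 0 => _ [Q _ <-]; apply: le_trans (spread_ge 1%g Q); exact: sq_ge0.
Qed.

Let m_le Q : C Q -> m <= spread Q.
Proof. by move=> CQ; apply: inf_lbound; [exact: spread_inf.2|exists Q]. Qed.

Let parallelogram Q Q' :
  sq (2^-1 *: (Q + Q')) = (sq Q + sq Q') / 2 - sq (Q - Q') / 4%:R.
Proof.
rewrite /sq -big_split/= !mulr_suml -sumrB; apply: eq_bigr => ij _.
by rewrite !mxE; field.
Qed.

(** The midpoint of two near-minimizers lies in [C], so its spread is at least [m], while the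
    parallelogram law lowers it by a quarter of [kappa * sq (Q - Q')]. *)
Let almost_min_close Q Q' e : C Q -> C Q' -> spread Q <= m + e -> spread Q' <= m + e ->
  kappa * `|Q - Q'| ^+ 2 <= 4%:R * e.
Proof.
move=> CQ CQ' Qe Qe'.
have h : spread (2^-1 *: (Q + Q')) <= m + e - kappa * sq (Q - Q') / 4%:R.
  apply: spread_le => g; rewrite actZ actD parallelogram -actB.
  have := act_ge g (Q - Q'); have := spread_ge g Q; have := spread_ge g Q'.
  lra.
have h2 := m_le (C_mid CQ CQ').
have h3 : kappa * `|Q - Q'| ^+ 2 <= kappa * sq (Q - Q') by rewrite ler_pM2l.
lra.
Qed.

Let close e : 0 < e -> exists2 e', 0 < e' & forall Q Q', C Q -> C Q' ->
  spread Q <= m + e' -> spread Q' <= m + e' -> `|Q - Q'| < e.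
Proof.
move=> e0; exists (kappa * e ^+ 2 / 8%:R).
  by rewrite divr_gt0// mulr_gt0// exprn_gt0.
move=> Q Q' CQ CQ' h h'; have := almost_min_close CQ CQ' h h'.
rewrite ltNge => H; apply/negP => eQ.
have : kappa * e ^+ 2 <= kappa * `|Q - Q'| ^+ 2.
  by rewrite ler_pM2l// ler_pXn2r ?nnegrE// ltW.
have : 0 < kappa * e ^+ 2 by rewrite mulr_gt0// exprn_gt0.
lra.
Qed.

(** By [close], a minimizing sequence is Cauchy. The action does not increase [spread], so
    [act g (u n)] is as nearly minimal as [u n] and hence close to it; the limit is invariant. *)
Lemma bounded_rep_invariant_form : exists Q : 'M[R]_d,
  [/\ forall g, rho g *m Q *m (rho g)^T = Q, Q^T = Q &
      forall v : 'rV[R]_d, v != 0 -> 0 < (v *m Q *m v^T) 0 0].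
Proof.
have ex n : exists Q, C Q /\ spread Q <= m + n.+1%:R^-1.
  have [|_ [Q CQ <-] Qn] := @inf_adherent R [set spread Q | Q in C] n.+1%:R^-1 _ spread_inf.
    by rewrite invr_gt0 ltr0Sn.
  by exists Q; split => //; exact: ltW.
pose u n := sval (cid (ex n)).
have uC n : C (u n) by rewrite /u; case: cid => ? [].
have un n : spread (u n) <= m + n.+1%:R^-1 by rewrite /u; case: cid => ? [].
have unear e : 0 < e -> \forall n \near \oo, spread (u n) <= m + e.
  move=> e0; near=> n; apply: (le_trans (un n)); rewrite lerD2l; apply: ltW.
  by near: n; exact: near_infty_natSinv_lt (PosNum e0).
have ucvg : cvgn u.
  apply/cauchy_cvgP/cauchy_exP => e e0.
  have [e' e'0 He'] := close e0.
  have [N _ HN] := unear _ e'0; exists (u N); exists N => // n Nn.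
  rewrite /= -ball_normE/=; apply: He' => //; first exact: HN (leqnn N).
  exact: HN.
pose Q := limn u.
have uQ e : 0 < e -> \forall n \near \oo, `|Q - u n| < e.
  by move=> e0; move/cvgrPdist_lt: ucvg; exact.
have eq0 m1 n1 (X : 'M[R]_(m1, n1)) : (forall e, 0 < e -> `|X| <= e) -> X = 0.
  move=> H; apply/eqP; rewrite -normr_eq0 eq_le normr_ge0 andbT.
  by apply/ler_addgt0Pl => e e0; rewrite addr0 H.
exists Q; split.
- move=> g; apply/eqP; rewrite -subr_eq0; apply/eqP; apply: eq0 => e e0.
  have e2 : 0 < e / 2 by rewrite divr_gt0.
  have [e' e'0 He'] := close e2.
  have K21 : 0 < K2 + 1 by rewrite addr_gt0.
  near \oo => n.
  have -> : rho g *m Q *m (rho g)^T - Q =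
     (act g (Q - u n) - (Q - u n)) + (act g (u n) - u n).
    rewrite actB -/(act g Q)
      [LHS](_ : _ = act g Q - act g (u n) + (u n - Q) + (act g (u n) - u n)) ?opprB//.
    by rewrite addrACA subrK [u n - Q]addrC addrK.
  apply: (le_trans (ler_normD _ _)); rewrite [e]splitr lerD//.
    apply: (@le_trans _ _ ((K2 + 1) * `|Q - u n|)).
      apply: (le_trans (ler_normB _ _)); rewrite mulrDl mul1r lerD2r.
      exact: act_le.
    rewrite mulrC -ler_pdivlMr//; apply: ltW; near: n; apply: uQ.
    by rewrite divr_gt0.
  apply: ltW; apply: He' => //; first exact: C_act.
    by apply: le_trans (spread_act g _) _; near: n; exact: unear.
  by near: n; exact: unear.
- apply/eqP; rewrite -subr_eq0; apply/eqP; apply: eq0 => e e0.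
  have e2 : 0 < e / 2 by rewrite divr_gt0.
  near \oo => n.
  have -> : Q^T - Q = (Q - u n)^T - (Q - u n).
    by rewrite linearB/= (uC n).1 opprB addrA subrK.
  have h : `|Q - u n| <= e / 2 by apply: ltW; near: n; exact: uQ.
  apply: (le_trans (ler_normB _ _)); rewrite [e]splitr lerD//.
  exact: le_trans (norm_tr _) h.
- move=> v v0; have nv : 0 < `|v| by rewrite normr_gt0.
  (* At this distance, replacing [Q] by [u n] changes the value at [v] by at most half of the lower
     bound for [u n]. *)
  have e0 : 0 < c / (dR * dR) / 2 by rewrite !divr_gt0// mulr_gt0.
  near \oo => n.
  have h : `|Q - u n| < c / (dR * dR) / 2 by near: n; exact: uQ.
  have h1 := (uC n).2 1%g v; rewrite act1 in h1.
  rewrite -/(qf v Q) -[Q](subrK (u n)) qfD.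
  have h2 : `|qf v (Q - u n)| <= c / 2 * `|v| ^+ 2.
    apply: (le_trans (mx_norm_entry _ _ _)).
    have : `|v *m (Q - u n) *m v^T| <= dR * (dR * (`|v| * (c / (dR * dR) / 2)) * `|v|).
      apply: mulmx_le => //; apply: mulmx_le => //; exact: ltW.
    move=> /le_trans; apply; rewrite le_eqVlt; apply/orP; left; apply/eqP.
    by field; rewrite gt_eqF.
  have : 0 < c * `|v| ^+ 2 by rewrite mulr_gt0// exprn_gt0.
  move: h2; rewrite ler_norml => /andP[h2 _]; lra.
Unshelve. all: by end_near. Qed.

End InvariantForm.

Lemma cvg_preimage (T U : topologicalType) (f : T -> U) (x : T) (y : U) (W : set U) :
  f z @[z --> x] --> y -> nbhs y W -> nbhs x (f @^-1` W).
Proof. by move=> fxy yW; exact: fxy. Qed.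

(** * Boundedness of Ad on a compact group and the invariance of the form under ad *)

Section AdInvariantForm.
Variables (R : realType) (d : nat) (G : TopologyGroup.type).
Variable L : lie_structure R d G.

Notation phi := (chart_inv (chart1 L)).
Notation kap := (chart_map (chart1 L)).
Notation v0 := (kap 1%g).

Lemma dleft_near eps : 0 < eps -> exists2 r, 0 < r &
  forall v, `|v - v0| < r -> `|dleft L v - 1%:M| <= eps.
Proof.
move=> eps0.
have [|r r0 H] := @seq_radius R _ (enum 'I_d) (fun i r' => forall v : 'rV[R]_d,
    `|v - v0| <= r' -> `|row i (dleft L v) - row i (dleft L v0)| <= eps).
  move=> i _.
  have D := strict_diff_comp (strict_diff_row_mxl v0 v0) (partial_mul1_strict_diff L (rshift d i)).
  have [r r0 H] := continuous_at_epsE (strict_diff_continuous D) eps0.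
  exists r => // r' rr v vr; apply: ltW.
  have rE w : row i (dleft L w) = 'D_(delta_mx 0 (rshift d i)) (mul1 L) (row_mx w v0).
    by apply/rowP => j; rewrite !mxE.
  by rewrite (rE v) (rE v0); exact: (H v (le_lt_trans vr rr)).
exists r => // v vr; apply: mx_norm_le => [|i j]; first exact: ltW.
have := H _ vr i (mem_enum _ i) v (lexx _); rewrite dleft0; apply: le_trans.
by have := mx_norm_entry (row i (dleft L v) - row i 1%:M) 0 j; rewrite !mxE.
Qed.

Lemma dright_near eps : 0 < eps -> exists2 r, 0 < r &
  forall v, `|v - v0| < r -> `|dright L v - 1%:M| <= eps.
Proof.
move=> eps0.
have [|r r0 H] := @seq_radius R _ (enum 'I_d) (fun i r' => forall v : 'rV[R]_d,
    `|v - v0| <= r' -> `|row i (dright L v) - row i (dright L v0)| <= eps).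
  move=> i _.
  have D := strict_diff_comp (strict_diff_row_mxr v0 v0) (partial_mul1_strict_diff L (lshift d i)).
  have [r r0 H] := continuous_at_epsE (strict_diff_continuous D) eps0.
  exists r => // r' rr v vr; apply: ltW.
  have rE w : row i (dright L w) = 'D_(delta_mx 0 (lshift d i)) (mul1 L) (row_mx v0 w).
    by apply/rowP => j; rewrite !mxE.
  by rewrite (rE v) (rE v0); exact: (H v (le_lt_trans vr rr)).
exists r => // v vr; apply: mx_norm_le => [|i j]; first exact: ltW.
have := H _ vr i (mem_enum _ i) v (lexx _); rewrite dright0; apply: le_trans.
by have := mx_norm_entry (row i (dright L v) - row i 1%:M) 0 j; rewrite !mxE.
Qed.

(** With [X B = A] one has [X - 1 = (A - 1) - (B - 1) - (X - 1) (B - 1)]. Once [B] is close to 1 the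
    last term is at most half of [X - 1] and can be absorbed. *)
Lemma Ad_near1 eps : 0 < eps -> nbhs (1%g : G) [set u | `|Ad L u - 1%:M| <= eps].
Proof.
move=> eps0.
pose dR : R := d%:R + 1; have dR0 : 0 < dR by rewrite ltr_wpDl.
have [r1 r10 H1] := Ad_dright L.
have e4 : 0 < eps / 4%:R by rewrite divr_gt0.
have [r2 r20 H2] := dleft_near e4; have [r3 r30 H3] := dright_near e4.
have i2 : 0 < (2 * dR)^-1 by rewrite invr_gt0 mulr_gt0.
have [r4 r40 H4] := dright_near i2.
pose r := Num.min r1 (Num.min r2 (Num.min r3 r4)).
have r0 : 0 < r by rewrite !lt_min r10 r20 r30.
have nk : nbhs (1%g : G) [set u | chart_dom (chart1 L) u /\ `|kap u - v0| < r].
  have n1 : nbhs (1%g : G) (chart_dom (chart1 L)).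
    by apply: open_nbhs_nbhs; split; [exact: chart_dom_open|exact: chart1_dom1].
  have n2 : nbhs (1%g : G) [set u | `|kap u - v0| < r].
    exact: (chart_map_continuous (chart1_dom1 L) (@norm_ball_nbhs R 'rV[R]_d v0 r r0)).
  exact: filterI.
apply: filterS nk => u [ud]; rewrite !lt_min => /and4P[u1 u2 u3 u4] /=.
have := H1 _ u1; rewrite (chart_mapK ud) => E.
set X := Ad L u in E *; set B := dright L (kap u) in E; set A := dleft L (kap u) in E.
have A1 : `|A - 1%:M| <= eps / 4%:R by exact: H2.
have B1 : `|B - 1%:M| <= eps / 4%:R by exact: H3.
have B2 : `|B - 1%:M| <= (2 * dR)^-1 by exact: H4.
clearbody X A B.
have EE : X - 1%:M = (A - 1%:M) - (B - 1%:M) - (X - 1%:M) *m (B - 1%:M).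
  rewrite mulmxBr mulmx1 mulmxBl E mul1mx.
  by rewrite opprB addrA subrK opprB addrCA subrr addr0.
have h : `|(X - 1%:M) *m (B - 1%:M)| <= `|X - 1%:M| / 2.
  apply: (le_trans (mx_norm_mulmx _ _)).
  apply: (@le_trans _ _ (dR * (`|X - 1%:M| * (2 * dR)^-1))).
    by rewrite ler_pM ?mulr_ge0// ?lerDl// ler_wpM2l.
  by rewrite le_eqVlt; apply/orP; left; apply/eqP; field; rewrite gt_eqF.
have : `|X - 1%:M| <= eps / 4%:R + eps / 4%:R + `|X - 1%:M| / 2.
  rewrite {1}EE; apply: (le_trans (ler_normB _ _)); rewrite lerD//.
  by apply: (le_trans (ler_normB _ _)); rewrite lerD.
lra.
Qed.

Lemma Ad_bounded : compact [set: G] -> exists2 K, 0 < K & forall g, `|Ad L g| <= K.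
Proof.
move=> cG; have ne : [set: G] !=set0 by exists 1%g.
have hc : {within [set: G], continuous (fun g => `|Ad L g|)}.
  apply: continuous_in_subspaceT => g _.
  apply/cvgrPdist_lt => eps eps0.
  have ge0 : 0 < d%:R * `|Ad L g| + 1 by rewrite ltr_wpDl// mulr_ge0.
  have n1 := Ad_near1 (divr_gt0 eps0 ge0).
  have n2 : nbhs g [set x | `|Ad L (g^-1 * x)%g - 1%:M| <= eps / (d%:R * `|Ad L g| + 1)].
    have cm : (g^-1 * x * 1)%g @[x --> g] --> (1%g : G).
      have := @continuous_mulg2 _ _ _ L g^-1%g 1%g g.
      by rewrite /prop_for /continuous_at mulVg mulg1.
    have n3 := cvg_preimage cm n1.
    by apply: filterS n3 => x; rewrite /preimage/= mulg1.
  apply: filterS n2 => x /= hx.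
  apply: (le_lt_trans (ler_dist_dist _ _)); rewrite distrC.
  have -> : Ad L x - Ad L g = (Ad L (g^-1 * x)%g - 1%:M) *m Ad L g.
    by rewrite mulmxBl mul1mx -Ad_mul mulVKg.
  apply: (le_lt_trans (mx_norm_mulmx _ _)); rewrite mulrCA.
  apply: (@le_lt_trans _ _ (eps / (d%:R * `|Ad L g| + 1) * (d%:R * `|Ad L g|))).
    by rewrite ler_wpM2r// mulr_ge0.
  by rewrite mulrAC ltr_pdivrMr// ltr_pM2l// ltrDl.
have [g _ Hg] := compact_EVT_max ne cG hc.
exists (`|Ad L g| + 1); first by rewrite ltr_wpDl.
by move=> h; apply: (le_trans (Hg h _)); rewrite ?inE// lerDl.
Qed.

Lemma ad_invariant_form : compact [set: G] -> exists Q : 'M[R]_d,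
  [/\ forall X, ad L X *m Q = - (Q *m (ad L X)^T), Q^T = Q &
      forall v : 'rV[R]_d, v != 0 -> 0 < (v *m Q *m v^T) 0 0].
Proof.
move=> /Ad_bounded[K K0 HK].
have [Q [Qinv QT Qpos]] := bounded_rep_invariant_form (Ad1 L) (Ad_mul L) K0 HK.
exists Q; split => // X.
have t := line_curve_tangent L X; set c := line_curve L X in t.
have [c0 _ _] := t; have dA := tangent_curve_Ad t.
have dAT : has_deriv (fun s => (Ad L (c s))^T) 0 (ad L X)^T.
  apply: has_deriv_entryP => i j; rewrite mxE.
  apply: has_deriv_near (has_deriv_entry j i dA).
  by exists 1; [exact: ltr01|move=> h _; rewrite [RHS]mxE].
have d1 := has_deriv_mulmx (has_deriv_mulr Q dA) dAT.
have d2 : has_deriv (fun s => Ad L (c s) *m Q *m (Ad L (c s))^T) 0 0.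
  apply: has_deriv_near (has_deriv_cst Q 0).
  by exists 1; [exact: ltr01|move=> h _; rewrite Qinv].
have := has_deriv_uniq d1 d2; rewrite c0 Ad1 trmx1 mulmx1 mul1mx.
by move=> /eqP; rewrite addr_eq0 => /eqP.
Qed.

End AdInvariantForm.

(** * Weight spaces commute *)

Section ComplexMatrices.
Variable R : realType.
Implicit Types m n p : nat.

Definition toC m n (M : 'M[R]_(m, n)) : 'M[R[i]]_(m, n) := map_mx (real_complex R) M.
Definition reM m n (M : 'M[R[i]]_(m, n)) : 'M[R]_(m, n) := map_mx (@complex.Re R) M.
Definition imM m n (M : 'M[R[i]]_(m, n)) : 'M[R]_(m, n) := map_mx (@complex.Im R) M.
Definition conjM m n (M : 'M[R[i]]_(m, n)) : 'M[R[i]]_(m, n) := map_mx (@conjc R) M.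

Lemma toC_mul m n p (A : 'M[R]_(m, n)) (B : 'M[R]_(n, p)) : toC (A *m B) = toC A *m toC B.
Proof. exact: map_mxM. Qed.

Lemma toCD m n (A B : 'M[R]_(m, n)) : toC (A + B) = toC A + toC B.
Proof. exact: map_mxD. Qed.

Lemma toCN m n (A : 'M[R]_(m, n)) : toC (- A) = - toC A.
Proof. exact: map_mxN. Qed.

Lemma toC0 m n : toC (0 : 'M[R]_(m, n)) = 0.
Proof. exact: map_mx0. Qed.

Lemma toC_inj m n : injective (@toC m n).
Proof. by move=> A B /matrixP AB; apply/matrixP => i j; have := AB i j; rewrite !mxE => -[]. Qed.

Lemma conjM_mul m n p (A : 'M[R[i]]_(m, n)) (B : 'M[R[i]]_(n, p)) :
  conjM (A *m B) = conjM A *m conjM B.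
Proof. exact: map_mxM. Qed.

Lemma conjMZ m n a (A : 'M[R[i]]_(m, n)) : conjM (a *: A) = conjc a *: conjM A.
Proof. exact: map_mxZ. Qed.

Lemma conjM_toC m n (A : 'M[R]_(m, n)) : conjM (toC A) = toC A.
Proof. by apply/matrixP => i j; rewrite !mxE conjc_real. Qed.

Lemma conjMK m n : involutive (@conjM m n).
Proof. by move=> A; apply/matrixP => i j; rewrite !mxE conjcK. Qed.

Lemma reimE m n (M : 'M[R[i]]_(m, n)) : M = toC (reM M) + 'i%C *: toC (imM M).
Proof. by apply/matrixP => i j; rewrite !mxE [LHS]complexE. Qed.

Lemma reM_toC m n (A : 'M[R]_(m, n)) : reM (toC A) = A.
Proof. by apply/matrixP => i j; rewrite !mxE. Qed.

Lemma imM_toC m n (A : 'M[R]_(m, n)) : imM (toC A) = 0.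
Proof. by apply/matrixP => i j; rewrite !mxE. Qed.

Lemma reM_mul m n p (A : 'M[R[i]]_(m, n)) (B : 'M[R]_(n, p)) : reM (A *m toC B) = reM A *m B.
Proof.
apply/matrixP => i j; rewrite !mxE raddf_sum; apply: eq_bigr => k _.
by rewrite !mxE; case: (A i k) => a b /=; rewrite mulr0 subr0.
Qed.

Lemma imM_mul m n p (A : 'M[R[i]]_(m, n)) (B : 'M[R]_(n, p)) : imM (A *m toC B) = imM A *m B.
Proof.
apply/matrixP => i j; rewrite !mxE raddf_sum; apply: eq_bigr => k _.
by rewrite !mxE; case: (A i k) => a b /=; rewrite mulr0 add0r.
Qed.

Lemma reM_conj m n (M : 'M[R[i]]_(m, n)) : toC (reM M) = 2^-1 *: (M + conjM M).
Proof.
apply/matrixP => i j; rewrite !mxE; case: (M i j) => a b.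
apply: (mulfI (_ : 2 != 0 :> R[i])); first by rewrite pnatr_eq0.
by rewrite mulrA divff ?pnatr_eq0// mul1r addcJ.
Qed.

End ComplexMatrices.

(** * Arithmetic of the weights of iterated brackets *)

Section DivisibleCombination.
Local Open Scope nat_scope.

(** For [X], [Y] of weights [i], [j], the number is the weight of [X] bracketed [k'] times with the
    vector obtained from [Y] by [k] brackets with [X]. After division by gcd(i, j), the multiplier
    of [k'] can be made invertible modulo [m]. *)
Lemma exists_dvdn_combination m i j : (0 < m)%N -> (0 < j)%N ->
  exists k k', (m %| i + k' * (j + k * i))%N.
Proof.
move=> m_gt0 j0; have [->|i0] := posnP i.
  by exists 0%N, m; rewrite add0n dvdn_mulr.
pose e := gcdn i j.
have e0 : (0 < e)%N by rewrite gcdn_gt0 i0.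
have [i' iE] := dvdnP (dvdn_gcdl i j); have [j' jE] := dvdnP (dvdn_gcdr i j).
rewrite -/e in iE jE.
have cij : coprime i' j'.
  rewrite /coprime -(eqn_pmul2r e0) muln_gcdl -iE -jE mul1n.
  by rewrite -/e eqxx.
have j'0 : (0 < j')%N by move: j0; rewrite jE muln_gt0 => /andP[].
(* This is the part of [m] prime to [j']. A prime factor of [m] divides exactly one of [j'] and [k];
   as [i'] is prime to [j'], it cannot divide [j' + k * i']. *)
pose k := (m`_(\pi(j')^'))%N.
have cop : coprime (j' + k * i') m.
  rewrite /coprime -dvdn1; apply/contraT => /negP H; exfalso.
  have g1 : (1 < gcdn (j' + k * i') m)%N.
    rewrite ltn_neqAle gcdn_gt0 m_gt0 orbT andbT; apply/eqP => gE.
    by apply: H; rewrite -gE.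
  have pr := pdiv_prime g1; set r := pdiv _ in pr.
  have := pdiv_dvd (gcdn (j' + k * i') m); rewrite -/r dvdn_gcd => /andP[r1 r2].
  have [rj|rj] := boolP (r %| j')%N.
    have : (r %| k * i')%N by rewrite -(dvdn_addr _ rj).
    rewrite Euclid_dvdM// => /orP[rk|ri].
      have /pnatP /(_ r pr rk) := part_pnat (\pi(j')^') m; move=> /(_ (part_gt0 _ _)).
      by rewrite !inE/= mem_primes pr j'0 rj.
    have : (r %| gcdn i' j')%N by rewrite dvdn_gcd ri.
    by rewrite (eqP cij) dvdn1 => /eqP r1'; rewrite r1' in pr.
  have rk : (r %| k)%N.
    move: r2; rewrite -{1}(partnC (\pi(j')^') m_gt0) Euclid_dvdM// => /orP[//|rk'].
    have /pnatP /(_ r pr rk') := part_pnat (\pi(j')^')^' m; move=> /(_ (part_gt0 _ _)).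
    by rewrite !inE/= negbK mem_primes pr j'0/= (negPf rj).
  by move: r1; rewrite dvdn_addl ?(negPf rj)// dvdn_mulr.
have c0 : (0 < j' + k * i')%N by rewrite addn_gt0 j'0.
have [[u v] /= uv] := coprimeP _ c0 cop.
(* [u] inverts [j' + k * i'] modulo [m], and [m.-1] stands for -1. *)
exists k, (u * i' * m.-1)%N.
have -> : (i + u * i' * m.-1 * (j + k * i) = e * (i' + i' * m.-1 * (u * (j' + k * i'))))%N.
  rewrite jE iE; ring.
have -> : (u * (j' + k * i') = 1 + v * m)%N by lia.
have mE := prednK m_gt0; set m1 := m.-1 in mE *; clearbody m1.
by apply/dvdnP; exists (e * i' * (1 + m1 * v))%N; rewrite -mE -addn1; ring.
Qed.

End DivisibleCombination.

(** * Commutation of weight vectors, for a bracket with an invariant form *)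

Section GradedCommute.
Variables (R : realType) (d : nat) (ad : 'rV[R]_d -> 'M[R]_d).
Hypotheses (adD : forall X Y, ad (X + Y) = ad X + ad Y)
  (adZ : forall a X, ad (a *: X) = a *: ad X)
  (ad_anti : forall X Y, X *m ad Y = - (Y *m ad X))
  (ad_jacobi : forall X Y, ad (X *m ad Y) = ad X *m ad Y - ad Y *m ad X).
Variable Q : 'M[R]_d.
Hypotheses (adQ : forall X, ad X *m Q = - (Q *m (ad X)^T)) (QT : Q^T = Q)
  (Qpos : forall v : 'rV[R]_d, v != 0 -> 0 < (v *m Q *m v^T) 0 0).
Variables (T : Type) (M : T -> 'M[R]_d) (alpha : T -> R[i]) (m : nat).
Hypotheses (m_gt0 : (0 < m)%N) (alpha_m : forall a, alpha a ^+ m = 1)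
  (ad_M : forall a X, M a *m ad (X *m M a) = ad X *m M a)
  (fixM : forall w : 'rV[R]_d, (forall a, w *m M a = w) -> w = 0).

(** The complex linear extension of [ad]. *)
Definition adC (Z : 'rV[R[i]]_d) : 'M[R[i]]_d :=
  toC (ad (reM Z)) + 'i%C *: toC (ad (imM Z)).

Let ad0 : ad 0 = 0. Proof. by rewrite -[0](scale0r 0) adZ scale0r. Qed.

Lemma adC_toC X : adC (toC X) = toC (ad X).
Proof. by rewrite /adC reM_toC imM_toC ad0 toC0 scaler0 addr0. Qed.

Lemma adCD Z W : adC (Z + W) = adC Z + adC W.
Proof.
rewrite /adC /reM /imM !map_mxD !adD !toCD scalerDr.
by rewrite addrACA.
Qed.

Lemma adCZ a Z : adC (a *: Z) = a *: adC Z.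
Proof.
have E : forall A B : 'M[R]_d, toC A + 'i%C *: toC B =
    map2_mx (fun x y : R => (x +i* y)%C) A B.
  by move=> A B; apply/matrixP => i j; rewrite !mxE [RHS]complexE.
have E1 : reM (a *: Z) = complex.Re a *: reM Z - complex.Im a *: imM Z.
  by apply/rowP => i; rewrite !mxE; case: (a) (Z 0 i) => [x y] [u v].
have E2 : imM (a *: Z) = complex.Re a *: imM Z + complex.Im a *: reM Z.
  by apply/rowP => i; rewrite !mxE; case: (a) (Z 0 i) => [x y] [u v].
rewrite /adC E1 E2 -scaleNr !adD !adZ !E.
apply/matrixP => i j; rewrite !mxE; case: (a) => x y /=.
by rewrite mulNr.
Qed.

Lemma adC0 : adC 0 = 0.
Proof. by rewrite -[0](scale0r 0) adCZ scale0r. Qed.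

Lemma adC_conj Z : adC (conjM Z) = conjM (adC Z).
Proof.
have E1 : reM (conjM Z) = reM Z by apply/rowP => i; rewrite !mxE; case: (Z 0 i).
have E2 : imM (conjM Z) = - imM Z by apply/rowP => i; rewrite !mxE; case: (Z 0 i).
rewrite /adC E1 E2 -scaleN1r adZ; apply/matrixP => i j; rewrite !mxE.
apply/eqP; rewrite eq_complex/=.
by apply/andP; split; apply/eqP; ring.
Qed.

Lemma adC_anti Z W : Z *m adC W = - (W *m adC Z).
Proof.
rewrite [Z]reimE [W]reimE !adCD !adCZ !adC_toC.
rewrite !mulmxDl !mulmxDr -!scalemxAl -!scalemxAr -!toC_mul.
rewrite (ad_anti (reM Z) (reM W)) (ad_anti (reM Z) (imM W)).
rewrite (ad_anti (imM Z) (reM W)) (ad_anti (imM Z) (imM W)) !toCN.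
set a := toC (reM W *m ad (reM Z)); set b := toC (reM W *m ad (imM Z)).
set c := toC (imM W *m ad (reM Z)); set e := toC (imM W *m ad (imM Z)).
by clearbody a b c e; apply/rowP => i; rewrite !mxE; ring.
Qed.

Lemma adC_jacobi Z W : adC (Z *m adC W) = adC Z *m adC W - adC W *m adC Z.
Proof.
have H X Y : adC (toC X *m toC (ad Y)) = toC (ad X) *m toC (ad Y) - toC (ad Y) *m toC (ad X).
  by rewrite -toC_mul adC_toC ad_jacobi toCD toCN !toC_mul.
rewrite [Z]reimE [W]reimE.
move: (reM Z) (imM Z) (reM W) (imM W) => X1 X2 Y1 Y2 {Z W}.
have E : (toC X1 + 'i%C *: toC X2) *m adC (toC Y1 + 'i%C *: toC Y2) =
    (toC X1 *m toC (ad Y1) + 'i%C *: (toC X2 *m toC (ad Y1))) +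
    'i%C *: (toC X1 *m toC (ad Y2) + 'i%C *: (toC X2 *m toC (ad Y2))).
  by rewrite adCD adCZ !adC_toC mulmxDr -scalemxAr !mulmxDl -!scalemxAl.
rewrite E !(adCD, adCZ) !H !adC_toC {E H}.
move: (toC (ad X1)) (toC (ad X2)) (toC (ad Y1)) (toC (ad Y2)) => x1 x2 y1 y2.
rewrite (mulmxDl _ _ (_ + _)) (mulmxDl y1) !mulmxDr -!scalemxAl -!scalemxAr.
move: (x1 *m y1) (x1 *m y2) (x2 *m y1) (x2 *m y2) => p11 p12 p21 p22.
move: (y1 *m x1) (y2 *m x1) (y1 *m x2) (y2 *m x2) => q11 q12 q21 q22.
by apply/matrixP => i j; rewrite !mxE; ring.
Qed.

Lemma adC_M a Z : toC (M a) *m adC (Z *m toC (M a)) = adC Z *m toC (M a).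
Proof.
rewrite [Z]reimE mulmxDl -scalemxAl -!toC_mul !adCD !adCZ !adC_toC.
by rewrite mulmxDr mulmxDl -scalemxAl -scalemxAr -!toC_mul !ad_M.
Qed.

Lemma adC_Q Z : adC Z *m toC Q = - (toC Q *m (adC Z)^T).
Proof.
rewrite [Z]reimE adCD adCZ !adC_toC mulmxDl -scalemxAl -!toC_mul !adQ !toCN !toC_mul.
by rewrite linearD linearZ/= mulmxDr -scalemxAr scalerN opprD /toC !map_trmx.
Qed.

(** The Hermitian extension of [Q]. Invariance says that the adjoint of [adC Z] is
    [- adC (conjM Z)]. *)
Let herm (u w : 'rV[R[i]]_d) := (u *m toC Q *m (conjM w)^T) 0 0.

Let herm_ad u w Z : herm (u *m adC Z) w = - herm u (w *m adC (conjM Z)).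
Proof.
rewrite /herm -[u *m adC Z *m _]mulmxA adC_Q conjM_mul adC_conj conjMK trmx_mul.
by rewrite mulmxN mulNmx mxE !mulmxA.
Qed.

Let herm0 u : herm u u = 0 -> u = 0.
Proof.
move=> h.
pose X := reM u; pose Y := imM u.
have q0 (v : 'rV[R]_d) : 0 <= (v *m Q *m v^T) 0 0.
  have [->|v0] := eqVneq v 0; first by rewrite !mul0mx mxE.
  exact: (ltW (Qpos v0)).
have uE : u = toC X + 'i%C *: toC Y := reimE u.
have cu : conjM u = toC X - 'i%C *: toC Y.
  apply/rowP => i; rewrite !mxE; case: (u 0 i) => a b.
  by apply/eqP; rewrite eq_complex/=; apply/andP; split; apply/eqP; ring.
clearbody X Y.
have E : herm u u = (((X *m Q *m X^T) 0 0 + (Y *m Q *m Y^T) 0 0)%:C)%C.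
  rewrite /herm cu {1}uE linearB/= linearZ/= mulmxBr !mulmxDl.
  rewrite -!scalemxAr -!scalemxAl /toC !map_trmx -!map_mxM.
  have -> : X *m Q *m Y^T = (Y *m Q *m X^T)^T by rewrite !trmx_mul trmxK QT mulmxA.
  move: (X *m Q *m X^T) (Y *m Q *m X^T) (Y *m Q *m Y^T) => a b c.
  by rewrite !mxE; apply/eqP; rewrite eq_complex/=; apply/andP; split; apply/eqP; ring.
move: h; rewrite E => -[/eqP]; rewrite paddr_eq0 ?q0// => /andP[/eqP h1 /eqP h2].
have X0 : X = 0 by apply/eqP/contraT => X0; have := Qpos X0; rewrite h1 ltxx.
have Y0 : Y = 0 by apply/eqP/contraT => Y0; have := Qpos Y0; rewrite h2 ltxx.
by rewrite uE X0 Y0 toC0 scaler0 addr0.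
Qed.

(** A normal operator N has the same kernel as its square: N N w = 0 gives N* N w = 0, since the
    squared norm of N* N w pairs N w with N N* N w = N* N N w; pairing N* N w with w then gives N w
    = 0. *)
Lemma normal_nil Z (w : 'rV[R[i]]_d) : adC Z *m adC (conjM Z) = adC (conjM Z) *m adC Z ->
  w *m adC Z *m adC Z = 0 -> w *m adC Z = 0.
Proof.
move=> cZ wZZ; have h0 : herm w 0 = 0 by rewrite /herm /conjM map_mx0 trmx0 mulmx0 mxE.
have h0' u : herm u 0 = 0 by rewrite /herm /conjM map_mx0 trmx0 mulmx0 mxE.
have wZZ' : w *m adC Z *m adC (conjM Z) = 0.
  apply: herm0; rewrite herm_ad conjMK -mulmxA -mulmxA -cZ.
  rewrite [adC Z *m (adC Z *m _)]mulmxA.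
  have -> : w *m (adC Z *m adC Z *m adC (conjM Z)) = 0.
    by rewrite !mulmxA wZZ mul0mx.
  by rewrite h0' oppr0.
by apply: herm0; rewrite herm_ad wZZ' h0' oppr0.
Qed.

Definition weight (k : nat) (Z : 'rV[R[i]]_d) : Prop :=
  forall a, Z *m toC (M a) = alpha a ^+ k *: Z.

Lemma alpha_neq0 a : alpha a != 0.
Proof.
apply/eqP => a0; have := alpha_m a; rewrite a0 expr0n gtn_eqF//.
by move=> /eqP; rewrite eq_sym oner_eq0.
Qed.

Hypothesis alpha_conj : forall a, conjc (alpha a) = (alpha a)^-1.

(** Weights are natural numbers read modulo [m], so the negative of [k] is written [k * m.-1]. *)
Lemma weight_conj k Z : weight k Z -> weight (k * m.-1) (conjM Z).
Proof.
move=> Zk a; rewrite -(conjM_toC (M a)) -conjM_mul Zk conjMZ; congr (_ *: _).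
rewrite rmorphXn/= alpha_conj mulnC exprM; congr (_ ^+ k).
apply: (mulfI (alpha_neq0 a)).
by rewrite divff ?alpha_neq0// -exprS prednK// alpha_m.
Qed.

Lemma weight_ad i j X Y : weight i X -> weight j Y -> weight (j + i) (Y *m adC X).
Proof.
move=> Xi Yj a; rewrite -mulmxA -adC_M Xi adCZ -!scalemxAr mulmxA.
by rewrite Yj -scalemxAl scalerA -exprD addnC.
Qed.

Lemma weight_dvd0 k Z : (m %| k)%N -> weight k Z -> Z = 0.
Proof.
move=> /dvdnP[q ->] Zk.
have Zfix a : Z *m toC (M a) = Z by rewrite Zk mulnC exprM alpha_m expr1n scale1r.
have X0 : reM Z = 0 by apply: fixM => a; rewrite -reM_mul Zfix.
have Y0 : imM Z = 0 by apply: fixM => a; rewrite -imM_mul Zfix.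
by rewrite [Z]reimE X0 Y0 toC0 scaler0 addr0.
Qed.

Lemma weight_normal i X : weight i X ->
  adC X *m adC (conjM X) = adC (conjM X) *m adC X.
Proof.
move=> Xi; have := adC_jacobi (conjM X) X.
have -> : conjM X *m adC X = 0.
  apply: (weight_dvd0 (k := i * m.-1 + i)); last exact: weight_ad Xi (weight_conj Xi).
  by rewrite -[X in (_ + X)%N]muln1 -mulnDr addn1 prednK// dvdn_mull.
by rewrite adC0 => /eqP; rewrite eq_sym subr_eq0 => /eqP ->.
Qed.

Let iad X k (Y : 'rV[R[i]]_d) := iter k (fun Z : 'rV[R[i]]_d => Z *m adC X) Y.

Let weight_iter i j X Y k : weight i X -> weight j Y -> weight (j + k * i) (iad X k Y).
Proof.
move=> Xi Yj; elim: k => [|k IH]; first by rewrite mul0n addn0.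
by rewrite /iad iterS/= mulSn [(i + _)%N]addnC addnA; exact: weight_ad.
Qed.

Let iter_nil i X Y k : weight i X -> iad X k Y = 0 -> Y *m adC X = 0.
Proof.
move=> Xi; elim: k => [|[|k] IH]; first by rewrite /iad/= => ->; rewrite mul0mx.
  by [].
rewrite /iad !iterS/= => h; apply: IH.
by rewrite /iad iterS/=; exact: normal_nil (weight_normal Xi) h.
Qed.

(** Let [Z] be [Y] bracketed [k] times with [X]. For the [k] and [k'] chosen, [X] bracketed [k']
    times with [Z] has weight divisible by [m] and vanishes, so already [X *m adC Z = 0]. By
    antisymmetry this is a vanishing iterated bracket of [Y] with [X], and normality of [adC X]
    reduces it to a single one. If [j = 0], then [Y] is itself 0. *)
Theorem weight_commute i j X Y : weight i X -> weight j Y -> Y *m adC X = 0.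
Proof.
move=> Xi Yj; have [j0|j0] := posnP j.
  have -> : Y = 0 by apply: (weight_dvd0 (dvdn0 m)); rewrite -j0.
  by rewrite mul0mx.
have [k [k' kk']] := exists_dvdn_combination i m_gt0 j0.
have Zw := weight_iter k Xi Yj.
have XZ : X *m adC (iad X k Y) = 0.
  by apply: (iter_nil (k := k') Zw); apply: weight_dvd0 kk' _; exact: weight_iter.
apply: (iter_nil (k := k.+1) Xi).
by rewrite /iad iterS/= adC_anti -/(iad X k Y) XZ oppr0.
Qed.

End GradedCommute.

(** * Characters of a finite abelian subgroup *)

Lemma set_elt (T : Type) (A : set T) x : A x -> exists a : A, val a = x.
Proof. by move=> Ax; exists (SigSub (mem_set Ax)). Qed.

Lemma set_eltP (T : Type) (A : set T) (a : A) : A (val a).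
Proof. exact: set_mem (valP a). Qed.

Lemma subgroupX (G : groupType) (A : set G) x n : subgroup A -> A x -> A (x ^+ n)%g.
Proof.
move=> [A1 AM _] Ax; elim: n => [|n IH]; first by rewrite expg0.
by rewrite expgS; exact: AM.
Qed.

Section Characters.
Variables (R : realType) (G : groupType) (A : set G).
Hypothesis sA : subgroup A.
Variable alpha : A -> R[i].
Hypothesis chi : character alpha.

Lemma characterM (a b c : A) : val c = (val a * val b)%g -> alpha c = alpha a * alpha b.
Proof. by case: chi => _; apply. Qed.

Lemma character_neq0 a : alpha a != 0.
Proof. by rewrite -normr_eq0; case: chi => -> _; rewrite oner_eq0. Qed.

Lemma character1 (a : A) : val a = 1%g -> alpha a = 1.
Proof.
move=> a1; have := @characterM a a a; rewrite a1 mulg1 => /(_ erefl).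
by move=> /(congr1 (fun z => z / alpha a)); rewrite mulfK ?character_neq0// divff ?character_neq0.
Qed.

Lemma characterX (a b : A) n : val b = (val a ^+ n)%g -> alpha b = alpha a ^+ n.
Proof.
elim: n b => [|n IH] b; first by rewrite expg0 expr0; exact: character1.
have [c cE] := set_elt (subgroupX n sA (set_eltP a)).
rewrite expgS exprS -cE => bE.
by rewrite (characterM bE) (IH _ cE).
Qed.

Lemma characterV (a b : A) : val b = (val a)^-1%g -> alpha b = (alpha a)^-1.
Proof.
move=> bE; have [e eE] : exists e : A, val e = 1%g by apply: set_elt; case: sA.
have := @characterM a b e; rewrite eE bE mulgV => /(_ erefl); rewrite character1// => h.
by rewrite -[RHS]mulr1 h mulKf ?character_neq0.
Qed.

Lemma character_conj a : conjc (alpha a) = (alpha a)^-1.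
Proof.
apply: (mulfI (character_neq0 a)); rewrite divff ?character_neq0//.
by rewrite -sqr_normc; case: chi => -> _; rewrite expr1n.
Qed.

(** Lagrange's argument: [h] permutes [s], so the product of the values [l x] is unchanged when each
    is multiplied by [w]. *)
Lemma prod_shift_exp (F : fieldType) (K : choiceType) (s : seq K) (l : K -> F)
    (h : K -> K) w : uniq s -> injective h -> (forall x, x \in s -> h x \in s) ->
  (forall x, x \in s -> l (h x) = w * l x) -> (forall x, x \in s -> l x != 0) ->
  w ^+ size s = 1.
Proof.
move=> us ih hs lh l0.
have ps : perm_eq [seq h x | x <- s] s.
  have uh : uniq [seq h x | x <- s] by rewrite map_inj_uniq.
  have sub : {subset [seq h x | x <- s] <= s} by move=> _ /mapP[x xs ->]; exact: hs.
  have [|_ e] := uniq_min_size uh sub; first by rewrite size_map.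
  exact: uniq_perm.
have p0 : \prod_(x <- s) l x != 0.
  by rewrite prodf_seq_neq0; apply/allP => x xs; exact: l0.
apply: (mulIf p0); rewrite mul1r -[RHS](perm_big _ ps)/= big_map.
rewrite [RHS](eq_big_seq (fun x => w * l x))//.
by rewrite big_split/= big_const_seq count_predT iter_mulr_1.
Qed.

Lemma character_cyclic : finite_set A -> exists m (g : A),
  [/\ (0 < m)%N, m.-primitive_root (alpha g) & forall a, alpha a ^+ m = 1].
Proof.
move=> finA.
(* Extended by 0 to all of [G], the character has a finite image of [A]; that image is a finite
   multiplicative group of complex numbers, hence cyclic. *)
pose f x := if pselect (A x) is left h then alpha (SigSub (mem_set h)) else 0.
have fE a : f (val a) = alpha a.
  rewrite /f; case: pselect => [h|/(_ (set_eltP a))//].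
  by congr alpha; exact: val_inj.
pose S := enum_fset (fset_set (f @` A)).
have SE z : reflect (exists a, alpha a = z) (z \in S).
  apply: (iffP idP); rewrite in_fset_set ?inE/=; try exact: finite_image.
    by move=> [x Ax <-]; have [a <-] := set_elt Ax; exists a.
  by move=> [a <-]; exists (val a); [exact: set_eltP|exact: fE].
have S0 : (0 < size S)%N.
  have [A1 _ _] := sA; have [e _] := set_elt A1.
  have /SE : exists a, alpha a = alpha e by exists e.
  by case: S {SE}.
have Sm a : alpha a ^+ size S = 1.
  apply: (@prod_shift_exp _ _ S id (fun z => alpha a * z)) => //.
  - exact: fset_uniq.
  - exact: mulfI (character_neq0 a).
  - move=> _ /SE[b <-]; apply/SE.
    have [c cE] : exists c : A, val c = (val a * val b)%g.
      by apply: set_elt; case: sA => _ AM _; apply: AM; exact: set_eltP.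
    by exists c; exact: characterM.
  - by move=> _ /SE[b <-]; exact: character_neq0.
have /hasP[z /SE[g <-] gp] : has (size S).-primitive_root S.
  apply: has_prim_root => //; last exact: fset_uniq.
  apply/allP => z /SE[a <-].
  by rewrite unity_rootE Sm.
by exists (size S), g; split.
Qed.

End Characters.

(** * Exponentials of sums of root vectors *)

Section RootTorus.
Variables (R : realType) (d : nat) (G : TopologyGroup.type).
Variable L : lie_structure R d G.
Hypothesis compactG : compact [set: G].
Variable A : set G.
Hypotheses (finA : finite_set A) (maxA : maximal_abelian A).
Variable alpha : A -> R[i].
Hypothesis chi : character alpha.

Let sA : subgroup A. Proof. by case: maxA => -[]. Qed.
Let cA x y : A x -> A y -> (x * y)%g = (y * x)%g.
Proof. by case: maxA => -[_ c _]; exact: c. Qed.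

Notation wvec k Z := (weight_space L [set: G] (multiple alpha k) Z).

Lemma lie_algebra_Ad X g : lie_algebra L [set: G] X -> lie_algebra L [set: G] (X *m Ad L g).
Proof.
move=> [gam gX _]; exists (fun t => g * gam t * g^-1)%g => //.
exact: one_parameter_conj.
Qed.

Lemma lie_algebraZ X a : lie_algebra L [set: G] X -> lie_algebra L [set: G] (a *: X).
Proof. by move=> [gam gX _]; exists (fun t => gam (a * t)) => //; exact: one_parameter_scale. Qed.

Lemma lie_algebra0 : lie_algebra L [set: G] 0.
Proof. by exists (fun=> 1%g) => //; exact: one_parameter_cst. Qed.

Lemma lie_algebraC_Ad Z g : lie_algebraC L [set: G] Z -> lie_algebraC L [set: G] (Z *m AdC L g).
Proof.
move=> [h1 h2]; split.
  by rewrite -/(reM _) -/(toC _) reM_mul; exact: lie_algebra_Ad.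
by rewrite -/(imM _) -/(toC _) imM_mul; exact: lie_algebra_Ad.
Qed.

Lemma lie_algebraCZ Z (a : R) : lie_algebraC L [set: G] Z ->
  lie_algebraC L [set: G] (real_complex R a *: Z).
Proof.
move=> [h1 h2]; split.
  have -> : map_mx (@complex.Re R) (real_complex R a *: Z) = a *: reM Z.
    by apply/rowP => i; rewrite !mxE; case: (Z 0 i) => x y /=; rewrite mul0r subr0.
  exact: lie_algebraZ.
have -> : map_mx (@complex.Im R) (real_complex R a *: Z) = a *: imM Z.
  by apply/rowP => i; rewrite !mxE; case: (Z 0 i) => x y /=; rewrite mul0r addr0.
exact: lie_algebraZ.
Qed.

Lemma lie_algebraC_conj Z : lie_algebraC L [set: G] Z -> lie_algebraC L [set: G] (conjM Z).
Proof.
move=> [h1 h2]; split.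
  have -> : map_mx (@complex.Re R) (conjM Z) = reM Z.
    by apply/rowP => i; rewrite !mxE; case: (Z 0 i).
  exact: h1.
have -> : map_mx (@complex.Im R) (conjM Z) = -1 *: imM Z.
  by apply/rowP => i; rewrite !mxE; case: (Z 0 i) => x y /=; rewrite mulN1r.
exact: lie_algebraZ.
Qed.

Lemma lie_algebraC_i Z : lie_algebraC L [set: G] Z -> lie_algebraC L [set: G] (- 'i%C *: Z).
Proof.
move=> [h1 h2]; split.
  have -> : map_mx (@complex.Re R) (- 'i%C *: Z) = imM Z.
    by apply/rowP => i; rewrite !mxE; case: (Z 0 i) => x y /=;
      rewrite oppr0 mul0r sub0r mulN1r opprK.
  exact: h2.
have -> : map_mx (@complex.Im R) (- 'i%C *: Z) = -1 *: reM Z.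
  by apply/rowP => i; rewrite !mxE; case: (Z 0 i) => x y /=; rewrite oppr0 mul0r add0r.
exact: lie_algebraZ.
Qed.

Lemma multipleN k a : conjc (multiple alpha k a) = multiple alpha (- k) a.
Proof.
by rewrite /multiple fmorphXz/= (character_conj chi) exprz_inv.
Qed.

Lemma wvecZ k Z (a : R) : wvec k Z -> wvec k (real_complex R a *: Z).
Proof.
move=> [h1 h2]; split; first exact: lie_algebraCZ.
by move=> b; rewrite -scalemxAl h2 !scalerA mulrC.
Qed.

Lemma wvec_conj k Z : wvec k Z -> wvec (- k) (conjM Z).
Proof.
move=> [h1 h2]; split; first exact: lie_algebraC_conj.
move=> b; have -> : AdC L (val b) = conjM (AdC L (val b)) by rewrite -/(toC _) conjM_toC.
by rewrite -conjM_mul h2 conjMZ multipleN.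
Qed.

Lemma wvec_i k Z : wvec k Z -> wvec k (- 'i%C *: Z).
Proof.
move=> [h1 h2]; split; first exact: lie_algebraC_i.
by move=> b; rewrite -scalemxAl h2 !scalerA mulrC.
Qed.

Lemma wvec_Ad k Z (b : A) : wvec k Z -> wvec k (Z *m AdC L (val b)).
Proof.
move=> [h1 h2]; split; first exact: lie_algebraC_Ad.
by move=> a; rewrite h2 -scalemxAl h2 !scalerA mulrC.
Qed.

(* [P] restricts the multiples [k] of [alpha] that occur, so that a single
   predicate covers all the subtori of the root torus of [alpha]. *)
Definition wsum (P : int -> Prop) (X : 'rV[R]_d) : Prop :=
  lie_algebra L [set: G] X /\ exists s : seq (int * 'rV[R[i]]_d),
    (forall p, p \in s -> [/\ nontrivial (multiple alpha p.1), wvec p.1 p.2 & P p.1])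
    /\ toC X = \sum_(p <- s) p.2.

Lemma wsum_root P H beta X :
  (forall k, P k -> nontrivial (multiple alpha k) -> exists c,
     multiple alpha k = multiple beta c /\
     forall Z, wvec k Z -> weight_space L H (multiple beta c) Z) ->
  wsum P X -> multiple_weight_space L H beta (map_mx (real_complex R) X).
Proof.
move=> PH [_ [s [Hs sE]]].
have ex (i : 'I_(size s)) : exists c, nontrivial (multiple beta c) /\
    weight_space L H (multiple beta c) (nth (0, 0) s i).2.
  have [h1 h2 h3] := Hs _ (mem_nth (0, 0) (ltn_ord i)).
  have [c [cE cH]] := PH _ h3 h1; exists c; rewrite -cE; split => //.
  by rewrite cE; exact: cH.
exists (size s), (fun i => sval (cid (ex i))), (fun i => (nth (0, 0) s i).2); split.
- by move=> i; case: cid => c [].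
- by move=> i; case: cid => c [].
- by rewrite -/(toC X) sE (big_nth (0, 0)) big_mkord.
Qed.

Lemma root_wsum X : lie_algebra L [set: G] X ->
  multiple_weight_space L [set: G] alpha (map_mx (real_complex R) X) -> wsum (fun=> True) X.
Proof.
move=> lX [n [k [Y [h1 h2 h3]]]]; split => //.
exists [seq (k i, Y i) | i <- enum 'I_n]; split.
  by move=> _ /mapP[i _ ->]; split; [exact: h1|exact: h2|].
by rewrite big_map big_enum /= -h3.
Qed.

Lemma wsum0 P : wsum P 0.
Proof.
split; first exact: lie_algebra0.
by exists [::]; split => //; rewrite big_nil toC0.
Qed.

Lemma wsumZ P a X : wsum P X -> wsum P (a *: X).
Proof.
move=> [lX [s [Hs sE]]]; split; first exact: lie_algebraZ.
exists [seq (p.1, real_complex R a *: p.2) | p <- s]; split.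
  by move=> _ /mapP[p /Hs[h1 h2 h3] ->]; split => //; exact: wvecZ.
rewrite big_map /= -scaler_sumr -sE.
by apply/rowP => i; rewrite !mxE rmorphM.
Qed.

(** The Lie algebra membership of the sum is a premise; callers supply it from the product of two
    commuting one-parameter subgroups. *)
Lemma wsumD P X Y : lie_algebra L [set: G] (X + Y) -> wsum P X -> wsum P Y -> wsum P (X + Y).
Proof.
move=> lXY [_ [s [Hs sE]]] [_ [s' [Hs' sE']]]; split => //.
exists (s ++ s'); split; last by rewrite big_cat/= toCD sE sE'.
by move=> p; rewrite mem_cat => /orP[/Hs|/Hs'].
Qed.

Lemma wsum_Ad P X (b : A) : wsum P X -> wsum P (X *m Ad L (val b)).
Proof.
move=> [lX [s [Hs sE]]]; split; first exact: lie_algebra_Ad.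
exists [seq (p.1, p.2 *m AdC L (val b)) | p <- s]; split.
  by move=> _ /mapP[p /Hs[h1 h2 h3] ->]; split => //; exact: wvec_Ad.
by rewrite big_map /= toC_mul sE mulmx_suml.
Qed.

Lemma wsum_re k Z : nontrivial (multiple alpha k) -> wvec k Z -> wsum (fun=> True) (reM Z).
Proof.
move=> nk Zk; split; first by case: Zk => -[].
exists [:: (k, real_complex R 2^-1 *: Z); (- k, real_complex R 2^-1 *: conjM Z)]; split.
  move=> p; rewrite !inE => /orP[/eqP ->|/eqP ->]; split => //=.
  - exact: wvecZ.
  - case: nk => a ak; exists a; rewrite -multipleN.
    by apply: contra ak => /eqP h; rewrite -[multiple _ _ _]conjcK h conjc1.
  - exact/wvecZ/wvec_conj.
rewrite big_cons big_cons big_nil addr0 -scalerDr reM_conj.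
by congr (_ *: _); rewrite rmorphV ?unitfE// rmorph_nat.
Qed.

Variables (m : nat) (g : A).
Hypotheses (m_gt0 : (0 < m)%N) (g_prim : m.-primitive_root (alpha g))
  (alpha_m : forall a, alpha a ^+ m = 1).

Lemma multiple_modz k a : multiple alpha k a = alpha a ^+ `|(k %% m%:Z)%Z|%N.
Proof.
have a0 := character_neq0 chi a.
have mod0 : (0 <= (k %% m%:Z)%Z)%R by rewrite modz_ge0// eqz_nat -lt0n.
rewrite /multiple {1}(divz_eq k m%:Z) expfzDr// mulrC.
rewrite [((k %/ _)%Z * _)%R]mulrC -exprz_exp -exprnP alpha_m exp1rz mulr1.
by rewrite -{1}(gez0_abs mod0) -exprnP.
Qed.

Lemma wsum_ad P P' X Y : wsum P X -> wsum P' Y -> Y *m ad L X = 0.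
Proof.
have [Q [Q1 Q2 Q3]] := ad_invariant_form L compactG.
have wc (k l : int) (Z W : 'rV[R[i]]_d) : wvec k Z -> wvec l W ->
    W *m adC (ad L) Z = 0.
  move=> [_ kZ] [_ lW].
  apply: (@weight_commute R d (ad L) (adD L) (adZ L) (ad_anti L) (ad_jacobi L) Q Q1 Q2 Q3
    A (fun a => Ad L (val a)) alpha m m_gt0 alpha_m _ _ (character_conj chi)
    `|(k %% m%:Z)%Z|%N `|(l %% m%:Z)%Z|%N).
  - by move=> a X'; rewrite ad_equivariant !mulmxA AdV mul1mx.
  - move=> w wA; apply: (Ad_fixed0 finA maxA) => a Aa.
    by have [a' <-] := set_elt Aa; exact: wA.
  - by move=> a; rewrite -multiple_modz; exact: kZ.
  - by move=> a; rewrite -multiple_modz; exact: lW.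
move=> [_ [s [Hs sE]]] [_ [s' [Hs' sE']]].
apply: toC_inj; rewrite toC0 toC_mul -(adC_toC (adZ L)) sE sE'.
have adCs : adC (ad L) (\sum_(p <- s) p.2) = \sum_(p <- s) adC (ad L) p.2.
  apply: (big_morph _ (adCD (adD L))); exact: adC0 (adD L) (adZ L).
rewrite adCs mulmx_suml big_seq big1// => p' p's'.
rewrite mulmx_sumr big_seq big1// => p ps.
have [_ h _] := Hs _ ps; have [_ h' _] := Hs' _ p's'.
exact: wc h h'.
Qed.

Definition texp (P : int -> Prop) (t : G) : Prop :=
  exists X gam, [/\ wsum P X, one_parameter L gam X & gam 1 = t].

Lemma wsum_commute P P' X Y gam gam' : wsum P X -> wsum P' Y ->
  one_parameter L gam X -> one_parameter L gam' Y ->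
  forall s t, (gam s * gam' t = gam' t * gam s)%g.
Proof. by move=> wX wY gX gY; apply: ad_commute gX gY _; exact: wsum_ad wX wY. Qed.

Lemma texp1 P : texp P 1%g.
Proof. by exists 0, (fun=> 1%g); split => //; [exact: wsum0|exact: one_parameter_cst]. Qed.

(** Since brackets vanish, the product of the two one-parameter subgroups is one with tangent
    [X + Y]; it also witnesses that [X + Y] belongs to the Lie algebra. *)
Lemma texpM P t t' : texp P t -> texp P t' -> texp P (t * t')%g.
Proof.
move=> [X [gam [wX gX <-]]] [Y [gam' [wY gY <-]]].
have gXY := one_parameter_mul (wsum_commute wX wY gX gY) gX gY.
exists (X + Y), (fun t => gam t * gam' t)%g; split => //.
by apply: wsumD => //; exists (fun t => gam t * gam' t)%g.
Qed.

Lemma texpZ P X gam s : wsum P X -> one_parameter L gam X -> texp P (gam s).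
Proof.
move=> wX gX; exists (s *: X), (fun t => gam (s * t)); split.
- exact: wsumZ.
- exact: one_parameter_scale.
- by rewrite mulr1.
Qed.

Lemma texpV P t : texp P t -> texp P t^-1%g.
Proof.
by move=> [X [gam [wX gX <-]]]; rewrite -(one_parameterN _ gX); exact: texpZ wX gX.
Qed.

Lemma root_torus_texp t : root_torus L [set: G] alpha t -> texp (fun=> True) t.
Proof.
apply; split.
  by split; [exact: texp1|exact: texpM|exact: texpV].
move=> _ [X [gam [[lX rX] gX [s ->]]]].
by apply: texpZ gX; exact: root_wsum.
Qed.

Lemma texp_root_torus P H beta t :
  (forall X gam, wsum P X -> one_parameter L gam X -> forall s, H (gam s)) ->
  (forall k, P k -> nontrivial (multiple alpha k) -> exists c,
     multiple alpha k = multiple beta c /\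
     forall Z, wvec k Z -> weight_space L H (multiple beta c) Z) ->
  texp P t -> root_torus L H beta t.
Proof.
move=> PH Pb [X [gam [wX gX <-]]] K [_ SK]; apply: SK.
exists X, gam; split => //; last by exists 1.
split; first by exists gam => //; exact: PH wX gX.
exact: wsum_root Pb wX.
Qed.

(** Commutation of one-parameter subgroups concerns real vectors, so [Z] is tested through its real
    part and that of [- i Z], both sums of root vectors. For [k = 1] and [t] in [A], it yields that
    alpha is trivial at [t]. *)
Lemma texp_wvec_fix P t k Z : texp P t -> nontrivial (multiple alpha k) -> wvec k Z ->
  Z *m AdC L t = Z.
Proof.
move=> [X [gam [wX gX <-]]] nk Zk.
have fixre W : wvec k W -> reM W *m Ad L (gam 1) = reM W.
  move=> Wk; have wW := wsum_re nk Wk; have [[gam' gW _] _] := wW.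
  by apply: (commute_Ad_fix gW) => t'; exact: wsum_commute wX wW gX gW _ _.
have re_eq (W : 'rV[R[i]]_d) : reM W = 0 -> reM (- 'i%C *: W) = 0 -> W = 0.
  move=> h1 h2; rewrite [W]reimE h1.
  have -> : imM W = reM (- 'i%C *: W).
    by apply/rowP => i; rewrite !mxE; case: (W 0 i) => x y /=;
      rewrite oppr0 mul0r sub0r mulN1r opprK.
  by rewrite h2 toC0 scaler0 addr0.
have reB (W W' : 'rV[R[i]]_d) : reM (W - W') = reM W - reM W' by exact: map_mxB.
apply/eqP; rewrite -subr_eq0; apply/eqP; apply: re_eq.
  by rewrite reB -/(toC _) reM_mul fixre// subrr.
rewrite scalerBr reB scalemxAl -/(toC _) reM_mul fixre ?subrr//.
exact: wvec_i.
Qed.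

(** Conjugation by [b] fixes [t], as both are in [A], but moves the exponent [X]. The product of [n]
    commuting conjugates is therefore [t ^ n], with the sum of the moved exponents. *)
Lemma texp_sum P t (b : A) X gam n : A t -> wsum P X -> one_parameter L gam X -> gam 1 = t ->
  exists gam', [/\ wsum P (\sum_(i < n) X *m Ad L (val b ^+ i)%g),
    one_parameter L gam' (\sum_(i < n) X *m Ad L (val b ^+ i)%g) & gam' 1 = (t ^+ n)%g].
Proof.
move=> At wX gX g1; elim: n => [|n [gam' [wS gS gt]]].
  exists (fun=> 1%g); rewrite big_ord0 expg0; split => //; first exact: wsum0.
  exact: one_parameter_cst.
have [c cE] := set_elt (subgroupX n sA (set_eltP b)).
have wc := wsum_Ad c wX; have gc := one_parameter_conj (val c) gX.
have gSc := one_parameter_mul (wsum_commute wS wc gS gc) gS gc.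
rewrite big_ord_recr/= -cE; eexists; split; last 2 first.
- exact: gSc.
- by rewrite /= gt g1 expgSr (cA (set_eltP c) At) mulgK.
by apply: wsumD => //; eexists; first exact: gSc.
Qed.

Lemma multipleX (b c : A) k n : val c = (val b ^+ n)%g ->
  multiple alpha k c = multiple alpha k b ^+ n.
Proof.
by move=> cE; rewrite /multiple (characterX sA chi cE) !exprnP !exprz_exp mulrC.
Qed.

Lemma texp_norm P t (b : A) n : A t -> texp P t ->
  (forall k, P k -> multiple alpha k b ^+ n = 1) ->
  texp (fun k => P k /\ multiple alpha k b = 1) (t ^+ n)%g.
Proof.
move=> At [X [gam [wX gX g1]]] Pb.
have [gam' [[lS _] gS gt]] := texp_sum b n At wX gX g1.
exists (\sum_(i < n) X *m Ad L (val b ^+ i)%g), gam'; split => //; split => //.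
have [_ [s [Hs sE]]] := wX.
exists [seq (p.1, real_complex R n%:R *: p.2) | p <- s & multiple alpha p.1 b == 1]; split.
  move=> q /mapP[p]; rewrite mem_filter => /andP[/eqP pb /Hs[h1 h2 h3]] ->.
  by split => //; exact: wvecZ.
have toCsum I (r : seq I) (F : I -> 'rV[R]_d) : toC (\sum_(i <- r) F i) = \sum_(i <- r) toC (F i).
  by apply: (big_morph _ (@toCD R 1 d)); exact: toC0.
rewrite big_map big_filter/= toCsum.
rewrite (eq_bigr (fun i : 'I_n => \sum_(p <- s) p.2 *m toC (Ad L (val b ^+ i)%g))); last first.
  by move=> i _; rewrite toC_mul sE mulmx_suml.
rewrite exchange_big/= [RHS]big_mkcond/= big_seq [RHS]big_seq.
apply: eq_bigr => p /Hs[h1 [_ h2] h3].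
have E (i : 'I_n) : p.2 *m toC (Ad L (val b ^+ i)%g) = multiple alpha p.1 b ^+ i *: p.2.
  have [c cE] := set_elt (subgroupX i sA (set_eltP b)).
  by rewrite -cE (h2 c) (multipleX _ cE).
rewrite (eq_bigr (fun i : 'I_n => multiple alpha p.1 b ^+ i *: p.2)); last by move=> i _.
rewrite -scaler_suml; case: ifPn => [/eqP ->|pb].
  under eq_bigr do rewrite expr1n.
  by rewrite sumr_const card_ord rmorph_nat.
(* A root of unity other than 1 whose order divides [n] has vanishing geometric sum; the weights
   equal to 1 at [b] are multiplied by [n]. *)
have := subrX1 (multiple alpha p.1 b) n; rewrite Pb// subrr => /esym/eqP.
by rewrite mulf_eq0 subr_eq0 (negPf pb)/= => /eqP ->; rewrite scale0r.
Qed.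

End RootTorus.

(** * Roots of prime power order *)

Section PrimeKernel.
Variables (R : realType) (d : nat) (G : TopologyGroup.type).
Variable L : lie_structure R d G.
Variable A : set G.
Hypotheses (finA : finite_set A) (sA : subgroup A).
Variable beta : A -> R[i].
Hypothesis chi : character beta.
Variable Z : 'rV[R[i]]_d.
Hypotheses (Zbeta : forall a : A, Z *m toC (Ad L (val a)) = beta a *: Z) (Z0 : Z != 0).

Let finAd : finite_set (Ad L @` A). Proof. exact: finite_image. Qed.

Lemma Ad_order_gt0 : (0 < Ad_order L A)%N.
Proof.
have [A1 _ _] := sA.
rewrite /Ad_order cardfs_gt0; apply/fset0Pn; exists (Ad L 1%g).
by rewrite in_fset_set// inE; exists 1%g.
Qed.

(** On a nonzero weight vector, [beta a] can be read off from [Ad a]. So beta factors through the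
    image of [A] under [Ad], whose order kills it. *)
Lemma weight_Ad_order a : beta a ^+ Ad_order L A = 1.
Proof.
have [i Zi] : exists i, Z 0 i != 0.
  apply: contrapT => H; move/eqP: Z0; apply; apply/rowP => i; rewrite mxE.
  by apply/eqP; apply: contrapT => /negP h; apply: H; exists i.
have SE M : reflect (exists b : A, Ad L (val b) = M) (M \in fset_set (Ad L @` A)).
  apply: (iffP idP); rewrite in_fset_set// inE.
    by move=> [x Ax <-]; have [b <-] := set_elt Ax; exists b.
  by move=> [b <-]; exists (val b) => //; exact: set_eltP.
have lE (b : A) : (Z *m toC (Ad L (val b))) 0 i / Z 0 i = beta b.
  by rewrite Zbeta mxE mulfK.
apply: (@prod_shift_exp _ _ (enum_fset (fset_set (Ad L @` A)))
  (fun M => (Z *m toC M) 0 i / Z 0 i) (fun M => M *m Ad L (val a))).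
- exact: fset_uniq.
- by move=> M N /(congr1 (fun X => X *m Ad L (val a)^-1%g)); rewrite -!mulmxA AdV !mulmx1.
- move=> _ /SE[b <-]; apply/SE.
  have [c cE] : exists c : A, val c = (val a * val b)%g.
    by apply: set_elt; case: sA => _ AM _; apply: AM; exact: set_eltP.
  by exists c; rewrite cE Ad_mul.
- move=> _ /SE[b <-]; rewrite lE toC_mul mulmxA Zbeta -scalemxAl Zbeta scalerA mxE mulfK//.
  exact: mulrC.
- by move=> _ /SE[b <-]; rewrite lE; exact: (character_neq0 chi).
Qed.

(** [beta h] is killed by a power of [p] and, because [Ad h] is, by the part of [Ad_order] prime to
    [p]. *)
Lemma p_kernel_weight p j (h : A) : prime p -> beta h ^+ (p ^ j) = 1 ->
  p_kernel L A p (val h) -> beta h = 1.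
Proof.
move=> pp hpj [_ Ah]; set n := Ad_order L A in Ah.
have [n' cn nE] := pfactor_coprime pp Ad_order_gt0.
have dE : (n %/ p ^ logn p n)%N = n'.
  by rewrite /n {1}nE mulnK// expn_gt0 prime_gt0.
rewrite dE in Ah.
have ZX k : Z *m toC (Ad L (val h) ^+ k) = beta h ^+ k *: Z.
  elim: k => [|k IH].
    by rewrite !expr0 scale1r /toC map_mx1 mulmx1.
  by rewrite exprSr exprS toC_mul mulmxA IH -scalemxAl Zbeta scalerA mulrC.
have hn' : beta h ^+ n' = 1.
  have := ZX n'; rewrite Ah /toC map_mx1 mulmx1 => /esym/eqP.
  by rewrite -subr_eq0 -{2}[Z]scale1r -scalerBl scaler_eq0 (negPf Z0) orbF subr_eq0 => /eqP.
have n'0 : (0 < n')%N by have := Ad_order_gt0; rewrite nE muln_gt0 => /andP[].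
have cop : coprime n' (p ^ j) by rewrite coprime_sym coprimeXl.
have [[u v] /= uv] := coprimeP _ n'0 cop.
have uE : (u * n' = 1 + v * p ^ j)%N by lia.
have : beta h ^+ (u * n') = 1 by rewrite mulnC exprM hn' expr1n.
by rewrite uE exprD expr1 mulnC exprM hpj expr1n mulr1.
Qed.

End PrimeKernel.

Section GPrimeMembership.
Variables (R : realType) (d : nat) (G : TopologyGroup.type).
Variable L : lie_structure R d G.
Variable A : set G.

(** The range of [gam] is connected, contains 1 and centralizes A_(p), hence lies in the identity
    component of G_(p). *)
Lemma one_parameter_G_prime p gam X : prime p -> (p %| Ad_order L A)%N ->
  one_parameter L gam X -> (forall h, p_kernel L A p h -> X *m Ad L h = X) ->
  forall s, G_prime L A (gam s).
Proof.
move=> pp pn gX Xfix s K [_ AK]; apply: AK; right; exists p => //.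
exists (range gam); last by exists s.
split.
- by exists 0 => //; exact: one_parameter0 gX.
- move=> _ [t _ <-] h hk; symmetry; apply: (Ad_fix_commute gX).
  exact: Xfix.
- apply: connected_continuous_connected.
    by apply/connected_intervalP.
  by apply: continuous_subspaceT; case: gX.
Qed.

End GPrimeMembership.

Lemma endomorphismX (G : groupType) (A : set G) (xi : A -> A) (b c : A) n :
  subgroup A -> endomorphism xi -> val c = (val b ^+ n)%g -> val (xi c) = (val (xi b) ^+ n)%g.
Proof.
move=> sA exi; elim: n c => [|n IH] c cE.
  apply: (mulgI (val (xi c))); rewrite -(exi c c c) ?expg0 ?mulg1//.
  by rewrite cE expg0 mulg1.
have [e eE] := set_elt (subgroupX n sA (set_eltP b)).
by rewrite (exi b e c) ?(IH e eE) ?expgS// cE expgS eE.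
Qed.

(** * Coroots with values of p-power order *)

Section PrimePowerCoroot.
Variables (R : realType) (d : nat) (G : TopologyGroup.type).
Variable L : lie_structure R d G.
Hypothesis compactG : compact [set: G].
Variable A : set G.
Hypotheses (finA : finite_set A) (maxA : maximal_abelian A).
Variable alpha : A -> R[i].
Hypothesis chi : character alpha.
Variables (m : nat) (g : A).
Hypotheses (m_gt0 : (0 < m)%N) (g_prim : m.-primitive_root (alpha g))
  (alpha_m : forall a, alpha a ^+ m = 1).

Let sA : subgroup A. Proof. by case: maxA => -[]. Qed.

Notation wvec k Z := (weight_space L [set: G] (multiple alpha k) Z).
Notation texp := (texp L alpha).

Let res (k : int) : nat := `|(k %% m%:Z)%Z|%N.

Let multE k a : multiple alpha k a = alpha a ^+ res k.
Proof. exact: multiple_modz. Qed.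

Let nontrivialP k : nontrivial (multiple alpha k) -> ~~ (m %| res k)%N.
Proof.
move=> [a]; rewrite multE; apply: contra => /dvdnP[c ->].
by rewrite mulnC exprM alpha_m expr1n.
Qed.

Let zeta_dvd i : alpha g ^+ i = 1 -> (m %| i)%N.
Proof. by move=> /eqP; rewrite (prim_order_dvd g_prim). Qed.

Let dvd_alpha a i : (m %| i)%N -> alpha a ^+ i = 1.
Proof. by move=> /dvdnP[c ->]; rewrite mulnC exprM alpha_m expr1n. Qed.

(** Zero summands are discarded, so the new condition has to hold only for nontrivial weights that
    really occur. *)
Lemma texp_sub (P P' : int -> Prop) t :
  (forall k Z, P k -> nontrivial (multiple alpha k) -> wvec k Z -> Z != 0 -> P' k) ->
  texp P t -> texp P' t.
Proof.
move=> PP' [X [gam [[lX [s [Hs sE]]] gX g1]]]; exists X, gam; split => //; split => //.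
exists [seq p <- s | p.2 != 0]; split.
  move=> p; rewrite mem_filter => /andP[p0 /Hs[h1 h2 h3]]; split => //.
  exact: PP' h3 h1 h2 p0.
rewrite big_filter sE [RHS]big_mkcond; apply: eq_bigr => p _.
by case: eqVneq.
Qed.

Lemma texp_empty t : texp (fun=> False) t -> t = 1%g.
Proof.
move=> [X [gam [[_ [s [Hs sE]]] gX <-]]].
have s0 : s = [::] by case: s Hs {sE} => // p s /(_ p); rewrite inE eqxx => /(_ isT)[].
have X0 : X = 0 by apply: toC_inj; rewrite sE s0 big_nil toC0.
by rewrite X0 in gX; rewrite (one_parameter_uniq gX (one_parameter_cst L)).
Qed.

Variable xi : A -> A.
Hypothesis xiP : coroot L [set: G] alpha xi.
Variables (p e : nat).
Hypotheses (p_prime : prime p) (xi_tors : forall a, (val (xi a) ^+ (p ^ e))%g = 1%g).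

(** [m'] is the part of [m] prime to [p]: the multiples of alpha of p-power order are those with
    [m'] dividing [res k]. *)
Let f := logn p m.
Let m' := (m %/ p ^ f)%N.

Let mE : m = (m' * p ^ f)%N.
Proof. by rewrite /m' divnK// pfactor_dvdnn. Qed.

Let m'_gt0 : (0 < m')%N.
Proof. by move: m_gt0; rewrite {1}mE muln_gt0 => /andP[]. Qed.

Let m'_coprime : coprime m' p.
Proof.
have [k ck kE] := pfactor_coprime p_prime m_gt0.
by rewrite /m' {1}kE mulnK ?expn_gt0 ?prime_gt0// coprime_sym.
Qed.

(** The value [t] of xi has p-power order, so [t = (t ^ u) ^ m'] with [u] inverse to [m'] modulo
    [p ^ e]. This exhibits [t] as a norm of length [m'] of an element of the torus. *)
Lemma coroot_p_part a : texp (fun k => (m' %| res k)%N) (val (xi a)).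
Proof.
have [_ _ xiT] := xiP.
have [[u v] /= uv] := coprimeP (p ^ e) m'_gt0 (coprimeXr e m'_coprime).
have uE : (u * m' = 1 + v * p ^ e)%N by lia.
have xE : val (xi a) = ((val (xi a) ^+ u) ^+ m')%g.
  by rewrite -expgnA uE expgnDr expg1 mulnC expgnA xi_tors expg1n mulg1.
(* alpha has order exactly [m'] at [b], so the weights fixed by [b] are those of p-power order. *)
have [b bE] := set_elt (subgroupX (p ^ f) sA (set_eltP g)).
have tu : texp (fun=> True) (val (xi a) ^+ u)%g.
  elim: u {uv uE xE} => [|u IH]; first by rewrite expg0; exact: texp1.
  rewrite expgS; apply: (texpM compactG finA maxA chi m_gt0 alpha_m) => //.
  exact: (root_torus_texp compactG finA maxA chi m_gt0 alpha_m (xiT a)).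
have Au : A (val (xi a) ^+ u)%g by apply: subgroupX => //; exact: set_eltP.
rewrite xE.
apply: (texp_sub _ (texp_norm compactG finA maxA chi m_gt0 alpha_m (b := b) (n := m') Au tu _)).
  move=> k Z [_ kb] _ _ _; move: kb.
  rewrite multE (characterX sA chi bE) -exprM => /zeta_dvd.
  by rewrite {1}mE mulnC dvdn_pmul2l ?expn_gt0 ?prime_gt0.
move=> k _; rewrite multE (characterX sA chi bE) -exprM -exprM; apply: dvd_alpha.
by rewrite mulnA mulnAC [(p ^ f * m')%N]mulnC -mE dvdn_mulr.
Qed.

(** Choose an occurring weight of p-power order with the least [gcdn (res k) m], that is, of the
    largest order. These gcds are [m'] times powers of [p], so they form a chain for divisibility
    and the least one divides all the others. *)
Lemma coroot_trivial_or_weight : (forall a, val (xi a) = 1%g) \/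
  exists k Z, [/\ (m' %| res k)%N, nontrivial (multiple alpha k), wvec k Z, Z != 0 &
    forall l W, (m' %| res l)%N -> nontrivial (multiple alpha l) -> wvec l W -> W != 0 ->
      (gcdn (res k) m %| res l)%N].
Proof.
pose K n := exists k Z, [/\ (m' %| res k)%N, nontrivial (multiple alpha k), wvec k Z, Z != 0 &
  gcdn (res k) m = n].
have [exK|noK] := pselect (exists n, `[< K n >]); last first.
  left=> a; apply: texp_empty; apply: texp_sub (coroot_p_part a) => k Z h1 h2 h3 h4.
  by apply: noK; exists (gcdn (res k) m); apply/asboolP; exists k, Z.
right; have [n0 /asboolP[k [Z [h1 h2 h3 h4 h5]]] n0min] := ex_minnP exK.
exists k, Z; split => // l W l1 l2 l3 l4.
have n0l : (gcdn (res k) m <= gcdn (res l) m)%N.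
  by rewrite h5; apply: n0min; apply/asboolP; exists l, W.
apply: dvdn_trans (dvdn_gcdl (res l) m).
have part k' : (m' %| res k')%N -> exists i, gcdn (res k') m = (m' * p ^ i)%N.
  move=> k'1; have /dvdnP[x xE] : (m' %| gcdn (res k') m)%N.
    by rewrite dvdn_gcd k'1 {1}mE dvdn_mulr.
  have : (gcdn (res k') m %| m)%N by exact: dvdn_gcdr.
  rewrite xE {1}mE mulnC dvdn_pmul2l// => /(dvdn_pfactor _ _ p_prime)[i _ iE].
  by exists i; rewrite iE.
have [i iE] := part k h1; have [i' iE'] := part l l1.
move: n0l; rewrite iE iE' leq_pmul2l// leq_exp2l ?prime_gt1// => ii'.
by rewrite dvdn_pmul2l// dvdn_exp2l.
Qed.

Lemma W_small_id_ext H (s : A -> A) : (forall a, val (s a) = val a) -> W_small L H s.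
Proof.
move=> sid; have -> : s = idfun by apply/funext => a; apply: val_inj; rewrite sid.
exact: W_small_id.
Qed.

Lemma coroot_prime_W_small s : transvection xi s -> W_small L (G_prime L A) s.
Proof.
move=> sP; have [exi xi1 xiT] := xiP.
have [xi0|[k [Z [k1 k2 k3 Z0 kmin]]]] := coroot_trivial_or_weight.
  by apply: W_small_id_ext => a; rewrite sP xi0 mulg1.
pose beta := multiple alpha k.
have r0 : (0 < res k)%N.
  by rewrite lt0n; apply/eqP => r0; have := nontrivialP k2; rewrite r0 dvdn0.
pose n0 := gcdn (res k) m.
have n00 : (0 < n0)%N by rewrite gcdn_gt0 r0.
have [i iE] : exists i, n0 = (m' * p ^ i)%N.
  have /dvdnP[x xE] : (m' %| n0)%N by rewrite dvdn_gcd k1 {1}mE dvdn_mulr.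
  have : (n0 %| m)%N by exact: dvdn_gcdr.
  rewrite xE {1}mE mulnC dvdn_pmul2l// => /(dvdn_pfactor _ _ p_prime)[i _ iE].
  by exists i; rewrite iE mulnC.
have if_ : (i <= f)%N.
  have : (n0 %| m)%N by exact: dvdn_gcdr.
  by rewrite iE {1}mE dvdn_pmul2l// dvdn_Pexp2l// prime_gt1.
pose j := (f - i)%N.
(* [p ^ j] is the order of beta. *)
have mn0 : m = (n0 * p ^ j)%N by rewrite iE -mulnA -expnD subnKC.
have j0 : (0 < j)%N.
  rewrite lt0n; apply/eqP => j0; have := nontrivialP k2.
  by rewrite {1}mn0 j0 expn0 muln1 dvdn_gcdl.
have [k'' kE] := dvdnP (dvdn_gcdl (res k) m); rewrite -/n0 in kE.
have ck'' : coprime (p ^ j) k''.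
  rewrite coprime_sym /coprime -(eqn_pmul2r n00) muln_gcdl -kE [(p ^ j * n0)%N]mulnC -mn0 mul1n.
  by rewrite -/n0 eqxx.
have betaX a n : beta a ^+ n = alpha a ^+ (res k * n) by rewrite /beta multE exprM.
have beta_q a : beta a ^+ (p ^ j) = 1.
  by rewrite betaX; apply: dvd_alpha; rewrite {1}mn0 dvdn_mul// dvdn_gcdl.
have beta_char : character beta.
  split => [a|a b c cE]; first by rewrite /beta multE normrX; case: chi => -> _; rewrite expr1n.
  by rewrite /beta !multE (characterM chi cE) exprMn.
have Zbeta (a : A) : Z *m toC (Ad L (val a)) = beta a *: Z by case: k3 => _; apply.
have p_dvd : (p %| Ad_order L A)%N.
  have := weight_Ad_order finA sA beta_char Zbeta Z0 g.
  rewrite betaX => /zeta_dvd; rewrite {1}mn0 kE mulnAC mulnC dvdn_pmul2r// Gauss_dvdr//.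
  by apply: dvdn_trans; rewrite -(prednK j0) expnS dvdn_mulr.
have fix_h (h : A) : p_kernel L A p (val h) -> beta h = 1.
  exact: (p_kernel_weight finA sA Zbeta Z0 p_prime (beta_q h)).
(* These are the weights that are multiples of beta, by a Bezout relation between [res k] and [m].
   By the choice of beta, every p-power weight that occurs is among them. *)
pose P l := (n0 %| res l)%N.
have tP a : texp P (val (xi a)).
  apply: texp_sub (coroot_p_part a) => l W l1 l2 l3 l4; exact: kmin l1 l2 l3 l4.
have Pbeta l : P l -> exists c, multiple alpha l = multiple beta c.
  move=> /dvdnP[x xE]; have [u _ /dvdnP[v vE]] := Bezoutl m r0; rewrite -/n0 in vE.
  exists (v * x)%N%:Z; apply/funext => a.
  have E : alpha a ^+ (u * m * x) = 1 by apply: dvd_alpha; rewrite mulnAC dvdn_mull.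
  rewrite [RHS]/multiple -exprnP betaX multE xE mulnA [(res k * v)%N]mulnC -vE mulnDl exprD.
  by rewrite E mulr1 mulnC.
have wfix l W h : P l -> wvec l W -> p_kernel L A p h -> W *m toC (Ad L h) = W.
  move=> Pl [_ lW] hk; have Ah : A h by case: hk.
  have [b bE] := set_elt Ah; have [c cE] := Pbeta l Pl.
  rewrite -bE in hk *; rewrite lW cE /multiple fix_h// exp1rz scale1r.
  by [].
have refix l W : P l -> wvec l W -> lie_algebraC L (G_prime L A) W.
  move=> Pl lW; have [[[gam gW _] [gam' gW' _]] _] := lW.
  split; [exists gam => //|exists gam' => //].
    apply: (one_parameter_G_prime p_prime p_dvd gW) => h hk.
    by rewrite -/(reM W) -reM_mul (wfix l).
  apply: (one_parameter_G_prime p_prime p_dvd gW') => h hk.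
  by rewrite -/(imM W) -imM_mul (wfix l).
(* Take the norm of length [p ^ j] along [g]: it kills all multiples of beta that are nontrivial at
   [g], and a weight trivial at [g] is trivial on [A], so no exponent is left. *)
have torsion a : (val (xi a) ^+ (p ^ j))%g = 1%g.
  apply: texp_empty; apply: texp_sub (texp_norm compactG finA maxA chi m_gt0 alpha_m
    (b := g) (n := (p ^ j)%N) (set_eltP (xi a)) (tP a) _).
    move=> l W [_ lg] l2 _ _; move: lg; rewrite multE => /zeta_dvd.
    by apply/negP; exact: nontrivialP.
  move=> l Pl; rewrite multE -exprM; apply: dvd_alpha.
  by rewrite {1}mn0 dvdn_mul.
(* If [beta a = 1], then [alpha a] is the value of alpha at a [p ^ j]-th power [c]. So [a] is [c]
   times an element of the kernel of alpha, and xi kills both factors. *)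
have xi_beta a : beta a = 1 -> val (xi a) = 1%g.
  move=> ba; have [[t t_lt] /= oE] := prim_rootP g_prim (alpha_m a).
  have po : (p ^ j %| t)%N.
    move: ba; rewrite /beta multE oE -exprM => /zeta_dvd.
    by rewrite {1}mn0 kE mulnA mulnC dvdn_pmul2r// Gauss_dvdl.
  have [t' t'E] := dvdnP po.
  have [b bE] := set_elt (subgroupX t' sA (set_eltP g)).
  have [c cE] := set_elt (subgroupX (p ^ j) sA (set_eltP b)).
  have xic : val (xi c) = 1%g by rewrite (endomorphismX sA exi cE) torsion.
  have ac : alpha c = alpha a.
    by rewrite (characterX sA chi cE) (characterX sA chi bE) -exprM -t'E oE.
  have [c' c'E] : exists c' : A, val c' = (val c)^-1%g.
    by apply: set_elt; case: sA => _ _; apply; exact: set_eltP.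
  have [y yE] : exists y : A, val y = (val a * val c')%g.
    by apply: set_elt; case: sA => _ AM _; apply: AM; exact: set_eltP.
  have ay : alpha y = 1.
    by rewrite (characterM chi yE) (characterV sA chi c'E) ac divff// (character_neq0 chi).
  have ae : val a = (val y * val c)%g by rewrite yE c'E mulgVK.
  by rewrite (exi y c a ae) xi1// xic mulg1.
have beta_root : weight_root L (G_prime L A) beta.
  split; [exact: beta_char|exact: k2|exists Z; last exact: Z0].
  by split; [exact: (refix k Z (dvdn_gcdl _ _) k3)|exact: Zbeta].
suff beta_coroot : coroot L (G_prime L A) beta xi by exact: W_small_gen beta_root beta_coroot sP.
split; [exact: exi|exact: xi_beta|move=> a].
apply: (texp_root_torus (P := P)) (tP a).
  move=> X gam [_ [r [Hr rE]]] gX; apply: (one_parameter_G_prime p_prime p_dvd gX) => h hk.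
  apply: toC_inj; rewrite toC_mul rE mulmx_suml big_seq [RHS]big_seq.
  apply: eq_bigr => q /Hr[h1 h2 h3].
  exact: wfix h3 h2 hk.
move=> l Pl l2; have [c cE] := Pbeta l Pl; exists c; split; first exact: cE.
move=> W lW; split; first exact: refix Pl lW.
by rewrite -cE; case: lW.
Qed.

End PrimePowerCoroot.

(** * Comparison of the small Weyl groups *)

Section Assembly.
Variables (R : realType) (d : nat) (G : TopologyGroup.type).
Variable L : lie_structure R d G.
Variable A : set G.

Lemma generated_mono (S S' : set G) : S `<=` S' -> generated S `<=` generated S'.
Proof. by move=> SS' x xS K [sK S'K]; apply: xS; split => //; exact: subset_trans S'K. Qed.

Lemma generated_subgroup (S : set G) : subgroup (generated S).
Proof.
split.
- by move=> K [[K1 _ _] _].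
- by move=> x y xS yS K KS; have [[_ KM _] _] := KS; apply: KM; [exact: xS|exact: yS].
- by move=> x xS K KS; have [[_ _ KV] _] := KS; apply: KV; exact: xS.
Qed.

Lemma weight_space_mono H (lambda : A -> R[i]) :
  weight_space L H lambda `<=` weight_space L [set: G] lambda.
Proof.
move=> Z [[[gam h1 _] [gam' h2 _]] h]; split => //.
by split; [exists gam|exists gam'].
Qed.

Lemma W_small_mono H : W_small L H (A := A) `<=` W_small L [set: G] (A := A).
Proof.
move=> s; elim => {s} [alpha xi s [chi nt [Z ZH Z0]] [h1 h2 h3] sP| |f g _ hf _ hg|f g _ hf fg gf].
- have ra : weight_root L [set: G] alpha.
    by split => //; exists Z => //; exact: weight_space_mono ZH.
  have ca : coroot L [set: G] alpha xi.
    split; [exact: h1|exact: h2|move=> a].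
    apply: generated_mono (h3 a) => x [X [gam [[[gam' h4 _] [n [k [Y [h5 h6 h7]]]]] h8 h9]]].
    exists X, gam; split => //; split; first by exists gam'.
    by exists n, k, Y; split => // i; exact: weight_space_mono (h6 i).
  exact: W_small_gen ra ca sP.
- exact: W_small_id.
- exact: W_small_comp.
- exact: W_small_inv hf fg gf.
Qed.

Hypothesis compactG : compact [set: G].
Hypotheses (finA : finite_set A) (maxA : maximal_abelian A).

Let sA : subgroup A. Proof. by case: maxA => -[]. Qed.
Let cA x y : A x -> A y -> (x * y)%g = (y * x)%g.
Proof. by case: maxA => -[_ c _]; exact: c. Qed.

Lemma coroot_character1 (alpha : A -> R[i]) (xi : A -> A) a :
  weight_root L [set: G] alpha -> coroot L [set: G] alpha xi -> alpha (xi a) = 1.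
Proof.
move=> [chi nt [Z [lZ Za] Z0]] [_ _ xiT].
have [m [g [m0 gp am]]] := character_cyclic sA chi finA.
have a1 : multiple alpha 1 = alpha by apply/funext => b; rewrite /multiple expr1z.
have := texp_wvec_fix compactG finA maxA chi m0 am (k := 1) (Z := Z)
  (root_torus_texp compactG finA maxA chi m0 am (xiT a)).
rewrite a1 => /(_ nt (conj lZ Za)); rewrite Za => /eqP.
by rewrite -subr_eq0 -{2}[Z]scale1r -scalerBl scaler_eq0 (negPf Z0) orbF subr_eq0 => /eqP.
Qed.

Lemma coroot_W_small (alpha : A -> R[i]) (xi s : A -> A) : weight_root L [set: G] alpha ->
  coroot L [set: G] alpha xi -> transvection xi s -> W_small L (G_prime L A) s.
Proof.
move=> ra ca sP; have xi_ker a := coroot_character1 a ra ca.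
have [chi nt _] := ra; have [exi xi1 xiT] := ca.
have [m [g [m0 gp am]]] := character_cyclic sA chi finA.
have Axi c a : A (val (xi a) ^+ c)%g by apply: subgroupX => //; exact: set_eltP.
pose xic c a : A := sval (cid (set_elt (Axi c a))).
have xicE c a : val (xic c a) = (val (xi a) ^+ c)%g by rewrite /xic; case: cid.
have Asc c a : A (val a * val (xic c a))%g.
  by case: sA => _ AM _; apply: AM; exact: set_eltP.
pose sc c a : A := sval (cid (set_elt (Asc c a))).
have scE c a : val (sc c a) = (val a * val (xi a) ^+ c)%g.
  by rewrite -xicE /sc; case: cid.
(* As alpha is trivial on the values of xi, xi is trivial on them too; the transvections [sc c]
   therefore compose additively in [c]. *)
have xi_sc c a : xi (sc c a) = xi a.
  have scE' : val (sc c a) = (val a * val (xic c a))%g by rewrite scE xicE.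
  apply: val_inj; rewrite (exi _ _ _ scE').
  rewrite (endomorphismX sA exi (xicE c a)).
  by rewrite (xi1 _ (xi_ker a)) expg1n mulg1.
have scD c c' : sc (c + c')%N = sc c \o sc c'.
  apply/funext => a; apply: val_inj; rewrite /= !scE xi_sc.
  by rewrite addnC expgnDr mulgA.
have xim a : (val (xi a) ^+ m)%g = 1%g.
  have [b bE] := set_elt (subgroupX m sA (set_eltP a)).
  by rewrite -(endomorphismX sA exi bE) xi1// (characterX sA chi bE).
(* The exponents [c] for which the transvection of the power [xi ^ c] lies in the group for G'. They
   are closed under sums and contain the multiples of [m]; the goal is [c = 1]. *)
pose I c := W_small L (G_prime L A) (sc c).
have I0 c : (m %| c)%N -> I c.
  move=> /dvdnP[x ->]; apply: W_small_id_ext => a.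
  by rewrite scE mulnC expgnA xim expg1n mulg1.
have ID c c' : I c -> I c' -> I (c + c')%N by rewrite /I scD; exact: W_small_comp.
have IM c k : I c -> I (c * k)%N.
  move=> Ic; elim: k => [|k IH]; last by rewrite mulnS; exact: ID.
  by rewrite muln0; apply: I0; rewrite dvdn0.
have Iprime c p e : prime p -> (m %| c * p ^ e)%N -> I c.
  move=> pp mc.
  have cc : coroot L [set: G] alpha (xic c).
    split.
    - move=> a b a' a'E; rewrite !xicE (exi _ _ _ a'E) expgMn//.
      exact: cA (set_eltP (xi a)) (set_eltP (xi b)).
    - by move=> a a1; rewrite xicE xi1// expg1n.
    - by move=> a; rewrite xicE; apply: subgroupX (xiT a); exact: generated_subgroup.
  apply: (coroot_prime_W_small compactG finA maxA chi m0 gp am cc pp (e := e)).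
    by move=> a; rewrite xicE -expgnA; have /dvdnP[x ->] := mc; rewrite mulnC expgnA xim expg1n.
  by move=> a; rewrite scE xicE.
(* Induction on [n], which kills [xi ^ u]. Split off a primary factor [n = n' * p ^ e]: the exponent
   [u * p ^ e] is reached by induction, [u * n'] by the prime power case, and a Bezout relation
   recovers [u] modulo [m]. *)
have Iall n : (0 < n)%N -> forall u, (u * n = m)%N -> I u.
  elim/ltn_ind: n => n IH n0 u un.
  have [n1|n1] := leqP n 1.
    have n1' : n = 1%N by apply/eqP; rewrite eqn_leq n1.
    by apply: I0; rewrite -un n1' muln1.
  have pp := pdiv_prime n1; set p := pdiv n in pp.
  have pn : (p %| n)%N := pdiv_dvd n.
  have [n' cn nE] := pfactor_coprime pp n0; set e := logn p n in nE.
  have e0 : (0 < e)%N by rewrite /e logn_gt0 mem_primes pp n0.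
  have pe1 : (1 < p ^ e)%N by rewrite -(exp1n e) ltn_exp2r// prime_gt1.
  have n'0 : (0 < n')%N by move: n0; rewrite nE muln_gt0 => /andP[].
  have I1 : I (u * p ^ e)%N.
    apply: (IH n') => //; first by rewrite nE ltn_Pmulr.
    by rewrite -mulnA [(p ^ e * n')%N]mulnC -nE.
  have I2 : I (u * n')%N.
    by apply: (Iprime _ p e pp); rewrite -mulnA -nE un.
  have pe0 : (0 < p ^ e)%N by exact: ltnW.
  have [[x y] /= xy] := coprimeP n' pe0 (coprimeXl e cn).
  have xE : (x * p ^ e = 1 + y * n')%N by lia.
  have I3 : I (u + y * m)%N.
    (* To avoid a negative coefficient, [- y] is replaced by [y * (p ^ e).-1]; the two differ by
       [y * p ^ e], which contributes [y * m]. *)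
    have -> : (u + y * m = u * p ^ e * x + u * n' * (y * (p ^ e).-1))%N.
      rewrite -mulnA [(p ^ e * x)%N]mulnC xE -un nE.
      by move: (p ^ e)%N pe0 => [//|q] _ /=; ring.
    by apply: ID; exact: IM.
  have scu : sc (u + y * m)%N = sc u.
    apply/funext => a; apply: val_inj; rewrite !scE expgnDr [(y * m)%N]mulnC expgnA xim.
    by rewrite expg1n mulg1.
  by rewrite /I -scu.
have -> : s = sc 1%N by apply/funext => a; apply: val_inj; rewrite sP scE expg1.
by apply: (Iall m) => //; rewrite mul1n.
Qed.

End Assembly.

Theorem theorem4p4 (R : realType) (d : nat) (G : TopologyGroup.type)
    (L : lie_structure R d G) (compactG : compact [set: G])
    (A : set G) (finA : finite_set A) (maxA : maximal_abelian A) :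
  W_small L (G_prime L A) (A := A) = W_small L [set: G] (A := A).
Proof.
apply/seteqP; split; first exact: W_small_mono.
move=> s; elim => {s} [alpha xi s|  |f g _ hf _ hg|f g _ hf fg gf].
- exact: coroot_W_small.
- exact: W_small_id.
- exact: W_small_comp.
- exact: W_small_inv hf fg gf.
Qed.
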